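(* Let $(m,n)=(3,9)$ and let $\Lambda=de_0-\nu_1e_1-\dots-\nu_9e_9\in M_{3,9}$. Define the homogeneous polynomial of degree $d$ in $x=(x_1,x_2,x_3)$ $$F(\Lambda;x)=\det\big(\mathbf{m}_d^{(\nu_1-1)}(p_1),\dots,\mathbf{m}_d^{(\nu_9-1)}(p_9),\mathbf{m}_d(x)\big).$$ Then $F(\Lambda;x^C(t))=C_\Lambda\,[\lambda-t]\prod_{j=1}^9[\varepsilon_j-t]^{\nu_j}$ with $\lambda=\langle\Lambda,\cdot\rangle$ and a nonzero constant $C_\Lambda\in\mathbb{K}$ (independent of $t$), and $\phi(\Lambda;x)=C_\Lambda^{-1}F(\Lambda;x)$.
   Context: $[x]$ is a fixed nonzero odd holomorphic function on $\mathbb{C}$ satisfying $[x+y][x-y][u+v][u-v]=[x+u][x-u][y+v][y-v]-[x+v][x-v][y+u][y-u]$. $L_{3,9}=\bigoplus_{j=0}^9\mathbb{Z}e_j$, $\mathfrak{h}=L_{3,9}\otimes\mathbb{C}$, with $\langle e_0,e_0\rangle=-1$, $\langle e_j,e_j\rangle=1$ ($j\ge1$), $\langle e_i,e_j\rangle=0$ ($i\ne j$); $\varepsilon_j=\langle e_j,\cdot\rangle$, $\varepsilon_{ij}=\varepsilon_i-\varepsilon_j$, $\varepsilon_{ijk}=\varepsilon_0-\varepsilon_i-\varepsilon_j-\varepsilon_k$; $h_0=e_0-e_1-e_2-e_3$, $h_k=e_k-e_{k+1}$ ($1\le k\le8$), $\alpha_k=\langle h_k,\cdot\rangle$ (so $\alpha_0=\varepsilon_{123}$).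 $W_{3,9}=\langle s_0,\dots,s_8\rangle$ is the affine Weyl group of type $E_8^{(1)}$ acting on $L_{3,9}$ by $s_k.\Lambda=\Lambda-\langle h_k,\Lambda\rangle h_k$ and on $\mathfrak{h}^*$ by $s_k.\lambda=\lambda-\langle h_k,\lambda\rangle\alpha_k$. $\mathbb{K}$ is the field of meromorphic functions on $\mathfrak{h}$ generated by $[\alpha]:h\mapsto[\alpha(h)]$ for real roots $\alpha\in W_{3,9}\{\alpha_0,\dots,\alpha_8\}$, with $w([\alpha])=[w.\alpha]$. $W_{3,9}$ acts on $\mathcal{L}=\mathbb{K}(f_1,f_2,f_3;\tau_1,\dots,\tau_9)$ by: $s_0(f_i)=1/f_i$, $s_0(\tau_j)=\tau_jf_j$ ($j\le3$), $s_0(\tau_j)=\tau_j$ ($j\ge4$); for $k\ge1$, $s_k(\tau_j)=\tau_{s_k(j)}$ with $s_k(j)$ the image of $j$ under the transposition $(k,k+1)$; $s_1,s_2$ permute $f_1,f_2,f_3$ accordingly; $s_k(f_i)=f_i$ for $4\le k\le8$; and $s_3(f_3)=\frac{\tau_3}{\tau_4}f_3$, $s_3(f_i)=\frac{\tau_3}{\tau_4}\cdot\frac{[\alpha_0+\varepsilon_{34}][\varepsilon_{i4}]f_i-[\alpha_0+\varepsilon_{i4}][\varepsilon_{34}]f_3}{[\alpha_0][\varepsilon_{i3}]}$ for $i=1,2$. $M_{3,9}=W_{3,9}\{e_1,\dots,e_9\}=\{\Lambda\in L_{3,9}:\langle c,\Lambda\rangle=-1,\ \langle\Lambda,\Lambda\rangle=1\}$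 with $c=3e_0-e_1-\dots-e_9$. The lattice $\tau$-function is $\tau(\Lambda)=w(\tau_9)$ for any $w$ with $w.e_9=\Lambda$. Introduce indeterminates $\tau_0,x_1,x_2,x_3$ with $f_i=\tau_0x_i/(\tau_1\tau_2\tau_3)$; for $\Lambda=de_0-\sum\nu_je_j\in M_{3,9}$ one has $\tau(\Lambda)=\tau_0^d\tau_1^{-\nu_1}\cdots\tau_9^{-\nu_9}\,\phi(\Lambda;x)$ with $\phi(\Lambda;x)$ a homogeneous polynomial of degree $d$ in $x$ with coefficients in $\mathbb{K}$; this defines $\phi(\Lambda;x)$. Reference points: $x(p_j)=([\varepsilon_{23j}][\varepsilon_{2j}][\varepsilon_{3j}]:[\varepsilon_{13j}][\varepsilon_{1j}][\varepsilon_{3j}]:[\varepsilon_{12j}][\varepsilon_{1j}][\varepsilon_{2j}])$, $j=1,\dots,9$ (where $\varepsilon_{ijk}$ with a repeated index is still $\varepsilon_0-\varepsilon_i-\varepsilon_j-\varepsilon_k$). Canonical solution: $x^C(t)=(x^C_1(t),x^C_2(t),x^C_3(t))$ with $x^C_i(t)=[\alpha_0+\varepsilon_i-t]\prod_{k\in\{1,2,3\},k\ne i}[\varepsilon_k-t]$, $t\in\mathbb{C}$. $\mathbf{m}_d(x)$ is the column vector of the $\binom{d+2}{2}$ monomials $x_1^{\mu_1}x_2^{\mu_2}x_3^{\mu_3}$, $\mu_1+\mu_2+\mu_3=d$ (in a fixed order); for $k\ge0$, $\mathbf{m}^{(k)}_d(x)$ is the $\binom{d+2}{2}\times\binom{k+2}{2}$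 matrix whose columns are $\partial_{x_1}^{\kappa_1}\partial_{x_2}^{\kappa_2}\partial_{x_3}^{\kappa_3}\mathbf{m}_d(x)$ for $|\kappa|=k$; for $k<0$ it is the empty matrix; $\mathbf{m}^{(k)}_d(p_j)$ is its value at $x=x(p_j)$. For $\Lambda\in M_{3,9}$ the total number of columns in the determinant equals $\binom{d+2}{2}$. *)

(* Defs.v *)
From HB Require Import structures.
From mathcomp Require Import all_boot all_order all_algebra.
From mathcomp Require Import reals.
From mathcomp Require Import complex.
Set Implicit Arguments. Unset Strict Implicit. Unset Printing Implicit Defensive.
Import Order.TTheory GRing.Theory Num.Theory.
Local Open Scope ring_scope.

Section Defs.
Variable R : realType.
Local Notation C := R[i].

Definition holomorphic (g : C -> C) : Prop :=
  forall z, exists l : C, forall e : C, 0 < e -> exists d : C, 0 < d /\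
    forall w : C, 0 < `|w| < d -> `|(g (z + w) - g z) / w - l| < e.

Definition bracket_fn (th : C -> C) : Prop :=
  [/\ holomorphic th,
      (exists z, th z != 0),
      (forall z, th (- z) = - th z) &
      (forall x y u v : C,
        th (x + y) * th (x - y) * th (u + v) * th (u - v) =
        th (x + u) * th (x - u) * th (y + v) * th (y - v)
        - th (x + v) * th (x - v) * th (y + u) * th (y - u))].

(* For meromorphic functions given by formulas, an identity of meromorphic *)
(* functions is equivalent to pointwise equality on a dense open set.      *)
Definition near_pt n (z w : 'I_n -> C) (e : C) := forall i, `|w i - z i| < e.

Definition generic n (P : ('I_n -> C) -> Prop) : Prop :=
  exists U : ('I_n -> C) -> Prop,
    [/\ (forall z, U z -> exists e, 0 < e /\ forall w, near_pt z w e -> U w),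
        (forall z e, 0 < e -> exists w, near_pt z w e /\ U w) &
        (forall z, U z -> P z)].

Definition lpart m n (z : 'I_(m + n) -> C) : 'I_m -> C := fun i => z (lshift n i).
Definition rpart m n (z : 'I_(m + n) -> C) : 'I_n -> C := fun j => z (rshift m j).

Definition lat := 'I_10 -> int.
Definition evec (j : nat) : lat := fun i => (i == j :> nat)%:Z.
Definition lip (v w : lat) : int :=
  - (v ord0 * w ord0) + \sum_(i < 10 | i != ord0) v i * w i.
Definition hk (k : 'I_9) : lat :=
  if val k == 0%N then fun i => evec 0 i - evec 1 i - evec 2 i - evec 3 i
  else fun i => evec k i - evec k.+1 i.
Definition sZ (k : 'I_9) (v : lat) : lat := fun i => v i - lip (hk k) v * hk k i.
(* a word [:: i1; ...; ir] stands for w = s_{i1} ... s_{ir} *)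
Definition actZ (w : seq 'I_9) (v : lat) : lat := foldr sZ v w.
Definition inM (L : lat) : Prop := exists (w : seq 'I_9) (j : 'I_9), actZ w (evec j.+1) =1 L.

(* h = L (x) C = C^10; pairing <v, h> for v in L_{3,9}.                    *)
Definition hpt := 'I_10 -> C.
Definition ipC (v : lat) (h : hpt) : C :=
  - ((v ord0)%:~R * h ord0) + \sum_(i < 10 | i != ord0) (v i)%:~R * h i.
Definition eps (j : nat) (h : hpt) : C := ipC (evec j) h.
Definition eps2 (i j : nat) h := eps i h - eps j h.
Definition eps3 (i j k : nat) h := eps 0 h - eps i h - eps j h - eps k h.
Definition alpha0 (h : hpt) : C := ipC (hk ord0) h.
Definition sh (k : 'I_9) (h : hpt) : hpt := fun i => h i - ipC (hk k) h * (hk k i)%:~R.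

(* The field K: the subfield of meromorphic functions on h generated by    *)
(* the [alpha], alpha a real root, i.e. alpha = w.alpha_k (= <w.h_k, .>).  *)
Inductive Kexp : Type :=
| Kone : Kexp
| Kbr : seq 'I_9 -> 'I_9 -> Kexp
| Kadd : Kexp -> Kexp -> Kexp
| Kopp : Kexp -> Kexp
| Kmul : Kexp -> Kexp -> Kexp
| Kinv : Kexp -> Kexp.

Variable th : C -> C.

Fixpoint Keval (a : Kexp) (h : hpt) : C :=
  match a with
  | Kone => 1
  | Kbr w k => th (ipC (actZ w (hk k)) h)
  | Kadd a b => Keval a h + Keval b h
  | Kopp a => - Keval a h
  | Kmul a b => Keval a h * Keval b h
  | Kinv a => (Keval a h)^-1
  end.

Definition inK (c : hpt -> C) : Prop := exists a : Kexp, forall h, c h = Keval a h.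

(* The field L = K(f_1,f_2,f_3; tau_1..tau_9), elements seen as functions  *)
(* of (h, f, tau); f i = f_{i+1}, tau j = tau_{j+1}.                       *)
Definition Lfun := hpt -> ('I_3 -> C) -> ('I_9 -> C) -> C.

Definition swapn (a b j : nat) : nat := if j == a then b else if j == b then a else j.

Definition sf (k : 'I_9) (h : hpt) (f : 'I_3 -> C) (tau : 'I_9 -> C) : 'I_3 -> C :=
  match val k with
  | 0 => fun i => (f i)^-1
  | 1 => fun i => f (inord (swapn 0 1 i))
  | 2 => fun i => f (inord (swapn 1 2 i))
  | 3 => fun i =>
      let r := tau (inord 2) / tau (inord 3) in
      if val i == 2%N then r * f i
      else r * (th (alpha0 h + eps2 3 4 h) * th (eps2 i.+1 4 h) * f i
                - th (alpha0 h + eps2 i.+1 4 h) * th (eps2 3 4 h) * f (inord 2))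
             / (th (alpha0 h) * th (eps2 i.+1 3 h))
  | _ => f
  end.

Definition stau (k : 'I_9) (h : hpt) (f : 'I_3 -> C) (tau : 'I_9 -> C) : 'I_9 -> C :=
  if val k == 0%N then fun j => if (val j < 3)%N then tau j * f (inord j) else tau j
  else fun j => tau (inord (swapn k.-1 k j)).

(* s_k acting on L (extending s_k([alpha]) = [s_k.alpha] on K) *)
Definition sL (k : 'I_9) (P : Lfun) : Lfun :=
  fun h f tau => P (sh k h) (sf k h f tau) (stau k h f tau).
Definition actL (w : seq 'I_9) (P : Lfun) : Lfun := foldr sL P w.

Definition tauw (w : seq 'I_9) : Lfun := actL w (fun _ _ tau => tau ord_max).

Definition expo := (nat * nat * nat)%type.
Definition mons (d : nat) : seq expo :=
  flatten [seq [seq (a, b, d - a - b)%N | b <- iota 0 (d - a).+1] | a <- iota 0 d.+1].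

Definition cx (x : C * C * C) (i : nat) : C :=
  match i with 0 => x.1.1 | 1 => x.1.2 | _ => x.2 end.
Definition ce (m : expo) (i : nat) : nat :=
  match i with 0 => m.1.1 | 1 => m.1.2 | _ => m.2 end.

(* (d_{x1}^k1 d_{x2}^k2 d_{x3}^k3 x^mu) at x *)
Definition dmon (kap mu : expo) (x : C * C * C) : C :=
  \prod_(i < 3) (((ce mu i) ^_ (ce kap i))%:R * cx x i ^+ (ce mu i - ce kap i)).

Definition pt (j : nat) (h : hpt) : C * C * C :=
  (th (eps3 2 3 j h) * th (eps2 2 j h) * th (eps2 3 j h),
   th (eps3 1 3 j h) * th (eps2 1 j h) * th (eps2 3 j h),
   th (eps3 1 2 j h) * th (eps2 1 j h) * th (eps2 2 j h)).

Definition dcols (k : int) (j : nat) (h : hpt) : seq (expo -> C) :=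
  match k with
  | Posz kn => [seq (fun mu => dmon kap mu (pt j h)) | kap <- mons kn]
  | Negz _ => [::]
  end.

Definition degL (L : lat) : nat := `|L ord0|%N.
Definition nuL (L : lat) (j : nat) : int := - L (inord j).

Definition Fcols (L : lat) (h : hpt) (x : C * C * C) : seq (expo -> C) :=
  flatten [seq dcols (nuL L j - 1) j h | j <- iota 1 9]
  ++ [:: fun mu => dmon (0, 0, 0)%N mu x].

Definition Fmat (L : lat) (h : hpt) (x : C * C * C) :
    'M[C]_('C((degL L).+2, 2)) :=
  \matrix_(r, c) nth (fun _ => 0) (Fcols L h x) c
                   (nth (0, 0, 0)%N (mons (degL L)) r).

Definition FL (L : lat) (h : hpt) (x : C * C * C) : C := \det (Fmat L h x).

Definition xC (h : hpt) (t : C) : C * C * C :=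
  (th (alpha0 h + eps 1 h - t) * th (eps 2 h - t) * th (eps 3 h - t),
   th (alpha0 h + eps 2 h - t) * th (eps 1 h - t) * th (eps 3 h - t),
   th (alpha0 h + eps 3 h - t) * th (eps 1 h - t) * th (eps 2 h - t)).

End Defs.

(* Main.v *)
Require Import Defs.
From HB Require Import structures.
From mathcomp Require Import all_boot all_order all_algebra.
From mathcomp Require Import perm.
From mathcomp Require Import boolp reals complex.
From mathcomp Require Import zify ring.
Set Implicit Arguments. Unset Strict Implicit. Unset Printing Implicit Defensive.
Import Order.TTheory GRing.Theory Num.Theory.
Local Open Scope ring_scope.

(* For generic h the forms of degree d vanishing to order nu_j at the p_j(h)   *)
(* form a line: each s_k acts on the x-plane by a Cremona map (standard        *)
(* quadratic for k = 0, linear for k >= 1) carrying the p_j(h) to the          *)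
(* p_j(s_k h), hence the linear system of Lambda at s_k h injects into that of *)
(* s_k Lambda at h, and by induction on a word of w all of them are as small   *)
(* as that of e_9, i.e. the constants. The forms phi(Lambda; x), built by the  *)
(* same induction, and F(Lambda; x) lie in this line, and F is nonzero since   *)
(* otherwise its vanishing conditions would admit a second solution. The       *)
(* Riemann relation says that these Cremona maps preserve the curve x^C, which *)
(* passes through p_j at t = eps_j; this evaluates phi, hence F, on x^C.       *)
(* No analytic continuation is needed: the zeros of [.] are nowhere dense as a *)
(* consequence of the functional equation and of continuity.                   *)

(** * Zeros of the bracket *)

(** Fix a word [w0] carrying e_9 to Lambda. The proof rests on [linsys L h], the space of degree-d
    forms with multiplicities nu_j at the p_j(h), being a line for generic [h].

    It is at most a line ([linsys_dim1]): pulling forms back along s_k is injective and sends the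
    system of s_k Lambda at h into that of Lambda at s_k h ([linsys_act] for the linear maps,
    [linsys_cremona] for the quadratic one), so along a word two forms for Lambda become two
    constants for e_9. It is nonzero: [phi_exists] builds along the word a form with coefficients in
    K that lies in the system, represents [tauw], and takes on x^C(t) the value [lambda - t] prod_j
    [eps_j - t]^{nu_j}, a nonzero value for suitable t ([phi_neq0]).

    F lies in the same line: pairing its coefficients with one of its columns gives a determinant
    with two equal columns ([linsys_Fcoef]), and Euler's identity recovers the derivatives of lower
    order ([vanish_deriv]). If the coefficient of F at a monomial present in phi were zero, the left
    kernel of a singular matrix would supply a form of the system independent of phi ([Fcoef_neq0]).
    Hence F = C phi with C nonzero ([Fcoef_phi]), and F on x^C is known from phi. The value on x^C
    also normalises phi, so every word for Lambda yields the same form ([phi_uniq]). Finally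
    [kratio] writes C as one element of K.

    All of this is pointwise, at points where the brackets met along the word do not vanish;
    [bracket_dense] and [odense_pull] show that such points are generic. *)

Section Density.
Variable R : realType.
Local Notation C := R[i].

Lemma complex_archi (x e : C) : 0 <= x -> 0 < e -> exists n, x < e * n.+1%:R.
Proof.
move=> x0 e0; set y := x / e.
have y0 : 0 <= y by rewrite divr_ge0 // ltW.
have yE : y = (complex.Re y)%:C%C by rewrite RRe_real // ger0_real.
exists (Num.Def.archi_bound (complex.Re y)).
rewrite mulrC -ltr_pdivrMr // -/y yE -(rmorph_nat (real_complex R)) ltcR.
have := archi_boundP (_ : 0 <= complex.Re y).
rewrite -ler0c -yE => /(_ y0) /lt_trans -> //.
by rewrite ltr_nat.
Qed.

(** The order on C is partial, but positive elements are real, hence comparable. *)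
Lemma pos_min (a b : C) : 0 < a -> 0 < b -> exists c : C, [/\ 0 < c, c <= a & c <= b].
Proof.
move=> a0 b0; case: (real_leP (gtr0_real a0) (gtr0_real b0)) => h.
  by exists a.
by exists b; split => //; exact: ltW.
Qed.

Lemma lt_normD (a b c d : C) : `|a| < c -> `|b| < d -> `|a + b| < c + d.
Proof. by move=> h1 h2; apply: le_lt_trans (ler_normD _ _) _; apply: ltrD. Qed.

Lemma half_pos (e : C) : 0 < e -> 0 < e / 2.
Proof. by move=> e0; rewrite divr_gt0 // ltr0n. Qed.

Lemma norm_half (x : C) : `|x / 2| = `|x| / 2.
Proof. by rewrite normrM normfV normr_nat. Qed.

Lemma holomorphic_continuous (g : C -> C) : holomorphic g -> forall z e : C, 0 < e ->
  exists d : C, 0 < d /\ forall w, `|w - z| < d -> `|g w - g z| < e.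
Proof.
move=> hg z e e0; have [l /(_ 1 ltr01) [d [d0 hd]]] := hg z.
have l0 : 0 < 1 + `|l| by rewrite ltr_wpDr.
have [c [c0 cd ce]] := pos_min d0 (divr_gt0 e0 l0).
exists c; split=> // w hw.
have [->|nz] := eqVneq w z; first by rewrite subrr normr0.
have nz' : 0 < `|w - z| by rewrite normr_gt0 subr_eq0.
have := hd (w - z); rewrite nz' (lt_le_trans hw cd) (_ : z + (w - z) = w); last by ring.
move=> /(_ isT) h.
have : `|(g w - g z) / (w - z)| < 1 + `|l|.
  have -> : (g w - g z) / (w - z) = (g w - g z) / (w - z) - l + l by ring.
  by apply: le_lt_trans (ler_normD _ _) _; rewrite ltrD2r.
rewrite normrM normfV ltr_pdivrMr // => /lt_le_trans; apply.
by rewrite mulrC -ler_pdivlMr //; apply: le_trans (ltW hw) _.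
Qed.

Variable th : C -> C.
Hypothesis br : bracket_fn th.

Lemma bracket_cont (z e : C) : 0 < e ->
  exists d : C, 0 < d /\ forall w : C, `|w - z| < d -> `|th w - th z| < e.
Proof. by case: br => h _ _ _; apply: holomorphic_continuous. Qed.

Lemma bracketN z : th (- z) = - th z. Proof. by case: br. Qed.

Lemma bracket0 : th 0 = 0.
Proof. by have /eqP := bracketN 0; rewrite oppr0 -addr_eq0 -mulr2n mulrn_eq0 /= => /eqP. Qed.

Lemma bracket_open z : th z != 0 -> exists d : C, 0 < d /\ forall w : C, `|w - z| < d -> th w != 0.
Proof.
rewrite -normr_gt0 => hz; have [d [d0 hd]] := @bracket_cont z _ hz.
exists d; split=> // w /hd h; apply/eqP => e.
by move: h; rewrite e sub0r normrN ltxx.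
Qed.

(** The Riemann relation at y = 0. If [x], [u + v] and [u - v] are in the support, then one of the
    two products on the right is nonzero, which produces new points of the support. *)
Lemma bracket_rel0 x u v :
  th x ^+ 2 * (th (u + v) * th (u - v)) =
  th (x + v) * th (x - v) * th u ^+ 2 - th (x + u) * th (x - u) * th v ^+ 2.
Proof.
case: br => _ _ _ /(_ x 0 u v); rewrite !addr0 !subr0 !add0r !bracketN => h.
transitivity (th x * th x * th (u + v) * th (u - v)); first by ring.
by rewrite h; ring.
Qed.

Lemma neq0_mul4 (a b c d : C) : a != 0 -> b != 0 -> a ^+ 2 * (b * c) = d -> c != 0 -> d != 0.
Proof. by move=> a0 b0 <- c0; rewrite !mulf_neq0 // expf_neq0. Qed.

(* If th vanished near 0, its support would be stable under midpoints and   *)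
(* reflections of close pairs of points, hence contain a progression from  *)
(* any of its points to 0.                                                 *)
Lemma bracket_near0 (r : C) : 0 < r -> exists s, `|s| < r /\ th s != 0.
Proof.
move=> r0; apply: contrapT => hn.
have z s : `|s| < r -> th s = 0.
  by move=> hs; apply: contrapT => /eqP h; apply: hn; exists s.
have mid p q : th p != 0 -> th q != 0 -> `|p - q| < r ->
    th ((p + q) / 2) != 0 /\ th (p + (p - q) / 2) != 0.
  (* With u and v the half-sum and half-difference, u + v = p and u - v = q, while x - u = v is so
     small that the second product vanishes. *)
  move=> hp hq hpq; have := bracket_rel0 p ((p + q) / 2) ((p - q) / 2).
  have -> : (p + q) / 2 + (p - q) / 2 = p by field.
  have -> : (p + q) / 2 - (p - q) / 2 = q by field.
  have -> : p - (p + q) / 2 = (p - q) / 2 by field.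
  rewrite (z ((p - q) / 2)); last first.
    by rewrite norm_half; apply: le_lt_trans hpq; rewrite ler_pdivrMr ?ltr0n // ler_peMr // ler1n.
  rewrite mulr0 mul0r subr0 => /(neq0_mul4 hp hp)/(_ hq).
  by rewrite !mulf_eq0 !negb_or => /andP[/andP[-> _] /andP[-> _]].
have refl p q : th p != 0 -> th q != 0 -> `|p - q| < r -> th (p + (p - q)) != 0.
  move=> hp hq hpq; have [h1 h2] := mid p q hp hq hpq.
  (* The two points just found differ again by [p - q], so [mid] applies to them and reaches the
     reflection of [q] in [p]. *)
  have := mid _ _ h2 h1.
  rewrite (_ : p + (p - q) / 2 - (p + q) / 2 = p - q); last by field.
  rewrite (_ : p + (p - q) / 2 + (p - q) / 2 = p + (p - q)); last by field.
  by move=> /(_ hpq) [].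
have [_ [z0 hz0] _ _] := br.
have [d [d0 hd]] := bracket_open hz0.
have [m [m0 md mr]] := pos_min d0 r0.
have [n hn'] := complex_archi (normr_ge0 z0) m0.
(* The progression from [z0] with this step reaches 0 after n + 1 steps, where the odd function [th]
   vanishes: a contradiction. *)
pose h := - z0 / n.+1%:R.
have hm : `|h| < m.
  by rewrite normrM normrN normfV normr_nat ltr_pdivrMr ?ltr0n.
have prog k : th (z0 + h *+ k) != 0 /\ th (z0 + h *+ k.+1) != 0.
  elim: k => [|k [h1 h2]].
    by rewrite mulr0n addr0 mulr1n; split => //; apply: hd; rewrite addrC addKr (lt_le_trans hm).
  split => //; have := refl _ _ h2 h1.
  have -> : z0 + h *+ k.+1 - (z0 + h *+ k) = h by rewrite mulrS; ring.
  rewrite -addrA -mulrSr; apply; exact: lt_le_trans hm mr.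
have [_ ] := prog n.
by rewrite -mulr_natr /h mulfVK ?pnatr_eq0 // addrN bracket0 eqxx.
Qed.

Let cl z := forall e : C, 0 < e -> exists w, `|w - z| < e /\ th w != 0.

Let clS z : th z != 0 -> cl z.
Proof. by move=> hz e e0; exists z; rewrite subrr normr0. Qed.

Let clN z : cl z -> cl (- z).
Proof.
move=> hz e /hz [w [hw h]]; exists (- w); split; last by rewrite bracketN oppr_eq0.
by rewrite -opprD normrN.
Qed.

(** Choose support points x', p' near x, p and q near 0. The relation with u + v = p', u - v = q
    puts x' + (p' + q)/2 or x' + (p' - q)/2 in the support, and both are close to x + p/2. *)
Let cl_half_add x p : cl x -> cl p -> cl (x + p / 2).
Proof.
move=> hx hp e e0; have e1 := half_pos e0.
have [x' [hx' sx]] := hx _ e1; have [p' [hp' sp]] := hp _ e1.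
have [q [hq sq]] := bracket_near0 e1.
have := bracket_rel0 x' ((p' + q) / 2) ((p' - q) / 2).
have -> : (p' + q) / 2 + (p' - q) / 2 = p' by field.
have -> : (p' + q) / 2 - (p' - q) / 2 = q by field.
move=> /(neq0_mul4 sx sp)/(_ sq) h.
have close w : `|w| < e / 2 -> `|x' + (p' + w) / 2 - (x + p / 2)| < e.
  move=> hw.
  have -> : x' + (p' + w) / 2 - (x + p / 2) = (x' - x) + ((p' - p) + w) / 2 by field.
  rewrite [ltRHS](_ : e = e / 2 + (e / 2 + e / 2) / 2); last by field.
  apply: lt_normD => //; rewrite norm_half ltr_pM2r ?invr_gt0 ?ltr0n //.
  exact: lt_normD.
have [h0|h0] := eqVneq (th (x' + (p' - q) / 2)) 0.
  exists (x' + (p' + q) / 2); split; first exact: close.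
  by apply: contra_neq h => ->; rewrite h0 !mul0r subrr.
exists (x' + (p' - q) / 2); split => //; apply: close.
by rewrite normrN.
Qed.

(* The closure of the support is an additive group containing an open set. *)
Lemma bracket_dense (z e : C) : 0 < e -> exists w, `|w - z| < e /\ th w != 0.
Proof.
suff : cl z by apply.
have cl0 : cl 0 by move=> r /bracket_near0 [s]; rewrite -[s in `|s|]subr0; exists s.
have clD x y : cl x -> cl y -> cl (x + y).
  move=> hx hy; rewrite (_ : x + y = x + y / 2 + y / 2); last by field.
  by do 2!apply: cl_half_add => //.
have [_ [z0 hz0] _ _] := br.
have [d [d0 hd]] := bracket_open hz0.
have ball y : `|y| < d -> cl y.
  move=> hy; rewrite -[y](addKr z0) addrC; apply: clD; last exact/clN/clS.
  by apply/clS/hd; rewrite addrC addKr.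
have [n hn] := complex_archi (normr_ge0 z) d0.
rewrite -[z](divfK (_ : n.+1%:R != 0)) ?pnatr_eq0 // mulr_natr.
have : cl (z / n.+1%:R) by apply: ball; rewrite normrM normfV normr_nat ltr_pdivrMr ?ltr0n.
move: (z / _) => y hy; elim: n.+1 => [|k ih]; first by rewrite mulr0n.
by rewrite mulrS; apply: clD.
Qed.

End Density.

(** * Generic points *)

Section Genericity.
Variable R : realType.
Local Notation C := R[i].

Lemma pos_min_fin (I : finType) (Q : I -> C -> Prop) :
  (forall i d d', 0 < d' -> d' <= d -> Q i d -> Q i d') ->
  (forall i, exists d, 0 < d /\ Q i d) -> exists d, 0 < d /\ forall i, Q i d.
Proof.
move=> mono ex.
suff [d [d0 hd]] : exists d, 0 < d /\ forall i, i \in enum I -> Q i d.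
  by exists d; split=> // i; apply: hd; rewrite mem_enum.
elim: (enum I) => [|i s [d [d0 hd]]]; first by exists 1; split.
have [e [e0 he]] := ex i; have [c [c0 cd ce]] := pos_min d0 e0.
exists c; split=> // j; rewrite inE => /orP [/eqP ->|hj].
  exact: mono ce he.
by apply: mono cd (hd _ hj).
Qed.

Section Continuity.
Variable n : nat.
Implicit Types (f g : ('I_n -> C) -> C) (z w : 'I_n -> C).

Definition contat f z := forall e, 0 < e ->
  exists d, 0 < d /\ forall w, near_pt z w d -> `|f w - f z| < e.

Lemma near_pt_le z w d d' : d' <= d -> near_pt z w d' -> near_pt z w d.
Proof. by move=> hd h i; apply: lt_le_trans hd. Qed.

Lemma contat_cst c z : contat (fun=> c) z.
Proof. by move=> e e0; exists 1; split=> // w _; rewrite subrr normr0. Qed.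

Lemma contat_coord i z : contat (fun w => w i) z.
Proof. by move=> e e0; exists e; split=> // w; apply. Qed.

Lemma contatD f g z : contat f z -> contat g z -> contat (fun w => f w + g w) z.
Proof.
move=> hf hg e /half_pos e0; have [d1 [p1 h1]] := hf _ e0; have [d2 [p2 h2]] := hg _ e0.
have [d [d0 dd1 dd2]] := pos_min p1 p2; exists d; split=> // w hw.
rewrite (_ : _ - _ = (f w - f z) + (g w - g z)); last by ring.
rewrite [ltRHS](_ : e = e / 2 + e / 2); last by field.
by apply: lt_normD; [apply: h1|apply: h2]; apply: near_pt_le hw.
Qed.

Lemma contatN f z : contat f z -> contat (fun w => - f w) z.
Proof.
move=> hf e /hf [d [d0 hd]]; exists d; split=> // w /hd.
by rewrite -opprD normrN.
Qed.

Lemma contatB f g z : contat f z -> contat g z -> contat (fun w => f w - g w) z.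
Proof. by move=> hf hg; apply: contatD => //; apply: contatN. Qed.

Lemma contatM f g z : contat f z -> contat g z -> contat (fun w => f w * g w) z.
Proof.
move=> hf hg e e0; pose K := 1 + `|f z| + `|g z|.
have K0 : 0 < K by rewrite /K -addrA ltr_wpDr // addr_ge0.
have [c [c0 c1 ce]] := pos_min (@ltr01 C) (divr_gt0 e0 K0).
have [d1 [p1 h1]] := hf _ c0; have [d2 [p2 h2]] := hg _ c0.
have [d [d0 dd1 dd2]] := pos_min p1 p2; exists d; split=> // w hw.
have {}h1 : `|f w - f z| < c by apply/h1/near_pt_le/hw.
have {}h2 : `|g w - g z| < c by apply/h2/near_pt_le/hw.
rewrite (_ : _ - _ = (f w - f z) * (g w - g z) + (f z * (g w - g z) + (f w - f z) * g z)); last by ring.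
apply: (@lt_le_trans _ _ (c * K)); last by rewrite -ler_pdivlMr.
have -> : c * K = c + (c * `|f z| + c * `|g z|) by rewrite /K; ring.
apply: le_lt_trans (ler_normD _ _) _.
apply: ltr_leD.
  rewrite normrM; apply: le_lt_trans h1; rewrite -[leRHS]mulr1.
  by apply: ler_wpM2l => //; apply: le_trans (ltW h2) _.
apply: le_trans (ler_normD _ _) _; rewrite !normrM; apply: lerD.
  by rewrite mulrC; apply: ler_wpM2r => //; apply: ltW.
by apply: ler_wpM2r => //; apply: ltW.
Qed.

Lemma contatV f z : f z != 0 -> contat f z -> contat (fun w => (f w)^-1) z.
Proof.
move=> nz hf e e0; have z0 : 0 < `|f z| by rewrite normr_gt0.
have z1 := half_pos z0.
have [c [c0 c1 c2]] := pos_min z1 (mulr_gt0 e0 (mulr_gt0 z0 z1)).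
have [d [d0 hd]] := hf _ c0; exists d; split=> // w /hd hw.
have lo : `|f z| / 2 < `|f w|.
  have := ler_normB (f z) (f z - f w); rewrite opprB addrCA subrr addr0.
  rewrite -[`|f z - f w|]normrN opprB => h.
  have h2 : `|f z| < `|f w| + `|f z| / 2.
    have -> : f z = f w + - (f w - f z) by ring.
    apply: le_lt_trans (ler_normD _ _) _; rewrite ltrD2l normrN.
    have -> : f w + - (f w - f z) = f z by ring.
    exact: lt_le_trans c1.
  rewrite -(ltrD2r (`|f z| / 2)); apply: le_lt_trans h2.
  by rewrite le_eqVlt; apply/orP; left; apply/eqP; field.
have w0 : 0 < `|f w| by apply: lt_trans lo.
have wn : f w != 0 by rewrite -normr_gt0.
rewrite (_ : _ - _ = (f z - f w) / (f z * f w)); last by field; apply/andP.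
rewrite normrM normfV ltr_pdivrMr ?normrM ?mulr_gt0 //.
rewrite -normrN opprB; apply: lt_le_trans hw _; apply: le_trans c2 _.
by rewrite ler_pM2l // ler_pM2l // ltW.
Qed.

Lemma contat_sum (I : Type) (r : seq I) (P : pred I) (F : I -> ('I_n -> C) -> C) z :
  (forall i, contat (F i) z) -> contat (fun w => \sum_(i <- r | P i) F i w) z.
Proof.
move=> h; elim: r => [|i r ih].
  by move=> e /(contat_cst 0 z) [d [d0 hd]]; exists d; split=> // w /hd; rewrite !big_nil.
move=> e e0; case Pi : (P i).
  have [d [d0 hd]] := contatD (h i) ih e0; exists d; split=> // w /hd.
  by rewrite !big_cons Pi.
have [d [d0 hd]] := ih _ e0; exists d; split=> // w /hd.
by rewrite !big_cons Pi.
Qed.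

Lemma contat_comp (g : C -> C) f z :
  (forall e : C, 0 < e -> exists d : C, 0 < d /\ forall w : C, `|w - f z| < d -> `|g w - g (f z)| < e) ->
  contat f z -> contat (fun w => g (f w)) z.
Proof.
move=> hg hf e /hg [d [/hf [d' [d0 hd']] hd]].
by exists d'; split=> // w /hd'/hd.
Qed.

(** The open dense sets that witness [generic], kept separate because pulling back needs the set
    itself to be open. *)
Definition odense (D : ('I_n -> C) -> Prop) :=
  (forall z, D z -> exists e, 0 < e /\ forall w, near_pt z w e -> D w) /\
  (forall z e, 0 < e -> exists w, near_pt z w e /\ D w).

Lemma odense_generic D : odense D -> generic D.
Proof. by case=> o d; exists D; split. Qed.

Lemma genericP P : generic P <-> exists2 D, odense D & forall z, D z -> P z.
Proof.
split=> [[U [o d h]]|[U [o d] h]]; first by exists U.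
by exists U; split.
Qed.

Lemma generic_sub (P Q : ('I_n -> C) -> Prop) :
  (forall z, P z -> Q z) -> generic P -> generic Q.
Proof. by move=> h [U [o d hU]]; exists U; split=> // z /hU/h. Qed.

Lemma near_pt_trans z w v d d' : near_pt z w d -> near_pt w v d' -> near_pt z v (d + d').
Proof.
move=> h h' i; rewrite (_ : _ - _ = (w i - z i) + (v i - w i)); last by ring.
exact: lt_normD.
Qed.

Lemma odenseI D E : odense D -> odense E -> odense (fun z => D z /\ E z).
Proof.
move=> [oD dD] [oE dE]; split.
  move=> z [/oD [e [e0 he]] /oE [e' [e0' he']]].
  have [c [c0 c1 c2]] := pos_min e0 e0'; exists c; split=> // w hw.
  by split; [apply: he|apply: he']; apply: near_pt_le hw.
move=> z e /half_pos e0; have [w [hw /oD [d [d0 hd]]]] := dD z _ e0.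
have [c [c0 c1 c2]] := pos_min e0 d0.
have [v [hv Ev]] := dE w _ c0; exists v; split; last first.
  by split=> //; apply: hd; apply: near_pt_le hv.
have -> : e = e / 2 + e / 2 by field.
by apply: near_pt_trans hw _; apply: near_pt_le hv.
Qed.

Lemma odenseT : odense (fun=> True).
Proof.
split=> [z _|z e e0]; first by exists 1.
by exists z; split=> // i; rewrite subrr normr0.
Qed.

Lemma genericT : generic (fun _ : 'I_n -> C => True).
Proof. exact/odense_generic/odenseT. Qed.

Lemma genericI (P Q : ('I_n -> C) -> Prop) :
  generic P -> generic Q -> generic (fun z => P z /\ Q z).
Proof.
move=> /genericP [D hD DP] /genericP [E hE EQ]; apply/genericP.
by exists (fun z => D z /\ E z); [exact: odenseI|move=> z [/DP ? /EQ]].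
Qed.

Lemma odense_iff (P Q : ('I_n -> C) -> Prop) :
  (forall z, P z <-> Q z) -> odense P -> odense Q.
Proof. by move=> h; rewrite (_ : P = Q) //; apply: funext => z; apply: propext. Qed.

Lemma odense_forall (I : finType) (P : I -> ('I_n -> C) -> Prop) :
  (forall i, odense (P i)) -> odense (fun z => forall i, P i z).
Proof.
move=> h; suff : odense (fun z => forall i, i \in enum I -> P i z).
  by apply: odense_iff => z; split=> hz i; [apply: hz; rewrite mem_enum|].
elim: (enum I) => [|i s ih]; first by apply: odense_iff odenseT.
apply: odense_iff (odenseI (h i) ih) => z; split=> [[hi hs] j|hz].
  by rewrite inE => /orP [/eqP ->|/hs].
by split=> [|j hj]; apply: hz; rewrite inE ?eqxx ?hj ?orbT.
Qed.

Lemma generic_exists (P : ('I_n -> C) -> Prop) : generic P -> exists z, P z.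
Proof. by move=> [U [_ /(_ (fun=> 0) 1 ltr01) [z [_ /[swap] h /h]]]]; exists z. Qed.

Lemma contat_vec (S : ('I_n -> C) -> 'I_n -> C) z : (forall i, contat (S^~ i) z) ->
  forall e, 0 < e -> exists d, 0 < d /\ forall w, near_pt z w d -> near_pt (S z) (S w) e.
Proof.
move=> h e e0.
have [] := @pos_min_fin 'I_n (fun i d => forall w, near_pt z w d -> `|S w i - S z i| < e).
- by move=> i d d' _ hd h' w hw; apply/h'/near_pt_le/hw.
- by move=> i; apply: h.
by move=> d [d0 hd]; exists d; split=> // w hw i; apply: hd.
Qed.

(** On the open dense stable set [D] the involution [S] is a homeomorphism, so it preserves density.
    This is how genericity passes through the birational maps s_k, defined only on such a [D]. *)
Lemma odense_pull (S : ('I_n -> C) -> 'I_n -> C) (D P : ('I_n -> C) -> Prop) :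
  odense D -> (forall z, D z -> D (S z)) -> (forall z, D z -> S (S z) = z) ->
  (forall z i, D z -> contat (S^~ i) z) ->
  odense P -> odense (fun z => D z /\ P (S z)).
Proof.
move=> hD DS SS cS [oU dU]; have [oD dD] := hD.
split.
  move=> z [Dz /oU [e [e0 he]]]; have [d [d0 hd]] := oD _ Dz.
  have [d' [d0' hd']] := @contat_vec S z (fun i => cS z i Dz) _ e0.
  have [c [c0 c1 c2]] := pos_min d0 d0'; exists c; split=> // w hw; split.
    exact/hd/near_pt_le/hw.
  exact/he/hd'/near_pt_le/hw.
move=> z e /half_pos e0; have [w [hw Dw]] := dD z _ e0.
have DSw := DS _ Dw.
have [d [d0 hd]] := oD _ DSw.
have [d' [d0' hd']] := @contat_vec S (S w) (fun i => cS _ i DSw) _ e0.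
have [c [c0 c1 c2]] := pos_min d0 d0'.
have [u [hu Uu]] := dU (S w) _ c0.
have Du : D u by apply/hd/near_pt_le/hu.
exists (S u); split; last by split; [exact: DS|rewrite SS].
have -> : e = e / 2 + e / 2 by field.
apply: near_pt_trans hw _; rewrite -[w]SS //; apply/hd'/near_pt_le/hu => //.
Qed.

Lemma generic_pull (S : ('I_n -> C) -> 'I_n -> C) (D P : ('I_n -> C) -> Prop) :
  odense D -> (forall z, D z -> D (S z)) -> (forall z, D z -> S (S z) = z) ->
  (forall z i, D z -> contat (S^~ i) z) ->
  generic P -> generic (fun z => D z /\ P (S z)).
Proof.
move=> hD DS SS cS /genericP [U hU UP].
apply: (@generic_sub (fun z => D z /\ U (S z))); first by move=> z [? /UP].
exact/odense_generic/odense_pull.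
Qed.

Variable th : C -> C.
Hypothesis br : bracket_fn th.

Lemma contat_bracket f z : contat f z -> contat (fun w => th (f w)) z.
Proof. by apply: contat_comp => e; apply: bracket_cont. Qed.

(** Along the direction [u] the value of [f] moves at unit speed, so a nearby value where [g] is
    nonzero is attained at a nearby point; [K] bounds the size of that displacement. *)
Lemma odense_comp_neq0 (g : C -> C) f :
  (forall z e : C, 0 < e -> exists d : C, 0 < d /\ forall w : C, `|w - z| < d -> `|g w - g z| < e) ->
  (forall z e : C, 0 < e -> exists w : C, `|w - z| < e /\ g w != 0) ->
  (forall z, contat f z) ->
  (exists u, forall z s, f (fun i => z i + s * u i) = f z + s) ->
  odense (fun z => g (f z) != 0).
Proof.
move=> cg dg cf [u hu]; split.
  move=> z; rewrite -normr_gt0 => h.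
  have [d [d0 hd]] := contat_comp (fun e => cg _ e) (cf z) h; exists d; split=> // w /hd hw.
  by apply/eqP => e; move: hw; rewrite e sub0r normrN ltxx.
move=> z e e0; pose K := 1 + \sum_i `|u i|.
have K0 : 0 < K by rewrite /K ltr_wpDr // sumr_ge0.
have [w [hw gw]] := dg (f z) _ (divr_gt0 e0 K0).
exists (fun i => z i + (w - f z) * u i); split; last by rewrite hu addrC subrK.
move=> i; rewrite addrC addKr normrM.
rewrite ltr_pdivlMr // in hw; apply: le_lt_trans hw.
apply: ler_wpM2l => //; rewrite /K (bigD1 i) //= addrCA ler_wpDr // addr_ge0 //.
by rewrite sumr_ge0.
Qed.

Lemma odense_bracket f : (forall z, contat f z) ->
  (exists u, forall z s, f (fun i => z i + s * u i) = f z + s) ->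
  odense (fun z => th (f z) != 0).
Proof.
by apply: odense_comp_neq0 => z e; [exact: bracket_cont|exact: bracket_dense].
Qed.

Lemma odense_coord i : odense (fun z : 'I_n -> C => z i != 0).
Proof.
apply: (@odense_comp_neq0 id (fun z => z i)).
- by move=> z e e0; exists e.
- move=> z e e0; have [->|nz] := eqVneq z 0.
    exists (e / 2); rewrite subr0 ger0_norm; last exact/ltW/half_pos.
    split; last by rewrite gt_eqF // half_pos.
    by rewrite ltr_pdivrMr ?ltr0n // ltr_pMr // ltr1n.
  by exists z; rewrite subrr normr0.
- by move=> z; apply: contat_coord.
by exists (fun=> 1) => z s; rewrite mulr1.
Qed.

End Continuity.

Lemma generic_proj m n (f : 'I_m -> 'I_n) (P : ('I_m -> C) -> Prop) : injective f ->
  generic P -> generic (fun z : 'I_n -> C => P (fun i => z (f i))).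
Proof.
move=> fi [U [o d h]]; exists (fun z => U (fun i => z (f i))); split; last by move=> z /h.
  move=> z /o [e [e0 he]]; exists e; split=> // w hw.
  by apply: he => i; apply: hw.
move=> z e e0; have [w [hw Uw]] := d (fun i => z (f i)) e e0.
pose v i := if [pick j | f j == i] is Some j then w j else z i.
exists v; split.
  move=> i; rewrite /v; case: pickP => [j /eqP <-|_]; first exact: hw.
  by rewrite subrr normr0.
rewrite (_ : (fun i => v (f i)) = w) //; apply: funext => i; rewrite /v.
by case: pickP => [j /eqP /fi ->|/(_ i)] //; rewrite eqxx.
Qed.

End Genericity.

(** * The lattice *)

(** The class e_{j+1} has index [j], so the transposition (k, k+1) exchanges the indices k - 1 and
    k. *)
Definition sw (k : nat) (j : 'I_9) : 'I_9 := inord (swapn k.-1 k j).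

Lemma swapnK a b : involutive (swapn a b).
Proof. by move=> j; rewrite /swapn; do !case: eqP => //=; lia. Qed.

Lemma swE (k : 'I_9) (j : 'I_9) : (0 < k)%N -> sw k j = swapn k.-1 k j :> nat.
Proof.
move=> k0; rewrite /sw inordK // /swapn.
by have := ltn_ord j; have := ltn_ord k; do !case: eqP => //=; lia.
Qed.

Lemma swK (k : 'I_9) : (0 < k)%N -> involutive (sw k).
Proof. by move=> k0 j; apply: val_inj => /=; rewrite !swE // swapnK. Qed.

Lemma swS (k : 'I_9) (j : 'I_9) : (0 < k)%N -> swapn k k.+1 j.+1 = (sw k j).+1.
Proof.
move=> k0; rewrite swE // /swapn; case: (val k) k0 => //= m _.
by rewrite !eqSS; case: eqP => // _; case: eqP.
Qed.

Lemma inordS (j : 'I_9) : inord j.+1 = lift ord0 j :> 'I_10.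
Proof. by apply: val_inj; rewrite /= inordK // ltnS. Qed.

Lemma big_split3 (T : Type) (idx : T) (op : Monoid.com_law idx) (F : 'I_9 -> T) :
  \big[op/idx]_(j < 9) F j =
  op (op (op (F 0) (F 1)) (F 2)) (\big[op/idx]_(j < 9 | (2 < j)%N) F j).
Proof.
rewrite (bigD1 0) //= (bigD1 1) //= (bigD1 2) //= !Monoid.mulmA; congr (op _ _).
by apply: eq_bigl; case=> [[|[|[|m]]] hm].
Qed.

Lemma big_nat_1_10 (T : Type) (idx : T) (op : Monoid.law idx) (F : nat -> T) :
  \big[op/idx]_(1 <= j < 10) F j = \big[op/idx]_(j < 9) F j.+1.
Proof. by rewrite big_add1 big_mkord. Qed.

Lemma big_neq_ord0 (T : Type) (idx : T) (op : Monoid.com_law idx) (F : 'I_10 -> T) :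
  \big[op/idx]_(i < 10 | i != ord0) F i = \big[op/idx]_(j < 9) F (lift ord0 j).
Proof.
rewrite big_mkcond [LHS]big_ord_recl eqxx /= Monoid.mul1m; apply: eq_bigr => j _.
by [].
Qed.

Lemma evecS_ord0 j : evec j.+1 ord0 = 0. Proof. by []. Qed.
Lemma evecS_lift (i j : 'I_9) : evec i.+1 (lift ord0 j) = (j == i)%:Z.
Proof. by []. Qed.

Lemma lip_sum (v w : lat) :
  lip v w = - (v ord0 * w ord0) + \sum_(j < 9) v (lift ord0 j) * w (lift ord0 j).
Proof. by rewrite /lip (@big_neq_ord0 _ _ +%R). Qed.

Lemma lip_evec0 (w : lat) : lip (evec 0) w = - w ord0.
Proof. by rewrite lip_sum big1 ?addr0 ?mul1r // => j _; rewrite mul0r. Qed.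

Lemma lip_evecS (j : 'I_9) (w : lat) : lip (evec j.+1) w = w (lift ord0 j).
Proof.
rewrite lip_sum evecS_ord0 mul0r oppr0 add0r (bigD1 j) //= evecS_lift eqxx mul1r.
by rewrite big1 ?addr0 // => i /negPf ne; rewrite evecS_lift ne mul0r.
Qed.

Lemma lipC (v w : lat) : lip v w = lip w v.
Proof. by rewrite !lip_sum mulrC; congr (_ + _); apply: eq_bigr => j _; rewrite mulrC. Qed.

Lemma lipBl (u v w : lat) : lip (fun i => u i - v i) w = lip u w - lip v w.
Proof.
rewrite !lip_sum (eq_bigr _ (fun j _ => mulrBl _ _ _)) sumrB mulrBl.
ring.
Qed.

Lemma hk0E : hk 0 = fun i => evec 0 i - evec 1 i - evec 2 i - evec 3 i.
Proof. by []. Qed.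

Lemma hkE (k : 'I_9) : (0 < k)%N -> hk k = fun i => evec k i - evec k.+1 i.
Proof. by rewrite /hk lt0n => /negPf ->. Qed.

Lemma lip_hk0 (w : lat) : lip (hk 0) w =
  - w ord0 - w (lift ord0 0) - w (lift ord0 1) - w (lift ord0 2).
Proof.
rewrite hk0E (lipBl (fun i => evec 0 i - evec 1 i - evec 2 i)) (lipBl (fun i => evec 0 i - evec 1 i)) lipBl.
by rewrite lip_evec0 (lip_evecS 0) (lip_evecS 1) (lip_evecS 2).
Qed.

Lemma ord_predS (k : 'I_9) : (0 < k)%N -> exists i : 'I_9, i.+1 = k :> nat /\ (i < k)%N.
Proof.
case: k => [[|k] hk] //= _; exists (Ordinal (ltnW hk)) => /=; split=> //.
Qed.

Lemma sZ_ord0 (k : 'I_9) (L : lat) : (0 < k)%N -> sZ k L ord0 = L ord0.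
Proof.
move=> k0; rewrite /sZ hkE // /evec /= eq_sym (gtn_eqF k0) subrr mulr0 subr0 //.
Qed.

Lemma sZ_lift (k j : 'I_9) (L : lat) : (0 < k)%N ->
  sZ k L (lift ord0 j) = L (lift ord0 (sw k j)).
Proof.
move=> k0; rewrite /sZ (hkE k0) lipBl lip_evecS.
have [i [ik lik]] := ord_predS k0.
have -> : lip (evec k) L = L (lift ord0 i) by rewrite -ik lip_evecS.
have -> : evec k (lift ord0 j) = (j == i)%:Z by rewrite -ik.
rewrite evecS_lift.
have [->|nji] := eqVneq j i.
  have -> : (i == k) = false by apply/negbTE/eqP => e; move: lik; rewrite e ltnn.
  have -> : sw k i = k by apply: val_inj => /=; rewrite swE // /swapn -ik /= eqxx.
  rewrite /=; ring.
have [->|njk] := eqVneq j k.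
  have -> : sw k k = i.
    apply: val_inj => /=; rewrite swE // /swapn -ik /= eqxx; case: eqP => //; lia.
  rewrite /=; ring.
have -> : sw k j = j.
  apply: val_inj => /=; rewrite swE // /swapn -ik /=.
  case: eqP => [e|_]; first by case/eqP: nji; apply: val_inj.
  by case: eqP => // e; case/eqP: njk; apply: val_inj => /=; rewrite e ik.
rewrite /=; ring.
Qed.

Lemma sZ0_ord0 (L : lat) :
  sZ 0 L ord0 = 2 * L ord0 + L (lift ord0 0) + L (lift ord0 1) + L (lift ord0 2).
Proof. rewrite /sZ lip_hk0 (_ : hk 0 _ = 1) //; ring. Qed.

Lemma sZ0_lift0 (L : lat) :
  sZ 0 L (lift ord0 0) = - L ord0 - L (lift ord0 1) - L (lift ord0 2).
Proof. rewrite /sZ lip_hk0 (_ : hk 0 _ = -1) //; ring. Qed.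

Lemma sZ0_lift1 (L : lat) :
  sZ 0 L (lift ord0 1) = - L ord0 - L (lift ord0 0) - L (lift ord0 2).
Proof. rewrite /sZ lip_hk0 (_ : hk 0 _ = -1) //; ring. Qed.

Lemma sZ0_lift2 (L : lat) :
  sZ 0 L (lift ord0 2) = - L ord0 - L (lift ord0 0) - L (lift ord0 1).
Proof. rewrite /sZ lip_hk0 (_ : hk 0 _ = -1) //; ring. Qed.

Lemma sZ0_lift_ge3 (L : lat) (j : 'I_9) : (2 < j)%N -> sZ 0 L (lift ord0 j) = L (lift ord0 j).
Proof.
move=> j2; rewrite /sZ (_ : hk 0 _ = 0) ?mulr0 ?subr0 //.
by case: j j2 => [[|[|[|m]]] hm].
Qed.

Lemma sZK (k : 'I_9) : involutive (sZ k).
Proof.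
move=> L; apply: funext => i.
have [->|[j ->]] : i = ord0 \/ exists j, i = lift ord0 j.
- by have [j ->|->] := unliftP ord0 i; [right; exists j|left].
- case: (posnP k) => [k0|k0]; last by rewrite !sZ_ord0.
  have -> : k = 0 by apply: val_inj.
  rewrite sZ0_ord0 sZ0_ord0 sZ0_lift0 sZ0_lift1 sZ0_lift2; ring.
case: (posnP k) => [k0|k0]; last by rewrite !sZ_lift // swK.
have -> : k = 0 by apply: val_inj.
case: (ltnP 2 j) => j2; first by rewrite !sZ0_lift_ge3.
have [->|[->| ->]] : j = 0 \/ j = 1 \/ j = 2.
- by case: j j2 => [[|[|[|m]]] hm] //= _; [left|right; left|right; right]; apply: val_inj.
- rewrite sZ0_lift0 sZ0_ord0 sZ0_lift1 sZ0_lift2; ring.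
- rewrite sZ0_lift1 sZ0_ord0 sZ0_lift0 sZ0_lift2; ring.
- rewrite sZ0_lift2 sZ0_ord0 sZ0_lift0 sZ0_lift1; ring.
Qed.

(** The equations <Lambda, Lambda> = 1 and <c, Lambda> = -1 written in coordinates. *)
Definition Minv (L : lat) : Prop :=
  \sum_(j < 9) L (lift ord0 j) ^+ 2 = L ord0 ^+ 2 + 1 /\
  \sum_(j < 9) L (lift ord0 j) = 1 - 3 * L ord0.

Lemma Minv_evec (j : 'I_9) : Minv (evec j.+1).
Proof.
split; rewrite evecS_ord0 (bigD1 j) //= evecS_lift eqxx big1 ?addr0 //.
  by move=> i /negPf ne; rewrite evecS_lift ne.
by move=> i /negPf ne; rewrite evecS_lift ne.
Qed.

Lemma Minv_sZ k L : Minv L -> Minv (sZ k L).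
Proof.
case: (posnP k) => [k0|k0]; last first.
  have bij : bijective (sw k) by exists (sw k); apply: swK.
  case=> h1 h2; split; rewrite sZ_ord0 // -?h1 -?h2 [RHS](reindex_onto (sw k) (sw k)) /=.
  - by apply: eq_big => [j|j _]; rewrite ?swK ?eqxx ?sZ_lift.
  - by move=> j _; rewrite swK.
  - by apply: eq_big => [j|j _]; rewrite ?swK ?eqxx ?sZ_lift.
  - by move=> j _; rewrite swK.
have -> : k = 0 by apply: val_inj.
rewrite /Minv !(@big_split3 _ _ +%R) /=.
rewrite sZ0_ord0 sZ0_lift0 sZ0_lift1 sZ0_lift2.
have -> : \sum_(j < 9 | (2 < j)%N) sZ 0 L (lift ord0 j) ^+ 2 =
    \sum_(j < 9 | (2 < j)%N) L (lift ord0 j) ^+ 2.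
  by apply: eq_bigr => j j2; rewrite sZ0_lift_ge3.
have -> : \sum_(j < 9 | (2 < j)%N) sZ 0 L (lift ord0 j) =
    \sum_(j < 9 | (2 < j)%N) L (lift ord0 j).
  by apply: eq_bigr => j j2; rewrite sZ0_lift_ge3.
set S := \sum_(j < 9 | _) _ ^+ 2; set T := \sum_(j < 9 | _) _.
move: (L ord0) (L _) (L _) (L _) S T => d a b c S T [h1 h2].
have -> : S = d ^+ 2 + 1 - a ^+ 2 - b ^+ 2 - c ^+ 2 by rewrite -h1; ring.
have -> : T = 1 - 3 * d - a - b - c by rewrite -h2; ring.
split; ring.
Qed.

Lemma Minv_actZ w L : Minv L -> Minv (actZ w L).
Proof. by move=> h; elim: w => //= k w; apply: Minv_sZ. Qed.

(** * Bounds on the degree and on the multiplicities *)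

Section Bounds.
Variable L : lat.
Hypothesis hL : Minv L.
Local Notation d := (L ord0).
Local Notation l j := (L (lift ord0 j)).

(** The squares of 3 l_j + d add up to 9 + 6d, which forces d >= -1; for d = -1 each of the nine
    squares is at least 1, but their sum is 3. *)
Lemma Minv_deg_ge0 : 0 <= d.
Proof.
have [h1 h2] := hL.
have e : \sum_(j < 9) (3 * l j + d) ^+ 2 = 9 + 6 * d.
  rewrite (eq_bigr (fun j => 9 * l j ^+ 2 + (6 * d * l j + d ^+ 2))); last by move=> j _; ring.
  rewrite !big_split /= -!mulr_sumr h1 h2 sumr_const card_ord; ring.
have g : 0 <= 9 + 6 * d by rewrite -e sumr_ge0 // => j _; apply: sqr_ge0.
have [//|d0] := lerP 0 d.
have dm : d = -1 by lia.
have : \sum_(j < 9) (1 : int) <= \sum_(j < 9) (3 * l j + d) ^+ 2.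
  by apply: ler_sum => j _; rewrite dm; nia.
by rewrite e dm sumr_const card_ord.
Qed.

Lemma Minv_deg0 : d = 0 -> forall j, l j = 0 \/ l j = 1.
Proof.
have [h1 h2] := hL => d0 j.
have : \sum_(j < 9) (l j ^+ 2 - l j) = 0 by rewrite sumrB h1 h2 d0.
move/eqP; rewrite psumr_eq0; last by move=> i _; nia.
by move/allP/(_ j (mem_index_enum _)) => /eqP; nia.
Qed.

(** Cauchy-Schwarz for the eight other coordinates, T^2 <= 8 S, is violated when both [d] and [l j]
    are positive. *)
Lemma Minv_le0 : 0 < d -> forall j, l j <= 0.
Proof.
have [h1 h2] := hL => d0 j; rewrite leNgt; apply/negP => a0.
move: h1; rewrite (bigD1 j) //= => h1; move: h2; rewrite (bigD1 j) //= => h2.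
set S := \sum_(_ < _ | _) _ ^+ 2 in h1; set T := \sum_(_ < _ | _) _ in h2.
have : 0 <= \sum_(i < 9 | i != j) (8 * l i - T) ^+ 2 by apply: sumr_ge0 => i _; apply: sqr_ge0.
rewrite (eq_bigr (fun i => 64 * l i ^+ 2 + (- (16 * T) * l i + T ^+ 2))); last by move=> i _; ring.
rewrite !big_split /= -!mulr_sumr -/S -/T.
have -> : \sum_(i < 9 | i != j) T = 8 * T.
  rewrite sumr_const (cardC1 j) card_ord /=; ring.
have -> : S = d ^+ 2 + 1 - l j ^+ 2 by rewrite -h1; ring.
have -> : T = 1 - 3 * d - l j by rewrite -h2; ring.
move: (d) (l j) d0 a0 => x a x0 a0; nia.
Qed.

(** No multiplicity exceeds the degree. This makes the exponents of [cexp] natural numbers and keeps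
    Euler's identity usable in [vanish_deriv]. *)
Lemma Minv_bound j : 0 <= d + l j.
Proof.
have [h1 _] := hL; have := Minv_deg_ge0; rewrite le_eqVlt => /predU1P [/esym d0|d0].
  by case: (Minv_deg0 d0 j) => ->; rewrite d0.
have : l j ^+ 2 <= d ^+ 2 + 1.
  by rewrite -h1 (bigD1 j) //= lerDl sumr_ge0 // => i _; apply: sqr_ge0.
by have := Minv_le0 d0 j; move: (d) (l j) d0 => x a *; nia.
Qed.

End Bounds.

Section Pairing.
Variable R : realType.
Local Notation C := R[i].
Implicit Types (h : hpt R) (v w : lat).

Lemma ipC_sum v h :
  ipC v h = - ((v ord0)%:~R * h ord0) + \sum_(j < 9) (v (lift ord0 j))%:~R * h (lift ord0 j).
Proof. by rewrite /ipC (@big_neq_ord0 _ _ +%R). Qed.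

Lemma eps0E h : eps 0 h = - h ord0.
Proof. by rewrite /eps ipC_sum big1 ?addr0 ?mul1r // => j _; rewrite mul0r. Qed.

Lemma epsSE (j : 'I_9) h : eps j.+1 h = h (lift ord0 j).
Proof.
rewrite /eps ipC_sum evecS_ord0 mul0r oppr0 add0r (bigD1 j) //= evecS_lift eqxx mul1r.
by rewrite big1 ?addr0 // => i /negPf ne; rewrite evecS_lift ne mul0r.
Qed.

Lemma ipC_subl u v h : ipC (fun i => u i - v i) h = ipC u h - ipC v h.
Proof.
rewrite !ipC_sum (eq_bigr (fun j => (u (lift ord0 j))%:~R * h (lift ord0 j) - (v (lift ord0 j))%:~R * h (lift ord0 j))).
  by rewrite sumrB intrB; ring.
by move=> j _; rewrite intrB mulrBl.
Qed.

Lemma ipC_hk0 h : ipC (hk 0) h = alpha0 h. Proof. by []. Qed.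

Lemma alpha0E h : alpha0 h = eps 0 h - eps 1 h - eps 2 h - eps 3 h.
Proof.
by rewrite /alpha0 hk0E (ipC_subl (fun i => evec 0 i - evec 1 i - evec 2 i))
  (ipC_subl (fun i => evec 0 i - evec 1 i)) ipC_subl.
Qed.

Lemma ipC_hk (k : 'I_9) h : (0 < k)%N -> ipC (hk k) h = eps k h - eps k.+1 h.
Proof. by move=> k0; rewrite hkE // ipC_subl. Qed.

Lemma ipC_sh (k : 'I_9) v h :
  ipC v (sh k h) = ipC v h - (lip v (hk k))%:~R * ipC (hk k) h.
Proof.
rewrite (ipC_sum v (sh k h)) (ipC_sum v h) /sh lip_sum.
rewrite (eq_bigr (fun j => (v (lift ord0 j))%:~R * h (lift ord0 j)
   - ipC (hk k) h * (v (lift ord0 j) * hk k (lift ord0 j))%:~R)).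
  rewrite sumrB -mulr_sumr rmorphD rmorphN rmorphM rmorph_sum /=.
  by set A := \sum_(j < 9) _; set B := \sum_(j < 9) _; ring.
by move=> j _; rewrite rmorphM /=; ring.
Qed.

Lemma ipC_sZ (k : 'I_9) v h : ipC (sZ k v) h = ipC v (sh k h).
Proof.
have -> : ipC (sZ k v) h = ipC v h - (lip (hk k) v)%:~R * ipC (hk k) h.
  rewrite !ipC_sum /sZ mulrDr mulr_sumr.
  rewrite (eq_bigr (fun j => (v (lift ord0 j))%:~R * h (lift ord0 j)
     - (lip (hk k) v)%:~R * ((hk k (lift ord0 j))%:~R * h (lift ord0 j)))).
    by rewrite sumrB rmorphB rmorphM /=; ring.
  by move=> j _; rewrite rmorphB rmorphM /= mulrBl mulrA.
by rewrite ipC_sh lipC.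
Qed.

Lemma eps_sh_pos (k j : 'I_9) h : (0 < k)%N -> eps j.+1 (sh k h) = eps (sw k j).+1 h.
Proof.
move=> k0; rewrite /eps -ipC_sZ; congr (ipC _ h); apply: funext => i.
have [m ->|->] := unliftP ord0 i; last by rewrite sZ_ord0.
rewrite sZ_lift // !evecS_lift; congr (nat_of_bool _)%:Z.
by rewrite -(inj_eq (can_inj (swK k0))) swK.
Qed.

Lemma eps0_sh (k : 'I_9) h : (0 < k)%N -> eps 0 (sh k h) = eps 0 h.
Proof.
move=> k0; rewrite /eps -ipC_sZ; congr (ipC _ h); apply: funext => i.
have [m ->|->] := unliftP ord0 i; last by rewrite sZ_ord0.
by rewrite sZ_lift.
Qed.

Lemma eps_sh0_lt3 j h : (j <= 3)%N -> eps j (sh 0 h) = eps j h + alpha0 h.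
Proof.
move=> j3; rewrite [LHS]/eps ipC_sh lipC (_ : lip _ _ = -1) ?mulN1r ?opprK //.
by rewrite lip_hk0; case: j j3 => [|[|[|[|]]]].
Qed.

Lemma eps_sh0_ge3 (j : 'I_9) h : (2 < j)%N -> eps j.+1 (sh 0 h) = eps j.+1 h.
Proof.
move=> j3; rewrite /eps -ipC_sZ; congr (ipC _ h); apply: funext => i.
rewrite /sZ (_ : lip _ _ = 0) ?mul0r ?subr0 // lip_hk0.
by case: j j3 => [[|[|[|m]]] hm].
Qed.

Lemma alpha0_sh0 h : alpha0 (sh 0 h) = - alpha0 h.
Proof. by rewrite [LHS]alpha0E !eps_sh0_lt3 // alpha0E; ring. Qed.

Lemma shK (k : 'I_9) : involutive (sh (R:=R) k).
Proof.
move=> h; apply: funext => i; have [j ->|->] := unliftP ord0 i.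
  by rewrite -!epsSE /eps -!ipC_sZ sZK.
by apply: oppr_inj; rewrite -!eps0E /eps -!ipC_sZ sZK.
Qed.

End Pairing.

(** * Plane forms and their multiplicities *)

Section Homogeneous.
Variable R : realType.
Local Notation C := R[i].
Local Notation X := (C * C * C)%type.
Local Notation P3 := ({poly C} * {poly C} * {poly C})%type.

Lemma mem_mons d (m : expo) : (m \in mons d) = (m.1.1 + m.1.2 + m.2 == d)%N.
Proof.
case: m => [[a b] c] /=; apply/flatten_mapP/eqP.
  move=> [l + /mapP [j]]; rewrite !mem_iota => hl hj [-> -> ->] /=.
  lia.
move=> e; exists a; first by rewrite mem_iota /=; lia.
apply/mapP; exists b; first by rewrite mem_iota /=; lia.
congr (_, _, _); lia.
Qed.

Lemma uniq_mons d : uniq (mons d).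
Proof.
rewrite /mons; apply: allpairs_uniq_dep.
- exact: iota_uniq.
- by move=> i _; apply: iota_uniq.
by move=> [i j] [i' j'] _ _ /= [-> ->].
Qed.

Lemma size_mons d : size (mons d) = 'C(d.+2, 2).
Proof.
rewrite /mons size_flatten /shape -map_comp sumnE big_map.
rewrite (eq_bigr (fun i => (d - i).+1)); last first.
  by move=> i _ /=; rewrite size_map size_iota.
rewrite -[iota 0 d.+1]/(index_iota 0 d.+1) big_nat_rev /= -(bin2_sum d.+2).
rewrite [RHS]big_nat_recl // add0n !big_mkord; apply: eq_bigr => i _.
by rewrite subSS subKn // -ltnS.
Qed.

Definition mono (m : expo) (x : X) : C := x.1.1 ^+ m.1.1 * x.1.2 ^+ m.1.2 * x.2 ^+ m.2.
(** A form of degree [d] is handled through a function on exponents, of which only the values on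
    [mons d] matter. *)
Definition hp d (a : expo -> C) (x : X) := \sum_(m <- mons d) a m * mono m x.
Definition tor (x : X) := [&& x.1.1 != 0, x.1.2 != 0 & x.2 != 0].

Lemma sum_mons_delta d (F : expo -> C) m0 v : m0 \in mons d ->
  \sum_(m <- mons d) (if m0 == m then v else 0) * F m = v * F m0.
Proof.
move=> hm; rewrite (bigD1_seq m0) ?uniq_mons //= eqxx big1 ?addr0 // => m.
by rewrite eq_sym => /negPf ->; rewrite mul0r.
Qed.

Lemma hpZ d a u (x : X) : hp d a (u * x.1.1, u * x.1.2, u * x.2) = u ^+ d * hp d a x.
Proof.
rewrite /hp mulr_sumr big_seq [RHS]big_seq; apply: eq_bigr => m; rewrite mem_mons => /eqP <-.
by rewrite /mono /= !exprMn !exprD; ring.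
Qed.

Lemma hp_ext d a b x : (forall m, m \in mons d -> a m = b m) -> hp d a x = hp d b x.
Proof. by move=> h; rewrite /hp big_seq [RHS]big_seq; apply: eq_bigr => m /h ->. Qed.

Lemma hp_lin d a b u v x : hp d (fun m => u * a m + v * b m) x = u * hp d a x + v * hp d b x.
Proof. by rewrite /hp !mulr_sumr -big_split; apply: eq_bigr => m _ /=; ring. Qed.

Lemma poly_neq0_eq0 (p : {poly C}) : (forall s, s != 0 -> p.[s] = 0) -> p = 0.
Proof.
move=> h; apply: (@roots_geq_poly_eq0 _ _ [seq i.+1%:R | i <- iota 0 (size p)]).
- by apply/allP => s /mapP [i _ ->]; rewrite /root h ?pnatr_eq0.
- rewrite map_inj_uniq ?iota_uniq // => i j /eqP.
  by rewrite eqr_nat eqSS => /eqP.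
by rewrite size_map size_iota.
Qed.

Lemma poly_ext (p q : {poly C}) : (forall s, p.[s] = q.[s]) -> p = q.
Proof.
by move=> h; apply/eqP; rewrite -subr_eq0; apply/eqP/poly_neq0_eq0 => s _; rewrite !hornerE h subrr.
Qed.

(** Setting x_3 = 1 leaves a polynomial in x whose coefficients are polynomials in y; each has
    infinitely many roots, as it vanishes at all nonzero arguments. *)
Lemma hp_eq0 d a : (forall x, tor x -> hp d a x = 0) -> forall m, m \in mons d -> a m = 0.
Proof.
move=> h [[i j] k]; rewrite mem_mons /= => /eqP hijk.
have e x y : hp d a (x, y, 1) = (\poly_(i < d.+1) (\poly_(j < (d - i).+1) a (i, j, d - i - j)%N).[y]).[x].
  rewrite horner_poly /hp /mons big_flatten big_map.
  rewrite -[iota 0 d.+1]/(index_iota 0 d.+1) big_mkord; apply: eq_bigr => l _.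
  rewrite big_map -[iota 0 (d - l).+1]/(index_iota 0 (d - l).+1) big_mkord.
  rewrite horner_poly mulr_suml; apply: eq_bigr => o _.
  by rewrite /mono /= expr1n; ring.
have e2 y : y != 0 -> \poly_(i < d.+1) (\poly_(j < (d - i).+1) a (i, j, d - i - j)%N).[y] = 0.
  by move=> y0; apply: poly_neq0_eq0 => x x0; rewrite -e h // /tor /= x0 y0 oner_neq0.
have : \poly_(j < (d - i).+1) a (i, j, d - i - j)%N = 0.
  apply: poly_neq0_eq0 => y /e2 /(congr1 (fun p : {poly C} => p`_i)).
  by rewrite coef_poly coef0 (_ : (i < d.+1)%N) //; lia.
move/(congr1 (fun p : {poly C} => p`_j)).
rewrite coef_poly coef0 (_ : (j < (d - i).+1)%N); last by lia.
by rewrite (_ : d - i - j = k)%N //; lia.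
Qed.

Lemma hp_neq0 d a x : hp d a x != 0 -> exists2 m, m \in mons d & a m != 0.
Proof.
move=> h; apply: contrapT => hn; move/eqP: h; apply; rewrite /hp big_seq big1 // => m hm.
have [->|nz] := eqVneq (a m) 0; first by rewrite mul0r.
by case: hn; exists m.
Qed.

Section Coefficients.
Variables (T : Type) (S : (T -> C) -> Prop).
Hypothesis S0 : S (fun=> 0).
Hypothesis S1 : S (fun=> 1).
Hypothesis SD : forall a b, S a -> S b -> S (fun t => a t + b t).
Hypothesis SM : forall a b, S a -> S b -> S (fun t => a t * b t).

Lemma S_sum (I : Type) (r : seq I) (F : I -> T -> C) :
  (forall i, S (F i)) -> S (fun t => \sum_(i <- r) F i t).
Proof.
move=> h; elim: r => [|i r ih].
  by rewrite (_ : (fun t => _) = fun=> 0) //; apply: funext => t; rewrite big_nil.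
rewrite (_ : (fun t => _) = fun t => F i t + \sum_(i <- r) F i t); first exact: SD.
by apply: funext => t; rewrite big_cons.
Qed.

(* Families of forms of degree [d] with coefficients in a ring [S] of       *)
(* functions of a parameter.                                                *)
Definition pS d (G : T -> X -> C) := exists c : expo -> T -> C,
  (forall m, S (c m)) /\ forall t x, G t x = hp d (c^~ t) x.


Lemma pS_cst a : S a -> pS 0 (fun t _ => a t).
Proof.
by move=> ha; exists (fun=> a); split=> // t x; rewrite /hp /mons /= big_seq1 /mono /= !expr0 !mulr1.
Qed.

Lemma pSD d G H : pS d G -> pS d H -> pS d (fun t x => G t x + H t x).
Proof.
move=> [a [Sa ha]] [b [Sb hb]]; exists (fun m t => a m t + b m t).
split=> [m|t x]; first exact: SD.
rewrite ha hb -[hp d (a^~ t) x]mul1r -[hp d (b^~ t) x]mul1r -hp_lin.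
by apply: hp_ext => m _; rewrite !mul1r.
Qed.

Lemma pSM d e G H : pS d G -> pS e H -> pS (d + e) (fun t x => G t x * H t x).
Proof.
move=> [a [Sa ha]] [b [Sb hb]].
pose add (m n : expo) : expo := (m.1.1 + n.1.1, m.1.2 + n.1.2, m.2 + n.2)%N.
exists (fun k t => \sum_(m <- mons d) \sum_(n <- mons e) if add m n == k then a m t * b n t else 0).
split=> [k|t x].
  apply: S_sum => m; apply: S_sum => n; case: (add m n == k) => //; exact: SM.
rewrite ha hb [RHS]/hp.
under [RHS] eq_bigr => k _ do rewrite mulr_suml.
rewrite [RHS]exchange_big /= [hp d _ x]/hp mulr_suml big_seq [RHS]big_seq; apply: eq_bigr => m hm.
under [RHS]eq_bigr => k _ do rewrite mulr_suml.
rewrite [RHS]exchange_big /= /hp mulr_sumr big_seq [RHS]big_seq; apply: eq_bigr => n hn.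
rewrite sum_mons_delta /=; first by rewrite /mono /= !exprD; ring.
by move: hm hn; rewrite !mem_mons /= => /eqP <- /eqP <-; apply/eqP; lia.
Qed.

Lemma pSX d G n : pS d G -> pS (n * d) (fun t x => G t x ^+ n).
Proof.
move=> h; elim: n => [|n ih]; first by apply: pS_cst.
rewrite mulSn; have [c [Sc hc]] := pSM h ih.
by exists c; split=> // t x; rewrite -hc exprS.
Qed.

Lemma pS_sum d (I : Type) (r : seq I) (F : I -> T -> X -> C) :
  (forall i, pS d (F i)) -> pS d (fun t x => \sum_(i <- r) F i t x).
Proof.
move=> h; elim: r => [|i r ih].
  exists (fun _ _ => 0); split=> // t x.
  by rewrite big_nil /hp big1 // => m _; rewrite mul0r.
have [c [Sc hc]] := pSD (h i) ih.
by exists c; split=> // t x; rewrite -hc big_cons.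
Qed.

Lemma pS_var m : pS (m.1.1 + m.1.2 + m.2) (fun t x => mono m x).
Proof.
exists (fun n _ => if m == n then 1 else 0); split=> [n|t x]; first by case: eqP.
by rewrite /hp sum_mons_delta ?mul1r // mem_mons.
Qed.

Lemma pS_subst d c (G1 G2 G3 : T -> X -> C) : (forall m, S (c m)) ->
  pS 1 G1 -> pS 1 G2 -> pS 1 G3 ->
  pS d (fun t x => hp d (c^~ t) (G1 t x, G2 t x, G3 t x)).
Proof.
move=> Sc h1 h2 h3; rewrite /hp.
suff h m : pS d (fun t x => if m \in mons d then c m t * mono m (G1 t x, G2 t x, G3 t x) else 0).
  have [b [Sb hb]] := pS_sum (mons d) h.
  exists b; split=> // t x; rewrite -hb big_seq [RHS]big_seq.
  by apply: eq_bigr => m ->.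
case hm: (m \in mons d); last first.
  exists (fun _ _ => 0); split=> // t x.
  by rewrite /hp big1 // => n _; rewrite mul0r.
have := pSM (pS_cst (Sc m)) (pSM (pSM (pSX m.1.1 h1) (pSX m.1.2 h2)) (pSX m.2 h3)).
by rewrite add0n !muln1; move: hm; rewrite mem_mons => /eqP ->.
Qed.

End Coefficients.

Definition curve_at (g : P3) (s : C) : X := (g.1.1.[s], g.1.2.[s], g.2.[s]).
Definition pmono (m : expo) (g : P3) : {poly C} := g.1.1 ^+ m.1.1 * g.1.2 ^+ m.1.2 * g.2 ^+ m.2.
Definition hp_curve d a (g : P3) : {poly C} := \sum_(m <- mons d) a m *: pmono m g.

Lemma hp_curve_horner d a g s : (hp_curve d a g).[s] = hp d a (curve_at g s).
Proof.
by rewrite /hp_curve horner_sum; apply: eq_bigr => m _; rewrite hornerZ !hornerM !horner_exp.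
Qed.

(* [vanish n p d a]: the form of degree [d] with coefficients [a] vanishes to *)
(* order [n] at [p], tested along polynomial curves rather than by            *)
(* derivatives, so that invariance under polynomial maps is immediate.        *)
Definition vanish n (p : X) d a := forall g, curve_at g 0 = p -> 'X^n %| hp_curve d a g.

Lemma vanish0 p d a : vanish 0 p d a.
Proof. by move=> g _; rewrite expr0 dvd1p. Qed.

(** By homogeneity the order of vanishing depends only on the projective point. *)
Lemma vanishZ n p d a u : u != 0 -> vanish n p d a ->
  vanish n (u * p.1.1, u * p.1.2, u * p.2) d a.
Proof.
move=> u0 h g hg; pose g' := (u^-1 *: g.1.1, u^-1 *: g.1.2, u^-1 *: g.2).
have -> : hp_curve d a g = u ^+ d *: hp_curve d a g'.
  apply: poly_ext => s; rewrite hornerZ !hp_curve_horner -hpZ /curve_at /= !hornerZ.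
  by rewrite !mulrA !divff // !mul1r.
rewrite dvdpZr ?expf_neq0 //; apply: h; case: p hg => [[p1 p2] p3] /= [e1 e2 e3].
by rewrite /curve_at /= !hornerZ e1 e2 e3 !mulrA !mulVf // !mul1r.
Qed.

Definition axis_pt (i : nat) (c : C) : X := match i with 0 => (c, 0, 0) | 1 => (0, c, 0) | _ => (0, 0, c) end.

Lemma dvdXn_coef n (p : {poly C}) k : 'X^n %| p -> (k < n)%N -> p`_k = 0.
Proof. by move=> /dvdpP [q ->] hk; rewrite coefMXn hk. Qed.

(** At a coordinate point the multiplicity is visible on the monomials: restricting to lines through
    the point separates them by their degree in the other two variables. *)
Lemma vanish_ax_supp n d a i c : (i < 3)%N -> c != 0 -> vanish n (axis_pt i c) d a ->
  forall m, m \in mons d -> a m != 0 -> (ce m i + n <= d)%N.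
Proof.
move=> i3 c0 hv.
have {}hv u : u != 0 -> vanish n (axis_pt i u) d a.
  move=> u0; have := vanishZ (_ : u / c != 0) hv.
  rewrite mulf_neq0 ?invr_eq0 // => /(_ isT).
  by case: i i3 {hv} => [|[|[|//]]] _ /=; rewrite divfK // mulr0.
move=> m hm; apply: contraNT; rewrite -ltnNge => hlt.
have hmi : (ce m i <= d)%N.
  by move: hm; rewrite mem_mons; case: i i3 {hv hlt} => [|[|[|//]]] _ /=; lia.
suff : (if (d - ce m i == d - ce m i)%N then a m else 0) = 0 by rewrite eqxx => ->.
apply: (@hp_eq0 d (fun m' => if (d - ce m' i == d - ce m i)%N then a m' else 0)) => // u tu.
(* The line through the coordinate point in direction [u]: the coefficient of 'X^(d - ce m i) is the
   part of the form of that degree in the two other variables, evaluated at [u]. *)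
pose g : P3 := (if i == 0%N then (cx u 0)%:P else cx u 0 *: 'X,
          if i == 1%N then (cx u 1)%:P else cx u 1 *: 'X,
          if i == 2%N then (cx u 2)%:P else cx u 2 *: 'X).
have hg : curve_at g 0 = axis_pt i (cx u i).
  by rewrite /curve_at /g; case: i i3 {hv hlt hmi g} => [|[|[|//]]] _ /=; rewrite !hornerE ?mulr0.
have ui : cx u i != 0 by case/and3P: tu; case: i i3 {hv hlt hmi g hg} => [|[|[|//]]].
have pE : hp_curve d a g = \sum_(m' <- mons d) (a m' * mono m' u) *: 'X^(d - ce m' i).
  apply: poly_ext => s; rewrite hp_curve_horner horner_sum /hp big_seq [RHS]big_seq.
  apply: eq_bigr => m'; rewrite mem_mons => /eqP hm'.
  rewrite hornerZ hornerXn -[RHS]mulrA; congr (_ * _); rewrite -hm' /mono /curve_at /g.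
  case: i i3 {hv hlt hmi g hg ui} => [|[|[|//]]] _ /=; rewrite !hornerE /= !exprMn.
  - by rewrite -addnA addKn exprD; ring.
  - by rewrite addnAC addnK exprD; ring.
  - by rewrite addnK exprD; ring.
have := dvdXn_coef (hv _ ui g hg) (_ : (d - ce m i < n)%N).
rewrite pE coef_sum => h; rewrite -[RHS]h; last by lia.
rewrite /hp; apply: eq_bigr => m' _; rewrite coefZ coefXn eq_sym.
by case: eqP => _; rewrite ?mul0r ?mulr1 ?mulr0.
Qed.

Lemma dvdp_sum_seq (I : eqType) (r : seq I) (F : I -> {poly C}) q :
  (forall i, i \in r -> q %| F i) -> q %| \sum_(i <- r) F i.
Proof.
move=> h; rewrite big_seq; elim/big_ind: _ => [|x y|] //.
by apply: dvdp_add.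
Qed.

Lemma supp_vanish_ax n d a i c : (i < 3)%N ->
  (forall m, m \in mons d -> a m != 0 -> (ce m i + n <= d)%N) ->
  vanish n (axis_pt i c) d a.
Proof.
move=> i3 h g hg; apply: dvdp_sum_seq => -[[m1 m2] m3] hm.
have [->|nz] := eqVneq (a (m1, m2, m3)) 0; first by rewrite scale0r dvdp0.
have {h nz} hn := h _ hm nz; rewrite -mul_polyC; apply: dvdp_mull.
have X0 (p : {poly C}) k : p.[0] = 0 -> 'X^k %| p ^+ k.
  by move=> hp; apply: dvdp_exp2r; rewrite -['X]subr0 dvdp_XsubCl /root hp.
have dv k l : (k <= l)%N -> 'X^k %| ('X^l : {poly C}) by apply: dvdp_exp2l.
move: hm hn; rewrite mem_mons /= => /eqP hd hn.
case: i i3 hg hn => [|[|[|//]]] _ /= [h1 h2 h3] hn; rewrite /pmono /=.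
- have le : (n <= m2 + m3)%N by lia.
  apply: dvdp_trans (dv _ _ le) _.
  by rewrite -mulrA exprD; apply: dvdp_mull; apply: dvdp_mul; apply: X0.
- have le : (n <= m1 + m3)%N by lia.
  apply: dvdp_trans (dv _ _ le) _.
  by rewrite mulrAC exprD; apply: dvdp_mulr; apply: dvdp_mul; apply: X0.
- have le : (n <= m1 + m2)%N by lia.
  apply: dvdp_trans (dv _ _ le) _.
  by rewrite exprD; apply: dvdp_mulr; apply: dvdp_mul; apply: X0.
Qed.

End Homogeneous.

(** * Vanishing order from derivatives of top order *)

Section Derivatives.
Variable R : realType.
Local Notation C := R[i].

Definition dmon1 (k m : nat) (x : C) : C := (m ^_ k)%:R * x ^+ (m - k).

Lemma dmonE (k m : expo) (x : C * C * C) :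
  dmon k m x = dmon1 k.1.1 m.1.1 x.1.1 * dmon1 k.1.2 m.1.2 x.1.2 * dmon1 k.2 m.2 x.2.
Proof. by rewrite /dmon !big_ord_recl big_ord0 mulr1 mulrA. Qed.

Lemma dmon1_euler k m x : x * dmon1 k.+1 m x = (m%:R - k%:R) * dmon1 k m x.
Proof.
rewrite /dmon1 ffactnSr; case: (ltngtP k m) => hk.
- have -> : (m - k = (m - k.+1).+1)%N by lia.
  rewrite -natrB; last exact: ltnW.
  have -> : ((m - k) = (m - k.+1).+1)%N by lia.
  by rewrite natrM exprS; ring.
- by rewrite ffact_small // mul0n !mul0r !mulr0.
- by rewrite hk subnn muln0 !mul0r subrr mulr0 ?mul0r.
Qed.

Lemma dmon_euler d (m k : expo) (x : C * C * C) : m \in mons d ->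
  (d%:R - (k.1.1 + k.1.2 + k.2)%:R) * dmon k m x =
  x.1.1 * dmon (k.1.1.+1, k.1.2, k.2) m x + x.1.2 * dmon (k.1.1, k.1.2.+1, k.2) m x
  + x.2 * dmon (k.1.1, k.1.2, k.2.+1) m x.
Proof.
rewrite mem_mons => /eqP <-; rewrite !dmonE /=.
have e1 := dmon1_euler k.1.1 m.1.1 x.1.1.
have e2 := dmon1_euler k.1.2 m.1.2 x.1.2.
have e3 := dmon1_euler k.2 m.2 x.2.
transitivity ((x.1.1 * dmon1 k.1.1.+1 m.1.1 x.1.1) * dmon1 k.1.2 m.1.2 x.1.2 * dmon1 k.2 m.2 x.2
  + (x.1.2 * dmon1 k.1.2.+1 m.1.2 x.1.2) * dmon1 k.1.1 m.1.1 x.1.1 * dmon1 k.2 m.2 x.2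
  + (x.2 * dmon1 k.2.+1 m.2 x.2) * dmon1 k.1.1 m.1.1 x.1.1 * dmon1 k.1.2 m.1.2 x.1.2); last by ring.
rewrite e1 e2 e3 !natrD; ring.
Qed.

(** The bound [B] is independent of [m], so that the expansions of all monomials have the same index
    range and can be summed; the terms with k > m are zero. *)
Lemma exp_taylor (x : C) (q : {poly C}) m B : (m < B)%N ->
  (x%:P + q) ^+ m = \sum_(k < B) (dmon1 k m x / k`!%:R) *: q ^+ k.
Proof.
move=> mB; rewrite exprDn (big_ord_widen _ (fun i => x%:P ^+ (m - i) * q ^+ i *+ 'C(m, i)) mB).
rewrite big_mkcond; apply: eq_bigr => k _ /=.
have f0 : (k`!%:R : C) != 0 by rewrite pnatr_eq0 -lt0n fact_gt0.
have -> : dmon1 k m x / k`!%:R = x ^+ (m - k) * 'C(m, k)%:R.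
  by rewrite /dmon1 -bin_ffact natrM; field.
case: ltnP => hk; last by rewrite bin_small // mulr0 scale0r.
by rewrite -mul_polyC polyCM polyC_exp -mulr_natr polyC_natr; ring.
Qed.

Lemma prod3_sum (A : comNzRingType) B (F G H : 'I_B -> A) :
  (\sum_i F i) * (\sum_i G i) * (\sum_i H i) = \sum_i \sum_j \sum_k F i * G j * H k.
Proof.
rewrite -mulrA mulr_suml; apply: eq_bigr => i _; rewrite mulr_suml mulr_sumr.
by apply: eq_bigr => j _; rewrite !mulr_sumr; apply: eq_bigr => k _; rewrite mulrA.
Qed.

Lemma scale3 (z u v w : C) (p q r : {poly C}) :
  z *: ((u *: p) * (v *: q) * (w *: r)) = (z * (u * v * w)) *: (p * q * r).
Proof. by rewrite -!mul_polyC !polyCM; ring. Qed.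

(* Only the derivatives of order exactly n-1 are tested in [Fmat]; Euler's *)
(* identity gives the lower ones.                                          *)
Lemma vanish_deriv n d a (p : C * C * C) : (0 < n <= d)%N ->
  (forall k, k \in mons n.-1 -> \sum_(m <- mons d) a m * dmon k m p = 0) ->
  vanish n p d a.
Proof.
move=> /andP [n0 nd] h.
(* Descending induction on the order of the derivative; the Euler factor d - |k| is nonzero because
   |k| < n <= d. *)
have {}h : forall r k, (k.1.1 + k.1.2 + k.2 + r = n.-1)%N -> \sum_(m <- mons d) a m * dmon k m p = 0.
  elim=> [|r ih] k hk; first by apply: h; rewrite mem_mons -hk addn0.
  have dk : (d%:R - (k.1.1 + k.1.2 + k.2)%:R : C) != 0.
    by rewrite subr_eq0 eqr_nat; apply/eqP; lia.
  apply: (mulfI dk); rewrite mulr0 mulr_sumr big_seq.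
  rewrite (eq_bigr (fun m => p.1.1 * (a m * dmon (k.1.1.+1, k.1.2, k.2) m p) +
     (p.1.2 * (a m * dmon (k.1.1, k.1.2.+1, k.2) m p) +
      p.2 * (a m * dmon (k.1.1, k.1.2, k.2.+1) m p)))); last first.
    by move=> m hm; rewrite mulrCA (dmon_euler _ _ hm); ring.
  rewrite -big_seq !big_split -!mulr_sumr /= !ih /=; first by rewrite !mulr0 !addr0.
  1-3: lia.
move=> g hg.
have [q hq] : exists q : {poly C} * {poly C} * {poly C},
    g = (p.1.1%:P + 'X * q.1.1, p.1.2%:P + 'X * q.1.2, p.2%:P + 'X * q.2).
  have ex (f : {poly C}) c : f.[0] = c -> exists q, f = c%:P + 'X * q.
    move=> fc; have : 'X %| f - c%:P by rewrite -['X]subr0 dvdp_XsubCl /root !hornerE fc subrr.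
    by case/dvdpP => q hq; exists q; rewrite mulrC -hq addrC subrK.
  case: g hg => [[g1 g2] g3]; case: p h => [[p1 p2] p3] h [/ex [q1 ->] /ex [q2 ->] /ex [q3 ->]].
  by exists (q1, q2, q3).
pose cf (k : expo) := (\sum_(m <- mons d) a m * dmon k m p) / (k.1.1`!%:R * k.1.2`!%:R * k.2`!%:R).
have -> : hp_curve d a g = \sum_(i < d.+1) \sum_(j < d.+1) \sum_(k < d.+1)
    cf (i : nat, j : nat, k : nat) *: (('X * q.1.1) ^+ i * ('X * q.1.2) ^+ j * ('X * q.2) ^+ k).
  transitivity (\sum_(m <- mons d) \sum_(i < d.+1) \sum_(j < d.+1) \sum_(k < d.+1)
     (a m * dmon (i : nat, j : nat, k : nat) m p / (i`!%:R * j`!%:R * k`!%:R)) *: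
       (('X * q.1.1) ^+ i * ('X * q.1.2) ^+ j * ('X * q.2) ^+ k)).
    rewrite /hp_curve big_seq [RHS]big_seq; apply: eq_bigr => -[[m1 m2] m3].
    rewrite mem_mons /= => /eqP hm.
    rewrite hq /pmono /= (@exp_taylor _ _ m1 d.+1); last by lia.
    rewrite (@exp_taylor _ _ m2 d.+1); last by lia.
    rewrite (@exp_taylor _ _ m3 d.+1); last by lia.
    rewrite prod3_sum scaler_sumr; apply: eq_bigr => i _.
    rewrite scaler_sumr; apply: eq_bigr => j _.
    rewrite scaler_sumr; apply: eq_bigr => k _.
    rewrite scale3; congr (_ *: _).
    by rewrite dmonE /= !invfM; ring.
  rewrite exchange_big; apply: eq_bigr => i _.
  rewrite exchange_big; apply: eq_bigr => j _.
  rewrite exchange_big; apply: eq_bigr => k _.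
  by rewrite -scaler_suml /cf mulr_suml.
apply: dvdp_sum_seq => i _; apply: dvdp_sum_seq => j _; apply: dvdp_sum_seq => k _.
(* Taylor terms of order below n have zero coefficient; the others carry a factor 'X^n because [g]
   minus its value at 0 is divisible by 'X. *)
have [hlt|hge] := ltnP (i + j + k) n.
  rewrite /cf (h (n.-1 - (i + j + k))%N) ?mul0r ?scale0r ?dvdp0 //=.
  lia.
rewrite -mul_polyC; apply: dvdp_mull; rewrite !exprMn.
apply: dvdp_trans (dvdp_exp2l 'X hge) _.
have -> : 'X ^+ i * q.1.1 ^+ i * ('X ^+ j * q.1.2 ^+ j) * ('X ^+ k * q.2 ^+ k) =
   'X ^+ (i + j + k) * (q.1.1 ^+ i * q.1.2 ^+ j * q.2 ^+ k) by rewrite !exprD; ring.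
exact: dvdp_mulIl.
Qed.

End Derivatives.

(** * Cremona action on the linear systems *)

Section Cremona.
Variable R : realType.
Local Notation C := R[i].
Local Notation X := (C * C * C)%type.
Local Notation P3 := ({poly C} * {poly C} * {poly C})%type.
Variable th : C -> C.
Hypothesis br : bracket_fn th.
Implicit Types (h : hpt R) (L : lat) (x : X).

Definition posz (v : int) : nat := match v with Posz n => n | Negz _ => 0%N end.

(* The forms of degree [degL L] vanishing to order [nu_j] at each [p_j(h)]; a *)
(* negative [nu_j] (only for [L = e_j]) imposes nothing.                     *)
Definition linsys L h (a : expo -> C) := forall j : 'I_9,
  vanish (posz (- L (lift ord0 j))) (pt th j.+1 h) (degL L) a.

(** The formula for s_3(f_i) in the coordinates x; the factor tau_3 / tau_4 disappears because s_3
    also exchanges tau_3 and tau_4. *)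
Definition lin3 (i : nat) h (y z : C) : C :=
  (th (alpha0 h + eps2 3 4 h) * th (eps2 i 4 h) * y
   - th (alpha0 h + eps2 i 4 h) * th (eps2 3 4 h) * z) / (th (alpha0 h) * th (eps2 i 3 h)).

(* [plane_act k h x] are the coordinates [s_k(x)], for the lift of the action *)
(* of [s_k] from the [f_i] to the [x_i] which maps [x^C(t)] at [h] to [x^C(t)]  *)
(* at [s_k h] (up to a scalar for [k = 0]).                                  *)
Definition plane_act (k : 'I_9) h x : X :=
  match val k with
  | 0 => (x.1.1^-1, x.1.2^-1, x.2^-1)
  | 1 => (x.1.2, x.1.1, x.2)
  | 2 => (x.1.1, x.2, x.1.2)
  | 3 => (lin3 1 h x.1.1 x.2, lin3 2 h x.1.2 x.2, x.2)
  | _ => x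
  end.

(** Under this condition p_1, p_2, p_3 are the coordinate points, the other p_j lie in the torus,
    and the denominators of [lin3] are nonzero. *)
Definition nondeg h :=
  (forall i j : 'I_9, i != j -> th (eps2 i.+1 j.+1 h) != 0) /\
  (forall i j k : 'I_9, uniq [:: i; j; k] -> th (eps3 i.+1 j.+1 k.+1 h) != 0).

Lemma nondeg2 h i j : nondeg h -> (0 < i < 10)%N -> (0 < j < 10)%N -> i != j -> th (eps2 i j h) != 0.
Proof.
case=> h1 _; case: i => [//|i] /= hi; case: j => [//|j] /= hj ne.
exact: (h1 (Ordinal (hi : i < 9)%N) (Ordinal (hj : j < 9)%N)).
Qed.

Lemma nondeg3 h i j k : nondeg h -> (0 < i < 10)%N -> (0 < j < 10)%N -> (0 < k < 10)%N ->
  uniq [:: i; j; k] -> th (eps3 i j k h) != 0.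
Proof.
case=> _ h1; case: i => [//|i] /= hi; case: j => [//|j] /= hj; case: k => [//|k] /= hk ne.
exact: (h1 (Ordinal (hi : i < 9)%N) (Ordinal (hj : j < 9)%N) (Ordinal (hk : k < 9)%N)).
Qed.

Lemma nondeg_alpha0 h : nondeg h -> th (alpha0 h) != 0.
Proof. by move=> hB; rewrite alpha0E; apply: (@nondeg3 h 1 2 3). Qed.

Lemma eps_sh (k : 'I_9) j h : (0 < k)%N -> (j < 10)%N ->
  eps j (sh k h) = eps (swapn k k.+1 j) h.
Proof.
move=> k0; case: j => [_|j hj].
  by rewrite eps0_sh // /swapn eq_sym (gtn_eqF k0).
have := swS (Ordinal (hj : j < 9)%N) k0; move=> /= ->.
exact: (eps_sh_pos (Ordinal (hj : j < 9)%N)).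
Qed.

(** Since the p_j are the points of x^C at t = eps_j, the effect of s_k on the reference points
    follows from its effect on the curve. *)
Lemma pt_xC j h : pt th j h = xC th h (eps j h).
Proof.
rewrite /pt /xC /eps3 /eps2 alpha0E.
by congr (th _ * _ * _, th _ * _ * _, th _ * _ * _); ring.
Qed.

(** This is the Riemann relation multiplied by the common factor [eps_j - t]. *)
Lemma lin3_xC i j h t : th (alpha0 h) != 0 -> th (eps2 i 3 h) != 0 ->
  lin3 i h (th (alpha0 h + eps i h - t) * th (eps j h - t) * th (eps 3 h - t))
           (th (alpha0 h + eps 3 h - t) * th (eps i h - t) * th (eps j h - t)) =
  th (alpha0 h + eps2 3 4 h + eps i h - t) * th (eps j h - t) * th (eps 4 h - t).
Proof.
move=> n1 n2; rewrite /lin3 /eps2 in n2 *.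
set a := alpha0 h in n1 *; set e := eps i h in n2 *; set f := eps j h; set e3 := eps 3 h in n2 *; set e4 := eps 4 h.
(* The four arguments solve x + y = a, x - y = e - e3, u + v = a + e3 - e4 + e - t, u - v = e4 - t,
   so that the left side is the wanted product; the twelve sums and differences are then
   simplified. *)
case: br => _ _ _ /(_ ((a + e - e3) / 2) ((a - e + e3) / 2) ((a + e3 + e) / 2 - t) ((a + e3 + e) / 2 - e4)).
rewrite (_ : (a + e - e3) / 2 + (a - e + e3) / 2 = a); last by field.
rewrite (_ : (a + e - e3) / 2 - (a - e + e3) / 2 = e - e3); last by field.
rewrite (_ : (a + e3 + e) / 2 - t + ((a + e3 + e) / 2 - e4) = a + (e3 - e4) + e - t); last by field.
rewrite (_ : (a + e3 + e) / 2 - t - ((a + e3 + e) / 2 - e4) = e4 - t); last by field.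
rewrite (_ : (a + e - e3) / 2 + ((a + e3 + e) / 2 - t) = a + e - t); last by field.
rewrite (_ : (a + e - e3) / 2 - ((a + e3 + e) / 2 - t) = - (e3 - t)); last by field.
rewrite (_ : (a - e + e3) / 2 + ((a + e3 + e) / 2 - e4) = a + (e3 - e4)); last by field.
rewrite (_ : (a - e + e3) / 2 - ((a + e3 + e) / 2 - e4) = - (e - e4)); last by field.
rewrite (_ : (a + e - e3) / 2 + ((a + e3 + e) / 2 - e4) = a + (e - e4)); last by field.
rewrite (_ : (a + e - e3) / 2 - ((a + e3 + e) / 2 - e4) = - (e3 - e4)); last by field.
rewrite (_ : (a - e + e3) / 2 + ((a + e3 + e) / 2 - t) = a + e3 - t); last by field.
rewrite (_ : (a - e + e3) / 2 - ((a + e3 + e) / 2 - t) = - (e - t)); last by field.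
rewrite !(bracketN br) => rel.
have nz : th a * th (e - e3) != 0 by rewrite mulf_neq0.
apply: (mulIf nz); rewrite divfK //.
transitivity (th a * th (e - e3) * th (a + (e3 - e4) + e - t) * th (e4 - t) * th (f - t)); last by ring.
by rewrite rel; ring.
Qed.

Lemma plane_act_xC (k : 'I_9) h t : (0 < k)%N -> nondeg h ->
  plane_act k h (xC th h t) = xC th (sh k h) t.
Proof.
move=> k0 hB.
have a1 := nondeg_alpha0 hB; have := alpha0E (sh k h).
rewrite !eps_sh // /xC !eps_sh // => ->.
rewrite /plane_act; case: k k0 => [[|[|[|[|k]]]] hk] //= _.
- rewrite (_ : eps 0 h - eps 2 h - eps 1 h - eps 3 h = alpha0 h); last by rewrite alpha0E; ring.
  by congr (_, _, _); ring.
- rewrite (_ : eps 0 h - eps 1 h - eps 3 h - eps 2 h = alpha0 h); last by rewrite alpha0E; ring.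
  by congr (_, _, _); ring.
- rewrite (_ : eps 0 h - eps 1 h - eps 2 h - eps 4 h = alpha0 h + eps2 3 4 h); last first.
    by rewrite alpha0E /eps2; ring.
  rewrite (_ : _ + eps 4 h = alpha0 h + eps 3 h); last by rewrite /eps2; ring.
  congr (_, _, _).
    by rewrite lin3_xC //; apply: nondeg2.
  by rewrite [X in lin3 _ _ _ X]mulrAC lin3_xC //; apply: nondeg2.
by rewrite -alpha0E.
Qed.

Lemma xC_sh0 h t : xC th (sh 0 h) t =
  (th (eps 1 h - t) * th (alpha0 h + eps 2 h - t) * th (alpha0 h + eps 3 h - t),
   th (eps 2 h - t) * th (alpha0 h + eps 1 h - t) * th (alpha0 h + eps 3 h - t),
   th (eps 3 h - t) * th (alpha0 h + eps 1 h - t) * th (alpha0 h + eps 2 h - t)).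
Proof.
rewrite /xC alpha0_sh0 !eps_sh0_lt3 //.
by congr (th _ * th _ * th _, th _ * th _ * th _, th _ * th _ * th _); ring.
Qed.

Lemma plane_act_curve (k : 'I_9) h (g : P3) : (0 < k)%N ->
  exists g', forall s, curve_at g' s = plane_act k h (curve_at g s).
Proof.
rewrite /plane_act; case: k => [[|[|[|[|k]]]] hk] //= _.
- by exists (g.1.2, g.1.1, g.2).
- by exists (g.1.1, g.2, g.1.2).
- pose l i (p q : {poly C}) := ((th (alpha0 h) * th (eps2 i 3 h))^-1) *:
    ((th (alpha0 h + eps2 3 4 h) * th (eps2 i 4 h)) *: p
     - (th (alpha0 h + eps2 i 4 h) * th (eps2 3 4 h)) *: q).
  exists (l 1 g.1.1 g.2, l 2 g.1.2 g.2, g.2) => s.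
  by rewrite /curve_at /lin3 /l !hornerE; congr (_, _, _); rewrite mulrC.
by exists g.
Qed.

Lemma degL_sZ (k : 'I_9) L : (0 < k)%N -> degL (sZ k L) = degL L.
Proof. by move=> k0; rewrite /degL sZ_ord0. Qed.

(** The linear map carries polynomial curves through p_j(h) to polynomial curves through
    p_{s_k(j)}(s_k h), so the vanishing conditions pull back with permuted indices. *)
Lemma linsys_act (k : 'I_9) L h a a' : (0 < k)%N -> nondeg h -> linsys L (sh k h) a ->
  (forall x, hp (degL L) a' x = hp (degL L) a (plane_act k h x)) -> linsys (sZ k L) h a'.
Proof.
move=> k0 hB hV e j g hg; rewrite degL_sZ // sZ_lift //.
have [g' hg'] := plane_act_curve h g k0.
have -> : hp_curve (degL L) a' g = hp_curve (degL L) a g'.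
  by apply: poly_ext => s; rewrite !hp_curve_horner e hg'.
apply: hV; rewrite hg' hg !pt_xC plane_act_xC //.
by rewrite -(eps_sh_pos _ _ k0) shK.
Qed.

(* The monomial [x^m] goes to [x^(e - m)], that is to [x^e] times [x^m] at 1/x. *)
Definition cremona_coefs (e : expo) (a : expo -> C) (m : expo) : C :=
  if [&& m.1.1 <= e.1.1, m.1.2 <= e.1.2 & m.2 <= e.2]%N
  then a (e.1.1 - m.1.1, e.1.2 - m.1.2, e.2 - m.2)%N else 0.

Definition xinv x : X := (x.1.1^-1, x.1.2^-1, x.2^-1).

Lemma cremona_coefs_hp d d' e a x : (d + d' = e.1.1 + e.1.2 + e.2)%N ->
  (forall m, m \in mons d -> a m != 0 -> [&& m.1.1 <= e.1.1, m.1.2 <= e.1.2 & m.2 <= e.2]%N) ->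
  tor x -> hp d' (cremona_coefs e a) x = hp d a (xinv x) * mono e x.
Proof.
move=> de supp /and3P [x1 x2 x3].
pose le (m : expo) := [&& m.1.1 <= e.1.1, m.1.2 <= e.1.2 & m.2 <= e.2]%N.
pose c (m : expo) : expo := (e.1.1 - m.1.1, e.1.2 - m.1.2, e.2 - m.2)%N.
have -> : hp d' (cremona_coefs e a) x = \sum_(m <- [seq m <- mons d' | le m]) a (c m) * mono m x.
  rewrite big_filter big_mkcond; apply: eq_bigr => m _; rewrite /cremona_coefs -/(le m).
  by case: (le m); rewrite ?mul0r.
have cK m : le m -> c (c m) = m.
  by case: m => [[m1 m2] m3] /and3P [/= ? ? ?]; rewrite /c /=; congr (_, _, _); lia.
have -> : hp d a (xinv x) * mono e x = \sum_(m <- [seq m <- mons d | le m]) a m * mono (c m) x.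
  rewrite /hp mulr_suml big_filter [RHS]big_mkcond big_seq [RHS]big_seq; apply: eq_bigr => m hm.
  case lm: (le m); last first.
    have [->|nz] := eqVneq (a m) 0; first by rewrite !mul0r.
    by have := supp m hm nz; rewrite -/(le m) lm.
  rewrite -mulrA; congr (_ * _); move/and3P: lm => [l1 l2 l3].
  rewrite /mono /c /= !exprVn -{1}(subnK l1) -{1}(subnK l2) -{1}(subnK l3) !exprD.
  by field; rewrite !expf_neq0.
rewrite (perm_big [seq c m | m <- [seq m <- mons d | le m]]).
  rewrite big_map big_seq [RHS]big_seq; apply: eq_bigr => m.
  by rewrite mem_filter => /andP [lm _]; rewrite cK.
apply: uniq_perm; first by rewrite filter_uniq // uniq_mons.
  rewrite map_inj_in_uniq; first by rewrite filter_uniq // uniq_mons.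
  move=> m n; rewrite !mem_filter => /andP [lm _] /andP [ln _] h.
  by rewrite -[m]cK // h cK.
move=> m; apply/idP/mapP.
  rewrite mem_filter mem_mons => /andP [lm hm]; exists (c m); last by rewrite cK.
  rewrite mem_filter mem_mons; move: lm hm => /and3P [l1 l2 l3] /eqP hm.
  by rewrite /le /c /= !leq_subr /=; apply/eqP; lia.
case=> n; rewrite mem_filter mem_mons => /andP [/and3P [l1 l2 l3] /eqP hn] ->.
by rewrite mem_filter mem_mons /le /c /= !leq_subr /=; apply/eqP; lia.
Qed.

End Cremona.

(** * Exponent bookkeeping for s_0 *)

Section IntPowers.
Variable F : fieldType.
Implicit Types (x y z : F) (d l : int).

Lemma expfzN x l : x ^ (- l) = (x ^ l)^-1.
Proof. by rewrite invr_expz. Qed.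

Lemma expfz_tau (t a b c x y z : F) (d l1 l2 l3 : int) :
  t != 0 -> a != 0 -> b != 0 -> c != 0 -> x != 0 -> y != 0 -> z != 0 ->
  (t ^+ 2 * (x * y * z) / (a * b * c)) ^ d *
    ((a * (t * x / (a * b * c))) ^ l1 * (b * (t * y / (a * b * c))) ^ l2
     * (c * (t * z / (a * b * c))) ^ l3) =
  t ^ (2 * d + l1 + l2 + l3) * (a ^ (- d - l2 - l3) * b ^ (- d - l1 - l3) * c ^ (- d - l1 - l2))
  * (x ^ (d + l1) * y ^ (d + l2) * z ^ (d + l3)).
Proof.
move=> t0 a0 b0 c0 x0 y0 z0.
have -> : a * (t * x / (a * b * c)) = t * x * b^-1 * c^-1 by field; rewrite a0 b0 c0.
have -> : b * (t * y / (a * b * c)) = t * y * a^-1 * c^-1 by field; rewrite a0 b0 c0.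
have -> : c * (t * z / (a * b * c)) = t * z * a^-1 * b^-1 by field; rewrite a0 b0 c0.
have -> : t ^+ 2 * (x * y * z) / (a * b * c) = t * t * x * y * z * a^-1 * b^-1 * c^-1.
  by field; rewrite a0 b0 c0.
have -> : 2 * d = d + d by ring.
rewrite !expfzMl !exprz_inv !expfzDr // !expfzN.
by field; rewrite !expfz_neq0.
Qed.

Lemma expfz_bracket (e1 e2 e3 f1 f2 f3 : F) (d l1 l2 l3 : int) :
  e1 != 0 -> e2 != 0 -> e3 != 0 -> f1 != 0 -> f2 != 0 -> f3 != 0 ->
  (e1 * e2 * e3 * (f1 * f2 * f3)) ^ (- d) * (e1 ^ (- l1) * e2 ^ (- l2) * e3 ^ (- l3))
  * ((e1 * f2 * f3) ^ (d + l1) * (e2 * f1 * f3) ^ (d + l2) * (e3 * f1 * f2) ^ (d + l3)) =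
  f1 ^ (d + l2 + l3) * f2 ^ (d + l1 + l3) * f3 ^ (d + l1 + l2).
Proof.
move=> *; rewrite !expfzMl !expfzDr // !expfzN.
by field; rewrite !expfz_neq0.
Qed.

End IntPowers.

(** * The quadratic transformation s_0 on linear systems *)

Section CremonaZero.
Variable R : realType.
Local Notation C := R[i].
Local Notation X := (C * C * C)%type.
Variable th : C -> C.
Hypothesis br : bracket_fn th.
Implicit Types (h : hpt R) (L : lat) (x : X).

(** The exponents d - nu_i, i = 1, 2, 3: inverting the variables in a form of the system and
    multiplying by this monomial gives a form of degree 2d - nu_1 - nu_2 - nu_3. *)
Definition cexp L : expo := (`|(L ord0 + L (lift ord0 0))%R|%N,
  `|(L ord0 + L (lift ord0 1))%R|%N, `|(L ord0 + L (lift ord0 2))%R|%N).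

Lemma posz_cases v : (posz v : int) = v \/ (posz v = 0%N /\ (v < 0)%R).
Proof. by case: v => n; [left|right; split]. Qed.

Lemma degL_Minv L : Minv L -> (degL L : int) = L ord0.
Proof. by move=> /Minv_deg_ge0 h; rewrite /degL gez0_abs. Qed.

Lemma cexpE L : Minv L -> [/\ ((cexp L).1.1 : int) = L ord0 + L (lift ord0 0),
  ((cexp L).1.2 : int) = L ord0 + L (lift ord0 1) & ((cexp L).2 : int) = L ord0 + L (lift ord0 2)].
Proof. by move=> /Minv_bound h; split; rewrite /cexp /= gez0_abs. Qed.

Lemma degL_cremona L : Minv L ->
  (degL L + degL (sZ 0%R L) = (cexp L).1.1 + (cexp L).1.2 + (cexp L).2)%N.
Proof.
move=> hL; have [e1 e2 e3] := cexpE hL.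
have := degL_Minv (Minv_sZ 0 hL); have := degL_Minv hL; rewrite sZ0_ord0; lia.
Qed.

Lemma pt_ax i h : (i < 3)%N -> exists2 c, pt th i.+1 h = axis_pt i c & (nondeg th h -> c != 0).
Proof.
have th0 (j : nat) : th (eps2 j j h) = 0 by rewrite /eps2 subrr bracket0.
case: i => [|[|[|//]]] _ /=; eexists.
- by rewrite /pt !th0 !mulr0 !mul0r.
- by move=> hB; rewrite !mulf_neq0 //; by [apply: nondeg2|apply: nondeg3].
- by rewrite /pt !th0 !mulr0 !mul0r.
- by move=> hB; rewrite !mulf_neq0 //; by [apply: nondeg2|apply: nondeg3].
- by rewrite /pt !th0 !mulr0.
- by move=> hB; rewrite !mulf_neq0 //; by [apply: nondeg2|apply: nondeg3].
Qed.

Lemma linsys_supp L h a i : (i < 3)%N -> nondeg th h -> linsys th L h a ->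
  forall m, m \in mons (degL L) -> a m != 0 ->
  (ce m i + posz (- L (inord i.+1)) <= degL L)%N.
Proof.
move=> i3 hB hV; have [c hc c0] := pt_ax h i3.
have hi : (i < 9)%N by lia.
have := hV (Ordinal hi); rewrite /= hc -inordS /= => hv.
exact: vanish_ax_supp i3 (c0 hB) hv.
Qed.

Lemma inord1 : inord 1 = lift ord0 0 :> 'I_10. Proof. exact: (inordS 0). Qed.
Lemma inord2 : inord 2 = lift ord0 1 :> 'I_10. Proof. exact: (inordS 1). Qed.
Lemma inord3 : inord 3 = lift ord0 2 :> 'I_10. Proof. exact: (inordS 2). Qed.

(** The multiplicities at the coordinate points confine the monomials to the box below [cexp L], so
    [cremona_coefs] discards no coefficient. *)
Lemma linsys_supp_le L h a : Minv L -> nondeg th h -> linsys th L h a ->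
  forall m, m \in mons (degL L) -> a m != 0 ->
  [&& m.1.1 <= (cexp L).1.1, m.1.2 <= (cexp L).1.2 & m.2 <= (cexp L).2]%N.
Proof.
move=> hL hB hV m hm nz; have [e1 e2 e3] := cexpE hL; have dL := degL_Minv hL.
have := linsys_supp (isT : (0 < 3)%N) hB hV hm nz; rewrite inord1 /=.
have := linsys_supp (isT : (1 < 3)%N) hB hV hm nz; rewrite inord2 /=.
have := linsys_supp (isT : (2 < 3)%N) hB hV hm nz; rewrite inord3 /=.
case: m {hm nz} => [[m1 m2] m3] /=.
have := posz_cases (- L (lift ord0 0)); have := posz_cases (- L (lift ord0 1)).
by have := posz_cases (- L (lift ord0 2)); lia.
Qed.

Lemma pt_tor j h : (2 < j < 9)%N -> nondeg th h -> tor (pt th j.+1 h).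
Proof.
move=> hj hB; apply/and3P; split; rewrite /= !mulf_neq0 //;
 by [apply: nondeg2 => //; lia | apply: nondeg3 => //=; rewrite ?inE; lia].
Qed.

Lemma pt_cremona (j : 'I_9) h : (2 < j)%N -> exists u,
  (nondeg th h -> u != 0) /\ let p := pt th j.+1 h in let q := pt th j.+1 (sh 0 h) in
  (p.1.2 * p.2, p.1.1 * p.2, p.1.1 * p.1.2) = (u * q.1.1, u * q.1.2, u * q.2).
Proof.
move=> hj; exists (th (eps2 1 j.+1 h) * th (eps2 2 j.+1 h) * th (eps2 3 j.+1 h)); split.
  by move=> hB; rewrite !mulf_neq0 //; apply: nondeg2 => //; have := ltn_ord j; lia.
rewrite !pt_xC (eps_sh0_ge3 _ hj) xC_sh0 /xC /eps2 /=.
by congr (_, _, _); ring.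
Qed.

(** At p_1, p_2, p_3 the new multiplicities are read off the support. Every other p_j lies in the
    torus, where inversion is invertible and sends p_j(h) to p_j(s_0 h) up to scale. *)
Lemma linsys_cremona L h a : Minv L -> nondeg th h -> nondeg th (sh 0 h) -> linsys th L (sh 0 h) a ->
  linsys th (sZ 0 L) h (cremona_coefs (cexp L) a).
Proof.
move=> hL hB hB' hV j.
have [e1 e2 e3] := cexpE hL; have dL := degL_Minv hL.
have dL' := degL_Minv (Minv_sZ 0 hL); rewrite sZ0_ord0 in dL'.
have supp := linsys_supp_le hL hB' hV.
case: (ltnP 2 j) => hj; last first.
  have [c hc _] := pt_ax h (hj : (j < 3)%N); rewrite hc.
  apply: supp_vanish_ax => // m hm; rewrite /cremona_coefs; case: ifP; last by rewrite eqxx.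
  move=> /and3P [le1 le2 le3] _.
  move: hm le1 le2 le3; rewrite mem_mons => /eqP; case: m => [[m1 m2] m3] /= hm le1 le2 le3.
  have [ej|[ej|ej]] : j = 0 \/ j = 1 \/ j = 2.
    by case: j hj {hc} => [[|[|[|n]]] hn] //= _; [left|right; left|right; right]; apply: val_inj.
  - rewrite ej sZ0_lift0 /=; have := posz_cases (- (- L ord0 - L (lift ord0 1) - L (lift ord0 2))); lia.
  - rewrite ej sZ0_lift1 /=; have := posz_cases (- (- L ord0 - L (lift ord0 0) - L (lift ord0 2))); lia.
  - rewrite ej sZ0_lift2 /=; have := posz_cases (- (- L ord0 - L (lift ord0 0) - L (lift ord0 1))); lia.
move=> g hg; rewrite sZ0_lift_ge3 //.
set n := posz _; pose g' := (g.1.2 * g.2, g.1.1 * g.2, g.1.1 * g.1.2).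
have dg' : 'X^n %| hp_curve (degL L) a g'.
  have [u [u0 hu]] := pt_cremona h hj.
  apply: (vanishZ (u0 hB) (hV j)); rewrite -hu -hg.
  by rewrite /curve_at /= !hornerM.
pose q := g.1.1 * g.1.2 * g.2.
pose r := pmono (cexp L) g.
(* Powers of [q] clear denominators; the extra factor [q] on both sides makes the identity hold also
   where a coordinate of [g] vanishes. *)
have id : hp_curve (degL (sZ 0 L)) (cremona_coefs (cexp L) a) g * q ^+ (degL L).+1 = hp_curve (degL L) a g' * (r * q).
  apply: poly_ext => s; rewrite !hornerM horner_exp !hp_curve_horner !hornerM.
  have [t0|] := boolP (tor (curve_at g s)); last first.
    by rewrite /tor !negb_and !negbK /curve_at /= => /or3P [] /eqP ->; rewrite ?(mul0r, mulr0) exprS ?(mul0r, mulr0).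
  rewrite (cremona_coefs_hp (degL_cremona hL) supp t0) exprSr.
  have -> : hp (degL L) a (curve_at g' s) = (g.1.1.[s] * g.1.2.[s] * g.2.[s]) ^+ degL L * hp (degL L) a (xinv (curve_at g s)).
    rewrite -hpZ /curve_at /xinv /g' /= !hornerM; move: t0 => /and3P [/= s1 s2 s3].
    by congr (hp _ _ (_, _, _)); field.
  rewrite ![in RHS]horner_exp /mono /curve_at /=.
  by ring.
have : 'X^n %| hp_curve (degL (sZ 0 L)) (cremona_coefs (cexp L) a) g * q ^+ (degL L).+1.
  by rewrite id; apply: dvdp_mulr.
(* As p_j is in the torus, q(0) is nonzero and [q] can be cancelled from the divisibility. *)
rewrite Gauss_dvdpl //; apply: coprimep_expl; apply: coprimep_expr.
rewrite coprimep_sym -['X]subr0 coprimep_XsubC /root /q !hornerM.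
have := pt_tor (_ : 2 < j < 9)%N hB; rewrite hj ltn_ord -hg => /(_ isT) /and3P [/= s1 s2 s3].
by rewrite !mulf_neq0.
Qed.

End CremonaZero.

(** * Coefficients in K, and the linear system along a word *)

Section Words.
Variable R : realType.
Local Notation C := R[i].
Local Notation X := (C * C * C)%type.
Variable th : C -> C.
Hypothesis br : bracket_fn th.
Implicit Types (h : hpt R) (L : lat) (x : X).

Lemma swapn_l a b : swapn a b a = b. Proof. by rewrite /swapn eqxx. Qed.
Lemma swapn_lt a i : (i < a)%N -> swapn a a.+1 i = i.
Proof. by move=> ia; rewrite /swapn !ltn_eqF // ltnW. Qed.

Lemma inK_ext (c c' : hpt R -> C) : c =1 c' -> inK th c -> inK th c'.
Proof. by move=> e [a ha]; exists a => h; rewrite -e. Qed.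

Lemma inK1 : inK th (fun=> 1). Proof. by exists Kone. Qed.
Lemma inKD (c c' : hpt R -> C) : inK th c -> inK th c' -> inK th (fun h => c h + c' h).
Proof. by move=> [a ha] [b hb]; exists (Kadd a b) => h /=; rewrite -ha -hb. Qed.
Lemma inKM (c c' : hpt R -> C) : inK th c -> inK th c' -> inK th (fun h => c h * c' h).
Proof. by move=> [a ha] [b hb]; exists (Kmul a b) => h /=; rewrite -ha -hb. Qed.
Lemma inKN (c : hpt R -> C) : inK th c -> inK th (fun h => - c h).
Proof. by move=> [a ha]; exists (Kopp a) => h /=; rewrite -ha. Qed.
Lemma inKV (c : hpt R -> C) : inK th c -> inK th (fun h => (c h)^-1).
Proof. by move=> [a ha]; exists (Kinv a) => h /=; rewrite -ha. Qed.
Lemma inK0 : inK th (fun=> 0).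
Proof. by apply: inK_ext (inKD inK1 (inKN inK1)) => h; rewrite subrr. Qed.

Lemma inK_nat n : inK th (fun=> n%:R).
Proof.
elim: n => [|n ih]; first exact: inK0.
by apply: inK_ext (inKD ih inK1) => h; rewrite -natr1.
Qed.

Lemma inK_sh k (c : hpt R -> C) : inK th c -> inK th (fun h => c (sh k h)).
Proof.
case=> a ha.
pose fix up (a : Kexp) : Kexp := match a with
  | Kone => Kone | Kbr w j => Kbr (k :: w) j | Kadd a b => Kadd (up a) (up b)
  | Kopp a => Kopp (up a) | Kmul a b => Kmul (up a) (up b) | Kinv a => Kinv (up a) end.
exists (up a) => h; rewrite ha.
elim: a {ha} => //= [w j|a -> b ->|a ->|a -> b ->|a ->] //.
by rewrite ipC_sZ.
Qed.

Lemma inK_hk k : inK th (fun h => th (ipC (hk k) h)).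
Proof. by exists (Kbr [::] k). Qed.

(** The roots eps_ij, and likewise eps_ijk below, are reached from a simple root by reflections
    shifting one index at a time. *)
Lemma inK_eps2_lt i j : (0 < i < j)%N -> (j < 10)%N -> inK th (fun h => th (eps2 i j h)).
Proof.
move=> /andP [i0]; elim: j => [//|j ih] ij j9.
pose J := Ordinal (ltnSE j9 : (j < 9)%N).
have J0 : (0 < J)%N by rewrite /=; lia.
move: ij; rewrite ltnS leq_eqVlt => /predU1P [->|ij].
  by apply: inK_ext (inK_hk J) => h; rewrite ipC_hk.
apply: inK_ext (inK_sh J (ih ij (ltnW j9))) => h.
rewrite /eps2 !eps_sh //=; try lia.
by rewrite swapn_l swapn_lt.
Qed.

Lemma inK_eps2 i j : (0 < i < 10)%N -> (0 < j < 10)%N -> inK th (fun h => th (eps2 i j h)).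
Proof.
move=> /andP [i0 i9] /andP [j0 j9]; case: (ltngtP i j) => ij.
- by apply: inK_eps2_lt; rewrite // i0.
- apply: inK_ext (inKN (inK_eps2_lt (_ : 0 < j < i)%N i9)) => [h|]; last by rewrite j0.
  by rewrite -bracketN // /eps2 opprB.
by apply: inK_ext inK0 => h; rewrite ij /eps2 subrr bracket0.
Qed.

Lemma inK_eps312 j : (2 < j < 10)%N -> inK th (fun h => th (eps3 1 2 j h)).
Proof.
move=> /andP []; elim: j => [//|j ih] j2 j9.
move: j2; rewrite ltnS leq_eqVlt => /predU1P [<-|j2].
  by apply: inK_ext (inK_hk 0) => h; rewrite ipC_hk0 alpha0E.
pose J := Ordinal (ltnSE j9 : (j < 9)%N).
have J0 : (0 < J)%N by rewrite /=; lia.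
apply: inK_ext (inK_sh J (ih j2 (ltnW j9))) => h.
rewrite /eps3 !eps_sh //=; try lia.
by rewrite swapn_l !swapn_lt //; lia.
Qed.

Lemma inK_eps313 j : (3 < j < 10)%N -> inK th (fun h => th (eps3 1 3 j h)).
Proof.
move=> hj; apply: inK_ext (inK_sh 2 (inK_eps312 (_ : 2 < j < 10)%N)) => [h|]; last by lia.
rewrite /eps3 !eps_sh //=; try lia.
by rewrite /swapn /= !gtn_eqF //; lia.
Qed.

Lemma inK_eps323 j : (3 < j < 10)%N -> inK th (fun h => th (eps3 2 3 j h)).
Proof.
move=> hj; apply: inK_ext (inK_sh 1 (inK_eps313 hj)) => h.
rewrite /eps3 !eps_sh //=; try lia.
by rewrite /swapn /= !gtn_eqF //; lia.
Qed.

Lemma inK_alpha0 : inK th (fun h => th (alpha0 h)).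
Proof. exact: inK_hk 0. Qed.

(** For j <= 3 the brackets with a repeated index are not at roots, but they only occur multiplied
    by [eps_jj] = 0. *)
Lemma inK_pt j : (0 < j < 10)%N -> [/\ inK th (fun h => (pt th j h).1.1),
  inK th (fun h => (pt th j h).1.2) & inK th (fun h => (pt th j h).2)].
Proof.
move=> hj; have th0 (i : nat) h : th (eps2 i i h) = 0 by rewrite /eps2 subrr bracket0.
have [j3|j3] := ltnP 3 j.
  split; do 2?apply: inKM; first
    [apply: inK_eps2; lia | apply: inK_eps323; lia | apply: inK_eps313; lia | apply: inK_eps312; lia].
have i1 : inK th (fun h => th (eps3 2 3 1 h)).
  by apply: inK_ext inK_alpha0 => h; rewrite alpha0E /eps3; congr th; ring.
have i2 : inK th (fun h => th (eps3 1 3 2 h)).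
  by apply: inK_ext inK_alpha0 => h; rewrite alpha0E /eps3; congr th; ring.
have i3 : inK th (fun h => th (eps3 1 2 3 h)).
  by apply: inK_ext inK_alpha0 => h; rewrite alpha0E.
case: j hj j3 => [|[|[|[|j]]]] //= _ _; rewrite /pt /=; split.
- by do !apply: inKM => //; apply: inK_eps2.
- by apply: inK_ext inK0 => h; rewrite th0 mulr0 mul0r.
- by apply: inK_ext inK0 => h; rewrite th0 mulr0 mul0r.
- by apply: inK_ext inK0 => h; rewrite th0 mulr0 mul0r.
- by do !apply: inKM => //; apply: inK_eps2.
- by apply: inK_ext inK0 => h; rewrite th0 mulr0.
- by apply: inK_ext inK0 => h; rewrite th0 mulr0.
- by apply: inK_ext inK0 => h; rewrite th0 mulr0.
- by do !apply: inKM => //; apply: inK_eps2.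
Qed.

Section LinearSubst.
Variables (T : Type) (S : (T -> C) -> Prop) (hh : T -> hpt R).
Hypothesis S0 : S (fun=> 0).
Hypothesis S1 : S (fun=> 1).
Hypothesis SD : forall a b, S a -> S b -> S (fun t => a t + b t).
Hypothesis SM : forall a b, S a -> S b -> S (fun t => a t * b t).
Hypothesis SK : forall c, inK th c -> S (fun t => c (hh t)).

Lemma pS_ext d (G H : T -> X -> C) : (forall t x, G t x = H t x) -> pS S d G -> pS S d H.
Proof. by move=> e [c [hc e']]; exists c; split=> // t x; rewrite -e. Qed.

(** Abstract in the coefficient ring [S]: it serves for coefficients in K depending on [h], and,
    with [S] trivial, for a single form at fixed [h]. *)
Lemma pS_plane_act (k : 'I_9) d c : (0 < k)%N -> (forall m, S (c m)) ->
  pS S d (fun t x => hp d (c^~ t) (plane_act th k (hh t) x)).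
Proof.
move=> k0 hc.
have v1 : pS S 1 (fun t x => x.1.1).
  by apply: pS_ext (pS_var S0 S1 (1, 0, 0)%N) => t x; rewrite /mono /= expr1 !expr0 !mulr1.
have v2 : pS S 1 (fun t x => x.1.2).
  by apply: pS_ext (pS_var S0 S1 (0, 1, 0)%N) => t x; rewrite /mono /= expr1 !expr0 mul1r mulr1.
have v3 : pS S 1 (fun t x => x.2).
  by apply: pS_ext (pS_var S0 S1 (0, 0, 1)%N) => t x; rewrite /mono /= expr1 !expr0 !mul1r.
have l i (G : T -> X -> C) : (0 < i < 3)%N -> pS S 1 G ->
    pS S 1 (fun t x => lin3 th i (hh t) (G t x) x.2).
  move=> hi hG.
  have ka4 : inK th (fun h => th (alpha0 h + eps2 3 4 h)).
    apply: inK_ext (inK_eps312 (isT : 2 < 4 < 10)%N) => h.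
    by rewrite /eps3 /eps2 alpha0E; congr th; ring.
  have kai : inK th (fun h => th (alpha0 h + eps2 i 4 h)).
    case: i hi => [//|[|[|//]]] _.
      apply: inK_ext (inK_eps323 (isT : 3 < 4 < 10)%N) => h.
      by rewrite /eps3 /eps2 alpha0E; congr th; ring.
    apply: inK_ext (inK_eps313 (isT : 3 < 4 < 10)%N) => h.
    by rewrite /eps3 /eps2 alpha0E; congr th; ring.
  have ki4 : inK th (fun h => th (eps2 i 4 h)) by apply: inK_eps2 => //; lia.
  have ki3 : inK th (fun h => th (eps2 i 3 h)) by apply: inK_eps2 => //; lia.
  have k34 : inK th (fun h => th (eps2 3 4 h)) by apply: inK_eps2.
  have kd := inKV (inKM inK_alpha0 ki3).
  have A := pSM S0 SD SM (pS_cst (SK (inKM (inKM ka4 ki4) kd))) hG.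
  have B := pSM S0 SD SM (pS_cst (SK (inKN (inKM (inKM kai k34) kd)))) v3.
  by apply: pS_ext (pSD SD A B) => t x; rewrite /lin3; ring.
rewrite /plane_act; case: k k0 => [[|[|[|[|k]]]] hk] //= _.
- exact: pS_subst.
- exact: pS_subst.
- apply: pS_subst => //; exact: l.
by exists c.
Qed.

End LinearSubst.

Lemma hp_plane_act (k : 'I_9) d (a : expo -> C) h : (0 < k)%N -> exists a', forall x, hp d a' x = hp d a (plane_act th k h x).
Proof.
move=> k0; have := @pS_plane_act unit (fun=> True) (fun=> h) I I (fun _ _ _ _ => I) (fun _ _ _ _ => I) (fun _ _ => I) k d (fun m _ => a m) k0 (fun=> I).
by case=> c [_ hc]; exists (c^~ tt) => x; rewrite -hc.
Qed.

(* For [w = s_k1 ... s_kr], [tauw th w h] is computed by visiting the points *)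
(* [h], [s_k1 h], [s_k2 s_k1 h], ...; the [_along] predicates require          *)
(* genericity at each of them.                                               *)
Fixpoint nondeg_along (w : seq 'I_9) h : Prop :=
  nondeg th h /\ (if w is k :: w' then nondeg_along w' (sh k h) else True).

Lemma nondeg_along_nondeg w h : nondeg_along w h -> nondeg th h. Proof. by case: w => [|k w] []. Qed.

Lemma lin3K i h y z : nondeg th h -> nondeg th (sh 3 h) -> (0 < i < 3)%N ->
  lin3 th i (sh 3 h) (lin3 th i h y z) z = y.
Proof.
move=> hB hB' hi.
have a' : alpha0 (sh 3 h) = alpha0 h + eps2 3 4 h.
  by rewrite alpha0E !eps_sh //= /swapn /= alpha0E /eps2; ring.
have ei j : (j < 3)%N -> eps j (sh 3 h) = eps j h.
  by move=> hj; rewrite eps_sh //; [case: j hj => [|[|[|]]]|lia].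
have e3 : eps 3 (sh 3 h) = eps 4 h by rewrite eps_sh.
have e4 : eps 4 (sh 3 h) = eps 3 h by rewrite eps_sh.
have i3 : (i < 3)%N by lia.
have n1 := nondeg_alpha0 hB; have n2 := nondeg_alpha0 hB'.
have n3 : th (eps2 i 3 h) != 0 by apply: nondeg2 => //; lia.
have n4 : th (eps2 i 3 (sh 3 h)) != 0 by apply: nondeg2 => //; lia.
move: n1 n2 n3 n4; rewrite /lin3 a' /eps2 e3 e4 ei //.
rewrite (_ : eps 4 h - eps 3 h = - (eps 3 h - eps 4 h)); last by ring.
rewrite (_ : alpha0 h + (eps 3 h - eps 4 h) - (eps 3 h - eps 4 h) = alpha0 h); last by ring.
rewrite (_ : alpha0 h + (eps 3 h - eps 4 h) + (eps i h - eps 3 h) = alpha0 h + (eps i h - eps 4 h)); last by ring.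
rewrite (bracketN br) => n1 n2 n3 n4.
by field; rewrite n1 n2 n3 n4.
Qed.

Lemma plane_actK k h x : nondeg th h -> nondeg th (sh k h) -> plane_act th k (sh k h) (plane_act th k h x) = x.
Proof.
case: x => [[x1 x2] x3]; rewrite /plane_act; case: k => [[|[|[|[|k]]]] hk] //= hB hB'.
  by rewrite !invrK.
by rewrite (_ : Ordinal hk = 3) in hB' *; [rewrite !lin3K|apply: val_inj].
Qed.

(** Dimension at most one, phrased as dependence of any two members. The first letter of the word
    carries both forms to the system of the shorter word at s_k h, and a dependence found there
    comes back because the transformation is invertible on generic points. *)
Lemma linsys_dim1 w h a b : nondeg_along w h ->
  linsys th (actZ w (evec 9)) h a -> linsys th (actZ w (evec 9)) h b ->
  exists u v, (u != 0) || (v != 0) /\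
    forall m, m \in mons (degL (actZ w (evec 9))) -> u * a m + v * b m = 0.
Proof.
elim: w h a b => [|k w ih] h a b.
  move=> _ _ _; rewrite /= (_ : degL (evec 9) = 0%N) // /mons /=.
  have [a0|a0] := eqVneq (a (0, 0, 0)%N) 0.
    exists 1, 0; rewrite oner_neq0; split=> // m; rewrite inE => /eqP ->.
    by rewrite a0 mulr0 mul0r addr0.
  exists (b (0, 0, 0)%N), (- a (0, 0, 0)%N); rewrite oppr_eq0 a0 orbT; split=> // m.
  by rewrite inE => /eqP ->; ring.
case=> hB hG hVa hVb; set L := actZ w (evec 9) in ih.
have hB' := nondeg_along_nondeg hG.
have hL : Minv L by apply/Minv_actZ/(Minv_evec ord_max).
have hL' : Minv (sZ k L) by apply: Minv_sZ.
have eL : sZ k (sZ k L) = L := sZK k L.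
(* Writing [h] as s_k s_k h lets the transport lemmas run from [h] to [sh k h], that is from s_k
   Lambda back to Lambda. *)
have {}hVa : linsys th (sZ k L) (sh k (sh k h)) a by rewrite shK.
have {}hVb : linsys th (sZ k L) (sh k (sh k h)) b by rewrite shK.
rewrite /= -/L.
case: (posnP k) => [k0|k0].
  have {k0} kE : k = 0 by apply: val_inj.
  move: hB hB' hG hL' eL hVa hVb; rewrite kE => hB hB' hG hL' eL hVa hVb.
  have hBB : nondeg th (sh 0 (sh 0 h)) by rewrite shK.
  have Va := linsys_cremona br hL' hB' hBB hVa.
  have Vb := linsys_cremona br hL' hB' hBB hVb.
  move: (Va) (Vb); rewrite eL => Va' Vb'.
  have [u [v [uv huv]]] := ih _ _ _ hG Va' Vb'.
  exists u, v; split=> //; apply: hp_eq0 => x tx.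
  have sa := linsys_supp_le br hL' hBB hVa; have sb := linsys_supp_le br hL' hBB hVb.
  have ti : tor (xinv x) by move: tx; rewrite /tor /xinv /= !invr_eq0.
  have dd := degL_cremona hL'.
  have ea := cremona_coefs_hp dd sa ti; have eb := cremona_coefs_hp dd sb ti.
  have m0 : mono (cexp (sZ 0 L)) (xinv x) != 0.
    by case/and3P: ti => *; rewrite /mono !mulf_neq0 ?expf_neq0.
  have xx : xinv (xinv x) = x by case: x {tx ti ea eb m0} => [[x1 x2] x3]; rewrite /xinv /= !invrK.
  rewrite xx in ea eb; apply: (mulIf m0); rewrite mul0r hp_lin mulrDl -!mulrA -ea -eb -hp_lin eL.
  by rewrite /hp big_seq big1 // => m /huv ->; rewrite mul0r.
have [a' ha'] := hp_plane_act (degL (sZ k L)) a (sh k h) k0.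
have [b' hb'] := hp_plane_act (degL (sZ k L)) b (sh k h) k0.
have Va := linsys_act br k0 hB' hVa ha'; have Vb := linsys_act br k0 hB' hVb hb'.
rewrite eL in Va Vb.
have [u [v [uv huv]]] := ih _ _ _ hG Va Vb.
exists u, v; split=> //; apply: hp_eq0 => x tx.
have xx : plane_act th k (sh k h) (plane_act th k h x) = x by apply: plane_actK.
rewrite -xx hp_lin -ha' -hb' -hp_lin degL_sZ //.
by rewrite /hp big_seq big1 // => m /huv ->; rewrite mul0r.
Qed.

End Words.

(** * Lattice tau-functions *)

Section TauFunction.
Variable R : realType.
Local Notation C := R[i].
Local Notation X := (C * C * C)%type.
Variable th : C -> C.
Hypothesis br : bracket_fn th.
Implicit Types (h : hpt R) (L : lat) (x : X) (tau : 'I_9 -> C).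

(** For such t the point x^C(t) is in the torus and all factors [eps_j - t] are invertible. *)
Definition time_ok h (t : C) := (forall j : 'I_9, th (eps j.+1 h - t) != 0) /\
  (forall j : 'I_3, th (alpha0 h + eps j.+1 h - t) != 0).

Fixpoint time_along (w : seq 'I_9) h t : Prop :=
  time_ok h t /\ (if w is k :: w' then time_along w' (sh k h) t else True).

Fixpoint tor_along (w : seq 'I_9) h x : Prop :=
  if w is k :: w' then tor x /\ tor_along w' (sh k h) (plane_act th k h x) else True.

Definition f_of_x (t0 : C) x tau : 'I_3 -> C := fun i => t0 * cx x i / (tau 0 * tau 1 * tau 2).

Definition Lmon (y : C) L tau := y ^ (L ord0) * \prod_(j < 9) tau j ^ (L (lift ord0 j)).

Definition bprod L h t := \prod_(j < 9) th (eps j.+1 h - t) ^ (- L (lift ord0 j)).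

Lemma time_ok_eps h t j : time_ok h t -> (0 < j < 10)%N -> th (eps j h - t) != 0.
Proof. by case=> h1 _; case: j => [//|j] /= hj; apply: (h1 (Ordinal (hj : j < 9)%N)). Qed.

Lemma time_ok_alpha0 h t j : time_ok h t -> (0 < j < 4)%N -> th (alpha0 h + eps j h - t) != 0.
Proof. by case=> _ h1; case: j => [//|j] /= hj; apply: (h1 (Ordinal (hj : j < 3)%N)). Qed.

Lemma bprod_sZ (k : 'I_9) L h t : (0 < k)%N -> bprod (sZ k L) h t = bprod L (sh k h) t.
Proof.
move=> k0; rewrite /bprod [RHS](reindex_inj (can_inj (swK k0))) /=; apply: eq_bigr => j _.
by rewrite sZ_lift // eps_sh_pos // swK.
Qed.

Lemma Lmon_sZ (k : 'I_9) y L tau : (0 < k)%N ->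
  Lmon y (sZ k L) tau = Lmon y L (fun j => tau (sw k j)).
Proof.
move=> k0; rewrite /Lmon sZ_ord0 //; congr (_ * _).
rewrite [RHS](reindex_inj (can_inj (swK k0))) /=; apply: eq_bigr => j _.
by rewrite sZ_lift // swK.
Qed.

Lemma mono_cexp L x : Minv L -> mono (cexp L) x =
  x.1.1 ^ (L ord0 + L (lift ord0 0)) * x.1.2 ^ (L ord0 + L (lift ord0 1))
  * x.2 ^ (L ord0 + L (lift ord0 2)).
Proof. by move=> /cexpE [<- <- <-]; rewrite /mono !exprnP. Qed.

Lemma xC_cremona L a h t : Minv L -> nondeg th h -> time_ok h t ->
  (forall x, tor x -> hp (degL (sZ 0 L)) (cremona_coefs (cexp L) a) x =
     hp (degL L) a (xinv x) * mono (cexp L) x) ->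
  hp (degL L) a (xC th (sh 0 h) t) = th (ipC L (sh 0 h) - t) * bprod L (sh 0 h) t ->
  hp (degL (sZ 0 L)) (cremona_coefs (cexp L) a) (xC th h t) =
    th (ipC (sZ 0 L) h - t) * bprod (sZ 0 L) h t.
Proof.
move=> hL hB hT tr ih.
have e1 := time_ok_alpha0 hT (isT : 0 < 1 < 4)%N; have e2 := time_ok_alpha0 hT (isT : 0 < 2 < 4)%N.
have e3 := time_ok_alpha0 hT (isT : 0 < 3 < 4)%N.
have f1 := time_ok_eps hT (isT : 0 < 1 < 10)%N; have f2 := time_ok_eps hT (isT : 0 < 2 < 10)%N.
have f3 := time_ok_eps hT (isT : 0 < 3 < 10)%N.
have tx : tor (xC th h t) by rewrite /tor /xC /= !mulf_neq0.
(* Up to this scalar, the product of all six brackets, inversion sends x^C(t) at [h] to x^C(t) at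
   s_0 h. *)
rewrite tr //; set u := th (alpha0 h + eps 1 h - t) * th (alpha0 h + eps 2 h - t) * th (alpha0 h + eps 3 h - t)
  * (th (eps 1 h - t) * th (eps 2 h - t) * th (eps 3 h - t)).
have u0 : u != 0 by rewrite /u !mulf_neq0.
have -> : hp (degL L) a (xinv (xC th h t)) = u ^- (degL L) * hp (degL L) a (xC th (sh 0 h) t).
  rewrite -exprVn -hpZ xC_sh0 /xinv /xC /=; congr (hp _ _ (_, _, _)); rewrite /u.
  - by field; rewrite e1 e2 e3 f1 f2 f3.
  - by field; rewrite e1 e2 e3 f1 f2 f3.
  - by field; rewrite e1 e2 e3 f1 f2 f3.
rewrite ih ipC_sZ [LHS]mulrC [u ^- _ * _]mulrCA [LHS]mulrCA; congr (_ * _).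
rewrite exprnN degL_Minv // mono_cexp // /bprod !(@big_split3 _ _ *%R) /=.
rewrite sZ0_lift0 sZ0_lift1 sZ0_lift2 !eps_sh0_lt3 //.
have -> : \prod_(j < 9 | (2 < j)%N) th (eps j.+1 (sh 0 h) - t) ^ (- L (lift ord0 j)) =
    \prod_(j < 9 | (2 < j)%N) th (eps j.+1 h - t) ^ (- sZ 0 L (lift ord0 j)).
  by apply: eq_bigr => j hj; rewrite sZ0_lift_ge3 // eps_sh0_ge3.
set P := \prod_(j < 9 | _) _.
have := expfz_bracket (L ord0) (L (lift ord0 0)) (L (lift ord0 1)) (L (lift ord0 2)) e1 e2 e3 f1 f2 f3.
rewrite -/u.
rewrite (_ : - (- L ord0 - L (lift ord0 1) - L (lift ord0 2)) = L ord0 + L (lift ord0 1) + L (lift ord0 2)); last by ring.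
rewrite (_ : - (- L ord0 - L (lift ord0 0) - L (lift ord0 2)) = L ord0 + L (lift ord0 0) + L (lift ord0 2)); last by ring.
rewrite (_ : - (- L ord0 - L (lift ord0 0) - L (lift ord0 1)) = L ord0 + L (lift ord0 0) + L (lift ord0 1)); last by ring.
rewrite ![alpha0 h + _]addrC => <-.
rewrite -[(1 %% 9).+1]/2%N -[((1 %% 9 + 1 %% 9) %% 9).+1]/3%N; ring.
Qed.

(** The new tau_0, here [t0'], is forced: it is the value for which 1/f_i is again of the form tau_0
    x_i / (tau_1 tau_2 tau_3), with x inverted and tau_1, tau_2, tau_3 multiplied by the f_i. *)
Lemma tau_cremona L a h t0 x tau : Minv L -> tor x -> t0 != 0 -> (forall j, tau j != 0) ->
  (forall x, tor x -> hp (degL (sZ 0 L)) (cremona_coefs (cexp L) a) x =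
     hp (degL L) a (xinv x) * mono (cexp L) x) ->
  let tau' := stau 0 h (f_of_x t0 x tau) tau in
  let t0' := t0 ^+ 2 * (x.1.1 * x.1.2 * x.2) / (tau 0 * tau 1 * tau 2) in
  [/\ t0' != 0, (forall j, tau' j != 0),
    sf th 0 h (f_of_x t0 x tau) tau = f_of_x t0' (xinv x) tau' &
    Lmon t0' L tau' * hp (degL L) a (xinv x) =
    Lmon t0 (sZ 0 L) tau * hp (degL (sZ 0 L)) (cremona_coefs (cexp L) a) x].
Proof.
move=> hL tx t00 tau0 tr tau' t0'.
have /and3P [x1 x2 x3] := tx.
have ta := tau0 0; have tb := tau0 1; have tc := tau0 2.
have i0 : inord (0%R : 'I_9) = 0 :> 'I_3 by apply: val_inj; rewrite /= inordK.
have i1 : inord (1%R : 'I_9) = 1 :> 'I_3 by apply: val_inj; rewrite /= inordK.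
have i2 : inord (2%R : 'I_9) = 2 :> 'I_3 by apply: val_inj; rewrite /= inordK.
have T0 : tau' 0 = tau 0 * (t0 * x.1.1 / (tau 0 * tau 1 * tau 2)) by rewrite /tau' /stau /= i0.
have T1 : tau' 1 = tau 1 * (t0 * x.1.2 / (tau 0 * tau 1 * tau 2)) by rewrite /tau' /stau /= i1.
have T2 : tau' 2 = tau 2 * (t0 * x.2 / (tau 0 * tau 1 * tau 2)) by rewrite /tau' /stau /= i2.
have T3 (j : 'I_9) : (2 < j)%N -> tau' j = tau j by move=> hj; rewrite /tau' /stau /= ltnNge hj.
have p0 : tau 0 * tau 1 * tau 2 != 0 by rewrite !mulf_neq0.
split.
- by rewrite /t0' !mulf_neq0 ?invr_eq0 ?expf_neq0.
- move=> j; case: (ltnP 2 j) => hj; first by rewrite T3.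
  have [->|[->| ->]] : j = 0 \/ j = 1 \/ j = 2.
    by case: j hj => [[|[|[|n]]] hn] //= _; [left|right; left|right; right]; apply: val_inj.
  + by rewrite T0 !mulf_neq0 ?invr_eq0.
  + by rewrite T1 !mulf_neq0 ?invr_eq0.
  + by rewrite T2 !mulf_neq0 ?invr_eq0.
- apply: funext => i; rewrite /f_of_x T0 T1 T2 /sf /t0' /=.
  by case: i => [[|[|[|i]]] hi] //=; field; rewrite ?ta ?tb ?tc ?x1 ?x2 ?x3 ?t00.
rewrite tr // mono_cexp // /Lmon !(@big_split3 _ _ *%R) /= T0 T1 T2.
rewrite sZ0_ord0 sZ0_lift0 sZ0_lift1 sZ0_lift2.
have -> : \prod_(j < 9 | (2 < j)%N) tau' j ^ L (lift ord0 j) =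
    \prod_(j < 9 | (2 < j)%N) tau j ^ sZ 0 L (lift ord0 j).
  by apply: eq_bigr => j hj; rewrite sZ0_lift_ge3 // T3.
set P := \prod_(j < 9 | _) _.
have := expfz_tau (L ord0) (L (lift ord0 0)) (L (lift ord0 1)) (L (lift ord0 2)) t00 ta tb tc x1 x2 x3.
rewrite -/t0'; move: (t0' ^ _) => Z e.
transitivity ((Z * ((tau 0 * (t0 * x.1.1 / (tau 0 * tau 1 * tau 2))) ^ L (lift ord0 0) *
      (tau 1 * (t0 * x.1.2 / (tau 0 * tau 1 * tau 2))) ^ L (lift ord0 1) *
      (tau 2 * (t0 * x.2 / (tau 0 * tau 1 * tau 2))) ^ L (lift ord0 2))) * (P * hp (degL L) a (xinv x))).
  by ring.
by rewrite e; ring.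
Qed.

Lemma sf_plane_act (k : 'I_9) h t0 x tau : (0 < k)%N -> (forall j, tau j != 0) ->
  sf th k h (f_of_x t0 x tau) tau = f_of_x t0 (plane_act th k h x) (fun j => tau (sw k j)).
Proof.
move=> k0 tau0; have swv (j : 'I_9) : sw k j = swapn k.-1 k j :> nat by apply: swE.
have ordE (j j' : 'I_9) : j = j' :> nat -> j = j' by apply: val_inj.
have ta := tau0 0; have tb := tau0 1; have tc := tau0 2; have td := tau0 3.
have o2 : inord 2 = 2 :> 'I_9 by apply: val_inj; rewrite /= inordK.
have o3 : inord 3 = 3 :> 'I_9 by apply: val_inj; rewrite /= inordK.
rewrite /sf /plane_act /f_of_x; apply: funext => i.
case: k k0 swv => [[|[|[|[|k]]]] hk] //= _ swv.
- rewrite (ordE (sw 1 0) 1) ?swv // (ordE (sw 1 1) 0) ?swv // (ordE (sw 1 2) 2) ?swv //.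
  by case: i => [[|[|[|i]]] hi] //=; rewrite inordK //= [tau 0 * tau 1]mulrC.
- rewrite (ordE (sw 2 0) 0) ?swv // (ordE (sw 2 1) 2) ?swv // (ordE (sw 2 2) 1) ?swv //.
  by case: i => [[|[|[|i]]] hi] //=; rewrite inordK //= [tau 0 * tau 1 * tau 2]mulrAC.
- rewrite (ordE (sw 3 0) 0) ?swv // (ordE (sw 3 1) 1) ?swv // (ordE (sw 3 2) 3) ?swv //.
  rewrite o2 o3 /lin3; case: i => [[|[|[|i]]] hi] //=; rewrite ?inordK //=.
  + set D := (th (alpha0 h) * _)^-1.
    by field; rewrite ta tb tc td.
  + set D := (th (alpha0 h) * _)^-1.
    by field; rewrite ta tb tc td.
  + by field; rewrite ta tb tc td.
rewrite (ordE (sw _ 0) 0) ?swv // (ordE (sw _ 1) 1) ?swv // (ordE (sw _ 2) 2) ?swv //.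
Qed.

Lemma phi_exists w : exists c : expo -> hpt R -> C, let L := actZ w (evec 9) in
  [/\ forall m, inK th (c m),
    forall h, nondeg_along th w h -> linsys th L h (c^~ h),
    forall h t, nondeg_along th w h -> time_along w h t ->
      hp (degL L) (c^~ h) (xC th h t) = th (ipC L h - t) * bprod L h t &
    forall h t0 x tau, nondeg_along th w h -> tor_along w h x -> t0 != 0 -> (forall j, tau j != 0) ->
      tauw th w h (f_of_x t0 x tau) tau = Lmon t0 L tau * hp (degL L) (c^~ h) x].
Proof.
elim: w => [|k w [c]].
  (* For e_9 the form is 1: on x^C the factor [lambda - t] cancels [eps_9 - t]^{-1}. *)
  exists (fun _ _ => 1); rewrite /= (_ : degL (evec 9) = 0%N) //.
  have h0 x : hp 0 (fun=> 1) x = 1 :> C by rewrite /hp /mons /= big_seq1 /mono !expr0 !mulr1.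
  have ev (j : 'I_9) : evec 9 (lift ord0 j) = (j == ord_max)%:Z by apply: (evecS_lift ord_max).
  split.
  - by move=> m; apply: inK1.
  - move=> h _ j; rewrite ev (_ : posz _ = 0%N); last by case: (j == _).
    exact: vanish0.
  - move=> h t _ [hT _]; rewrite h0 /bprod (bigD1 ord_max) //= big1 => [|j /negPf nj].
      rewrite ev eqxx mulr1 -/(eps 9 h) exprN1 divff //.
      exact: time_ok_eps.
    by rewrite ev nj oppr0 expr0z.
  move=> h t0 x tau _ _ t00 tau0; rewrite h0 mulr1 /Lmon expr0z mul1r (bigD1 ord_max) //=.
  rewrite ev eqxx expr1z big1 ?mulr1 // => j /negPf nj.
  by rewrite ev nj expr0z.
set L := actZ w (evec 9) => -[cK cV cX cT].
have hL : Minv L by apply/Minv_actZ/(Minv_evec ord_max).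
case: (posnP k) => [k0|k0].
  have -> : k = 0 by apply: val_inj.
  pose c' m h := cremona_coefs (cexp L) (c^~ (sh 0 h)) m.
  have tr h : nondeg_along th (0 :: w) h -> forall x, tor x ->
      hp (degL (sZ 0 L)) (cremona_coefs (cexp L) (c^~ (sh 0 h))) x =
      hp (degL L) (c^~ (sh 0 h)) (xinv x) * mono (cexp L) x.
    case=> hB hG x tx; apply: cremona_coefs_hp => //; first exact: degL_cremona.
    by apply: (linsys_supp_le br hL (nondeg_along_nondeg hG)); apply: cV.
  exists c'; rewrite /= -/L; split.
  - move=> m; rewrite /c' /cremona_coefs; case: [&& _, _ & _]; last exact: inK0.
    exact: (@inK_sh _ th 0 (c _)).
  - move=> h [hB hG]; apply: linsys_cremona => //; first exact: nondeg_along_nondeg hG.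
    exact: cV.
  - move=> h t hG [hT hT']; have [hB hG'] := hG.
    apply: xC_cremona => //; first exact: tr.
    exact: cX.
  move=> h t0 x tau hG [tx hX] t00 tau0; have [hB hG'] := hG.
  have [n1 n2 n3 n4] := tau_cremona h hL tx t00 tau0 (tr h hG).
  rewrite -n4.
  change (sL th 0 (tauw th w) h (f_of_x t0 x tau) tau = Lmon (t0 ^+ 2 * (x.1.1 * x.1.2 * x.2) / (tau 0 * tau 1 * tau 2)) L (stau 0 h (f_of_x t0 x tau) tau) * hp (degL L) (c^~ (sh 0 h)) (xinv x)).
  rewrite /sL n3.
  exact: cT.
have [c' [cK' hc']] := @pS_plane_act _ _ br (hpt R) (inK th) id (inK0 th) (inK1 th) (@inKD _ th) (@inKM _ th) (fun c hc => hc) k (degL L) (fun m h => c m (sh k h)) k0 (fun m => inK_sh k (cK m)).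
exists c'; rewrite /= -/L degL_sZ //; split => //.
- move=> h [hB hG]; apply: (linsys_act br k0 hB (cV _ hG)) => x.
  by rewrite -hc'.
- move=> h t [hB hG] [hT hT'].
  by rewrite -hc' plane_act_xC // cX // ipC_sZ bprod_sZ.
move=> h t0 x tau [hB hG] [tx hX] t00 tau0.
rewrite -[LHS]/(sL th k (tauw th w) h (f_of_x t0 x tau) tau) /sL sf_plane_act // /stau.
rewrite (_ : (val k == 0)%N = false); last by apply/negbTE; rewrite -lt0n.
by rewrite Lmon_sZ // -hc' -cT.
Qed.

End TauFunction.

(** * The determinant *)

Section LastColumn.
Variables (F : fieldType) (E I : eqType) (e0 : E).
Variables (ms : seq E) (idx : seq I) (col : I -> E -> F) (N : nat).
Hypothesis ums : uniq ms.
Hypothesis sms : size ms = N.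
Hypothesis sidx : (size idx).+1 = N.

Definition lastcol_mx (v : E -> F) : 'M[F]_N :=
  \matrix_(r, c) nth (fun=> 0) ([seq col p | p <- idx] ++ [:: v]) c (nth e0 ms r).

Definition delta (m : E) : E -> F := fun n => (n == m)%:R.

Lemma last_lt : (size idx < N)%N. Proof. by rewrite -sidx. Qed.
Local Notation jl := (Ordinal last_lt).

Lemma lastcol_mx_last v r : lastcol_mx v r jl = v (nth e0 ms r).
Proof. by rewrite mxE nth_cat size_map /= ltnn subnn. Qed.

Lemma lastcol_mx_nth v r (c : 'I_N) (i0 : I) : (c < size idx)%N ->
  lastcol_mx v r c = col (nth i0 idx c) (nth e0 ms r).
Proof. by move=> hc; rewrite mxE nth_cat size_map hc (nth_map i0). Qed.

Lemma cofactor_lastcol v w r : cofactor (lastcol_mx v) r jl = cofactor (lastcol_mx w) r jl.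
Proof.
rewrite /cofactor; congr (_ * \det _); apply/matrixP => i j; rewrite !mxE !nth_cat size_map.
have := ltn_ord (lift jl j); have := neq_lift jl j.
rewrite -val_eqE /= eq_sym => h1 h2.
by have -> : (bump (size idx) j < size idx)%N by lia.
Qed.

Lemma sum_ms (G : E -> F) : \sum_(m <- ms) G m = \sum_(r < N) G (nth e0 ms r).
Proof. by rewrite (big_nth e0) sms big_mkord. Qed.

Lemma det_lastcol v :
  \det (lastcol_mx v) = \sum_(m <- ms) v m * \det (lastcol_mx (delta m)).
Proof.
rewrite (expand_det_col _ jl) sum_ms; apply: eq_bigr => r _.
rewrite lastcol_mx_last; congr (_ * _).
rewrite (expand_det_col _ jl) (bigD1 r) //= lastcol_mx_last /delta eqxx mul1r.
rewrite big1 ?addr0; first exact: cofactor_lastcol.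
move=> s sr; rewrite lastcol_mx_last nth_uniq ?sms ?ltn_ord //.
by rewrite val_eqE (negPf sr) mul0r.
Qed.

Lemma det_lastcol_in p : p \in idx -> \det (lastcol_mx (col p)) = 0.
Proof.
move=> hp; have hi : (index p idx < size idx)%N by rewrite index_mem.
have hi' : (index p idx < N)%N by apply: ltn_trans last_lt.
rewrite -det_tr; apply: (@determinant_alternate _ _ _ (Ordinal hi') jl).
  by rewrite -val_eqE /= neq_ltn hi.
move=> r; rewrite [LHS]mxE [RHS]mxE lastcol_mx_last.
by rewrite (lastcol_mx_nth _ _ p) //= nth_index.
Qed.

(** A left kernel vector of the singular matrix, read as a function on monomials, satisfies all the
    conditions imposed by the columns; the unit last column makes it vanish at [m1]. *)
Lemma det_lastcol_ker m1 : m1 \in ms -> \det (lastcol_mx (delta m1)) = 0 ->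
  exists b : E -> F, [/\ forall p, p \in idx -> \sum_(m <- ms) b m * col p m = 0,
    b m1 = 0 & exists2 m, m \in ms & b m != 0].
Proof.
move=> hm1 /eqP/det0P [v v0 hv].
pose b m := \sum_(r < N) (nth e0 ms r == m)%:R * v 0 r.
have bE (r : 'I_N) : b (nth e0 ms r) = v 0 r.
  rewrite /b (bigD1 r) //= eqxx mul1r big1 ?addr0 // => s sr.
  by rewrite nth_uniq ?sms ?ltn_ord // val_eqE (negPf sr) mul0r.
have hc (c : 'I_N) : \sum_r v 0 r * lastcol_mx (delta m1) r c = 0.
  by have := congr1 (fun A : 'rV_N => A 0 c) hv; rewrite !mxE.
exists b; split.
- move=> p hp; have hi : (index p idx < size idx)%N by rewrite index_mem.
  have hi' : (index p idx < N)%N by apply: ltn_trans last_lt.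
  rewrite sum_ms -[RHS](hc (Ordinal hi')); apply: eq_bigr => r _.
  by rewrite bE (lastcol_mx_nth _ _ p) //= nth_index.
- have hi : (index m1 ms < N)%N by rewrite -sms index_mem.
  rewrite -(nth_index e0 hm1) (bE (Ordinal hi)) -[RHS](hc jl) (bigD1 (Ordinal hi)) //=.
  rewrite lastcol_mx_last /delta /= nth_index // eqxx mulr1 big1 ?addr0 // => s sr.
  rewrite lastcol_mx_last -[X in _ == X](nth_index e0 hm1) nth_uniq ?sms ?ltn_ord //.
  by rewrite -val_eqE /= in sr; rewrite (negPf sr) mulr0.
have [r hr] : exists r, v 0 r != 0.
  apply/existsP; apply: contraNT v0; rewrite negb_exists => /forallP h.
  by apply/eqP/rowP => r; rewrite mxE; apply/eqP; rewrite -[_ == _]negbK h.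
by exists (nth e0 ms r); rewrite ?bE // mem_nth // sms.
Qed.

End LastColumn.

(** * The columns of F and their number *)

Section Determinant.
Variable R : realType.
Local Notation C := R[i].
Local Notation X := (C * C * C)%type.
Variable th : C -> C.
Hypothesis br : bracket_fn th.
Implicit Types (h : hpt R) (L : lat) (x : X).

(** Labels (point, derivative) of all columns but the last; being data rather than functions, they
    admit membership tests and positions. *)
Definition fidx L : seq (nat * expo) := flatten
  [seq (if nuL L j - 1 is Posz k then [seq (j, m) | m <- mons k] else [::]) | j <- iota 1 9].

Definition fcol h (p : nat * expo) (mu : expo) : C := dmon p.2 mu (pt th p.1 h).

Lemma FcolsE L h x : Fcols th L h x = [seq fcol h p | p <- fidx L] ++ [:: fun mu => dmon (0, 0, 0)%N mu x].
Proof.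
rewrite /Fcols /fidx map_flatten -map_comp; congr (flatten _ ++ _).
apply: eq_map => j; rewrite /comp /dcols; case: (nuL L j - 1) => // k.
by rewrite -map_comp.
Qed.

Lemma bin2_double n : (2 * 'C(n.+1, 2) = n.+1 * n)%N.
Proof. by elim: n => // n ih; rewrite binS bin1 mulnDr ih; lia. Qed.

Lemma nuLS L (j : 'I_9) : nuL L j.+1 = - L (lift ord0 j).
Proof. by rewrite /nuL inordS. Qed.

Lemma Minv_le1 L : Minv L -> forall j, L (lift ord0 j) <= 1.
Proof.
move=> hL j; have := Minv_deg_ge0 hL; rewrite le_eqVlt => /predU1P [/esym d0|d0].
  by case: (Minv_deg0 hL d0 j) => ->.
by have := Minv_le0 hL d0 j => /le_trans; apply.
Qed.

Lemma size_fidx L : Minv L -> (size (fidx L)).+1 = 'C((degL L).+2, 2).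
Proof.
move=> hL; rewrite /fidx size_flatten /shape -map_comp sumnE big_map.
have -> : iota 1 9 = index_iota 1 10 by [].
rewrite (@big_nat_1_10 _ _ addn).
rewrite (eq_bigr (fun j : 'I_9 => 'C((posz (- L (lift ord0 j))).+1, 2))); last first.
  move=> j _; rewrite /comp nuLS; case: (- L (lift ord0 j)) => [[|n]|n] //.
  by rewrite intS addrC addKr size_map size_mons.
suff : (2 * (\sum_(j < 9) 'C((posz (- L (lift ord0 j))).+1, 2)).+1 = 2 * 'C((degL L).+2, 2))%N.
  by move=> h; apply/eqP; rewrite -(@eqn_pmul2l 2) //; apply/eqP.
rewrite bin2_double mulnS big_distrr /=.
rewrite (eq_bigr (fun j : 'I_9 => ((posz (- L (lift ord0 j))).+1 * posz (- L (lift ord0 j)))%N)); last first.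
  by move=> j _; rewrite bin2_double.
have [h1 h2] := hL.
have e : (\sum_(j < 9) ((posz (- L (lift ord0 j))).+1 * posz (- L (lift ord0 j)))%N)%:Z =
    L ord0 ^+ 2 + 3 * L ord0.
  (* A coordinate 1 of Lambda, that is nu_j = -1, contributes no column, in agreement with l^2 - l =
     0. *)
  rewrite (big_morph Posz PoszD (erefl (Posz 0))); transitivity (\sum_(j < 9) (L (lift ord0 j) ^+ 2 - L (lift ord0 j))).
    apply: eq_bigr => j _; have := Minv_le1 hL j.
    case: (posz_cases (- L (lift ord0 j))) => [e|[e l]] le1.
      by rewrite PoszM intS e; ring.
    rewrite e muln0.
    by have -> : L (lift ord0 j) = 1 by lia.
  by rewrite sumrB h1 h2; ring.
move: e (degL_Minv hL); set S := bigop _ _ _ => e dL; nia.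
Qed.

End Determinant.

(** * F as a member of the linear system *)

Section DeterminantForm.
Variable R : realType.
Local Notation C := R[i].
Local Notation X := (C * C * C)%type.
Variable th : C -> C.
Hypothesis br : bracket_fn th.
Implicit Types (h : hpt R) (L : lat) (x : X).

(** With a unit vector as last column the determinant is a cofactor, hence the coefficient of x^m in
    F. *)
Definition Fcoef L h (m : expo) : C :=
  \det (lastcol_mx (0, 0, 0)%N (mons (degL L)) (fidx L) (fcol th h) 'C((degL L).+2, 2) (delta C m)).

Lemma FL_hp L h x : Minv L -> FL th L h x = hp (degL L) (Fcoef L h) x.
Proof.
move=> hL; rewrite /FL.
have -> : Fmat th L h x = lastcol_mx (0, 0, 0)%N (mons (degL L)) (fidx L) (fcol th h)
    'C((degL L).+2, 2) (fun mu => dmon (0, 0, 0)%N mu x).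
  by apply/matrixP => r c; rewrite !mxE FcolsE.
rewrite (det_lastcol _ _ (uniq_mons _) (size_mons _) (size_fidx hL)).
apply: eq_bigr => m _; rewrite mulrC; congr (_ * _).
by rewrite dmonE /dmon1 !ffactn0 !subn0 !mul1r.
Qed.

Lemma linsys_fcol L h a : Minv L ->
  (forall p, p \in fidx L -> \sum_(m <- mons (degL L)) a m * fcol th h p m = 0) -> linsys th L h a.
Proof.
move=> hL ha j; have := Minv_bound hL j; have := degL_Minv hL.
case e : (- L (lift ord0 j)) => [[|n]|n] dL lj; try exact: vanish0.
apply: vanish_deriv; first by rewrite /=; lia.
move=> k hk; apply: (ha (j.+1, k)); apply/flatten_mapP; exists j.+1.
  by rewrite mem_iota /=; have := ltn_ord j; lia.
by rewrite nuLS e intS addrC addKr; apply/mapP; exists k.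
Qed.

(** Pairing the coefficients of F with a column gives the determinant in which this column also
    stands last, so it is repeated. *)
Lemma linsys_Fcoef L h : Minv L -> linsys th L h (Fcoef L h).
Proof.
move=> hL; apply: linsys_fcol => // p hp.
rewrite -[RHS](det_lastcol_in (0, 0, 0)%N (mons (degL L)) (fcol th h) (size_fidx hL) hp).
rewrite (det_lastcol _ _ (uniq_mons _) (size_mons _) (size_fidx hL)).
by apply: eq_bigr => m _; rewrite mulrC.
Qed.

(** Otherwise [det_lastcol_ker] gives a nonzero [b] in the system with [b m1] zero, which cannot be
    dependent on [a]. *)
Lemma Fcoef_neq0 w h a m1 : nondeg_along th w h -> let L := actZ w (evec 9) in
  linsys th L h a -> m1 \in mons (degL L) -> a m1 != 0 -> Fcoef L h m1 != 0.
Proof.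
move=> hG L hV hm a0; apply/eqP => D0.
have hL : Minv L by apply/Minv_actZ/(Minv_evec ord_max).
have [b [hb b0 [m hm' bm]]] := det_lastcol_ker (uniq_mons _) (size_mons _) (size_fidx hL) hm D0.
have [u [v [uv huv]]] := linsys_dim1 br hG hV (linsys_fcol hL hb).
have u0 : u = 0.
  by apply/eqP; have /eqP := huv _ hm; rewrite b0 mulr0 addr0 mulf_eq0 (negPf a0) orbF.
move: uv; rewrite u0 eqxx /= => v0.
by have /eqP := huv _ hm'; rewrite u0 mul0r add0r mulf_eq0 (negPf v0) (negPf bm).
Qed.

Lemma inKX (c : hpt R -> C) n : inK th c -> inK th (fun h => c h ^+ n).
Proof.
move=> hc; elim: n => [|n ih]; first exact: inK1.
by apply: inK_ext (inKM hc ih) => h; rewrite exprS.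
Qed.

Lemma inK_prod (I : Type) (r : seq I) (G : I -> hpt R -> C) :
  (forall i, inK th (G i)) -> inK th (fun h => \prod_(i <- r) G i h).
Proof.
move=> hG; elim: r => [|i r ih].
  by apply: inK_ext (inK1 th) => h; rewrite big_nil.
by apply: inK_ext (inKM (hG i) ih) => h; rewrite big_cons.
Qed.

Lemma inK_fcol p mu : (0 < p.1 < 10)%N -> inK th (fun h => fcol th h p mu).
Proof.
move=> hp; have [h1 h2 h3] := inK_pt br hp.
have d1 k m (c : hpt R -> C) : inK th c -> inK th (fun h => dmon1 k m (c h)).
  by move=> hc; apply: inKM; [exact: inK_nat|exact: inKX].
apply: inK_ext (inKM (inKM (d1 p.2.1.1 mu.1.1 _ h1) (d1 p.2.1.2 mu.1.2 _ h2)) (d1 p.2.2 mu.2 _ h3)) => h.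
by rewrite /fcol dmonE.
Qed.

Lemma fidx_lt L p : p \in fidx L -> (0 < p.1 < 10)%N.
Proof.
case/flatten_mapP => j; rewrite mem_iota => hj; case: (nuL L j - 1) => // n.
by case/mapP => k _ ->.
Qed.

Lemma inK_Fcoef L m : inK th (fun h => Fcoef L h m).
Proof.
rewrite /Fcoef /determinant.
apply: (S_sum (inK0 th) (@inKD _ th)) => s.
apply: inKM; first exact: (@inKX (fun=> -1) _ (inKN (inK1 th))).
apply: inK_prod => i; under [X in inK _ X]boolp.eq_fun do rewrite mxE.
move: (nth (0, 0, 0)%N (mons (degL L)) i) => mu.
have [hc|hc] := ltnP (s i) (size (fidx L)); last first.
  apply: (@inK_ext _ _ (fun=> nth (fun=> 0) [:: delta C m] (s i - size (fidx L))%N mu)).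
    by move=> h; rewrite nth_cat size_map ltnNge hc.
  case: (s i - _)%N => [|n] /=; last by rewrite nth_nil; exact: inK0.
  by rewrite /delta; apply: inK_nat.
have p0 : nat * expo := (0, (0, 0, 0))%N.
apply: inK_ext (inK_fcol _ (fidx_lt (mem_nth p0 hc))) => h.
by rewrite [nth (fun=> 0) _ _]nth_cat size_map hc (nth_map p0).
Qed.

(** Membership in K asks for one expression valid at all [h], while the monomial with nonzero
    coefficient may depend on [h]; the recursion takes the ratio at the first such monomial. *)
Fixpoint kratio (f g : expo -> hpt R -> C) (l : seq expo) : hpt R -> C :=
  if l is m :: l' then
    fun h => g m h / f m h + (1 - f m h / f m h) * kratio f g l' h
  else fun=> 0.

Lemma inK_kratio f g l : (forall m, inK th (f m)) -> (forall m, inK th (g m)) ->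
  inK th (kratio f g l).
Proof.
move=> hf hg; elim: l => [|m l ih] /=; first exact: inK0.
apply: inKD; first by apply: inKM => //; apply: inKV.
apply: inKM => //; apply: inKD; first exact: inK1.
by apply/inKN/inKM => //; apply: inKV.
Qed.

(* As [0 / 0 = 0], the factor [1 - f / f] tests whether [f] vanishes. *)
Lemma kratioE f g l h b : (forall m, m \in l -> g m h = b * f m h) ->
  (exists2 m, m \in l & f m h != 0) -> kratio f g l h = b.
Proof.
elim: l => [|m l ih] hg [m1 h1 n1] //=.
rewrite hg ?mem_head //; have [f0|f0] := eqVneq (f m h) 0; last first.
  by rewrite mulfK // divff // subrr mul0r addr0.
rewrite f0 mulr0 mul0r add0r subr0 mul1r; apply: ih.
  by move=> n hn; apply: hg; rewrite inE hn orbT.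
exists m1 => //; move: h1; rewrite inE => /predU1P [e|//].
by rewrite e f0 eqxx in n1.
Qed.

Lemma actZ_evec (j : 'I_9) : exists w, actZ w (evec 9) = evec j.+1.
Proof.
suff h n : forall j : 'I_9, (j + n = 8)%N -> exists w, actZ w (evec 9) = evec j.+1.
  by apply: (h (8 - j)%N); have := ltn_ord j; lia.
elim: n => [|n ih] i hi; first by exists [::]; rewrite /= (_ : i = ord_max) //; apply: val_inj => /=; lia.
have hk : (i.+1 < 9)%N by lia.
pose k : 'I_9 := Ordinal hk.
have [w hw] : exists w, actZ w (evec 9) = evec k.+1 by apply: ih => /=; lia.
exists (k :: w); rewrite /= hw; apply: funext => l.
have k0 : (0 < k)%N by [].
have [m ->|->] := unliftP ord0 l; last by rewrite sZ_ord0.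
have ki : sw k k = i by apply: val_inj; rewrite [LHS]swE // /swapn gtn_eqF ?eqxx.
rewrite sZ_lift // !evecS_lift; congr (nat_of_bool _)%:Z.
by rewrite -(inj_eq (can_inj (swK k0))) swK // ki.
Qed.

End DeterminantForm.

(** * Genericity of the conditions along a word *)

Section GenericWords.
Variable R : realType.
Local Notation C := R[i].
Local Notation X := (C * C * C)%type.
Variable th : C -> C.
Hypothesis br : bracket_fn th.
Implicit Types (h : hpt R) (L : lat) (x : X).

Section Param.
Variable n : nat.
Implicit Types (z : 'I_n -> C) (g : ('I_n -> C) -> hpt R).

Lemma contat_ipC v g z : (forall i, contat (fun w => g w i) z) -> contat (fun w => ipC v (g w)) z.
Proof.
move=> hg; have hc (c : C) i : contat (fun w => c * g w i) z.
  by apply: contatM => //; apply: contat_cst.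
rewrite (_ : (fun w => _) = fun w => - ((v ord0)%:~R * g w ord0) +
   \sum_(j < 9) (v (lift ord0 j))%:~R * g w (lift ord0 j)).
  by apply: contatD; [apply: contatN|apply: contat_sum].
by apply: funext => w; rewrite ipC_sum.
Qed.

Lemma contat_sh k g z : (forall i, contat (fun w => g w i) z) ->
  forall i, contat (fun w => sh k (g w) i) z.
Proof.
move=> hg i; rewrite /sh; apply: contatB => //; apply: contatM; last exact: contat_cst.
exact: contat_ipC.
Qed.

Lemma contat_alpha0 g z : (forall i, contat (fun w => g w i) z) -> contat (fun w => alpha0 (g w)) z.
Proof. exact: contat_ipC. Qed.

Lemma contat_eps2 i j g z : (forall i, contat (fun w => g w i) z) -> contat (fun w => eps2 i j (g w)) z.
Proof. by move=> hg; apply: contatB; apply: contat_ipC. Qed.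

Lemma odense_time_ok g (s : ('I_n -> C) -> C) :
  (forall z i, contat (fun w => g w i) z) -> (forall z, contat s z) ->
  (exists u, forall z c, g (fun i => z i + c * u i) = g z /\ s (fun i => z i + c * u i) = s z - c) ->
  odense (fun z => time_ok th (g z) (s z)).
Proof.
move=> cg cs [u hu]; apply: odenseI; apply: odense_forall => j; apply: odense_bracket => //.
- by move=> z; apply: contatB => //; apply: contat_ipC.
- by exists u => z c; have [-> ->] := hu z c; rewrite opprB; ring.
- by move=> z; apply: contatB => //; apply: contatD; [exact: contat_alpha0|exact: contat_ipC].
by exists u => z c; have [-> ->] := hu z c; rewrite opprB; ring.
Qed.

Lemma odense_time_along w g (s : ('I_n -> C) -> C) :
  (forall z i, contat (fun w => g w i) z) -> (forall z, contat s z) ->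
  (exists u, forall z c, g (fun i => z i + c * u i) = g z /\ s (fun i => z i + c * u i) = s z - c) ->
  odense (fun z => time_along th w (g z) (s z)).
Proof.
move=> + cs; elim: w g => [|k w ih] g cg hu /=.
  by apply: odenseI; [exact: odense_time_ok|exact: odenseT].
apply: odenseI; first exact: odense_time_ok.
apply: (ih (fun z => sh k (g z))).
  by move=> z i; apply: contat_sh.
by case: hu => u hu; exists u => z c; have [-> ->] := hu z c.
Qed.

End Param.

Lemma odense_nondeg : odense (fun z : 'I_10 -> C => nondeg th z).
Proof.
have ce (v : lat) z : contat (fun w : 'I_10 -> C => ipC v w) z.
  by apply: contat_ipC => i; apply: contat_coord.
have oT (b : bool) (P : ('I_10 -> C) -> Prop) : (b -> odense P) -> odense (fun z => b -> P z).
  case: b => h; first by apply: odense_iff (h isT) => z; split=> // /(_ isT).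
  by apply: odense_iff (@odenseT _ _) => z.
have dir (z u : 'I_10 -> C) s (j : 'I_9) :
    eps j.+1 ((fun i => z i + s * u i) : hpt R) = eps j.+1 (z : hpt R) + s * u (lift ord0 j).
  by rewrite !epsSE.
apply: odenseI.
  apply: odense_forall => i; apply: odense_forall => j; apply: oT => ne.
  apply: odense_bracket => //; first by move=> z; apply: contat_eps2 => l; apply: contat_coord.
  (* Moving the i-th coordinate alone changes eps_i - eps_j at unit speed. *)
  exists (fun l => (l == lift ord0 i)%:R) => z s.
  rewrite /eps2 !dir eqxx (inj_eq lift_inj) [j == i]eq_sym (negPf ne) mulr1 mulr0; ring.
apply: odense_forall => i; apply: odense_forall => j; apply: odense_forall => k.
apply: oT => _; apply: odense_bracket => //.
  by move=> z; rewrite /eps3; do 3?[apply: contatB; last exact: ce]; exact: ce.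
(* Moving the coordinate of e_0 changes only eps_0; the sign is that of <e_0, e_0> = -1. *)
exists (fun l => - (l == ord0)%:R) => z s.
by rewrite /eps3 !dir !eps0E /= mulrN mulr1; ring.
Qed.

Lemma odense_nondeg_sh k : odense (fun z : 'I_10 -> C => nondeg th (sh k (z : hpt R))).
Proof.
apply: odense_iff (@odense_pull _ _ (fun z : 'I_10 -> C => sh k (z : hpt R)) (fun=> True) _ (@odenseT _ _) _ _ _ odense_nondeg) => //.
- by move=> z; split=> [[]|].
- by move=> z _; apply: shK.
by move=> z i _; apply: contat_sh => l; apply: contat_coord.
Qed.

Lemma odense_nondeg_along w : odense (fun z : 'I_10 -> C => nondeg_along th w z).
Proof.
elim: w => [|k w ih] /=; first by apply: odenseI; [exact: odense_nondeg|exact: odenseT].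
apply: odenseI; first exact: odense_nondeg.
apply: odense_iff (@odense_pull _ _ (fun z : 'I_10 -> C => sh k (z : hpt R)) (fun=> True) _ (@odenseT _ _) _ _ _ ih) => //.
- by move=> z; split=> [[]|].
- by move=> z _; apply: shK.
by move=> z i _; apply: contat_sh => l; apply: contat_coord.
Qed.

Definition xpart (z : 'I_(10 + 3) -> C) : X := (rpart z 0, rpart z 1, rpart z 2).

(** The maps s_k on pairs (h, x): since the map on x depends on [h], genericity of x along a word
    must be pulled back on both together. *)
Definition point_act (k : 'I_9) (z : 'I_(10 + 3) -> C) : 'I_(10 + 3) -> C := fun i =>
  match split i with
  | inl j => sh k (lpart z) j
  | inr j => cx (plane_act th k (lpart z) (xpart z)) j
  end.

Lemma lpart_point_act k z : lpart (point_act k z) = sh k (lpart z).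
Proof.
apply: funext => j; rewrite /lpart /point_act; case: (split_ordP (lshift 3 j)) => i.
  by move=> /lshift_inj ->.
by move/eqP; rewrite eq_lrshift.
Qed.

Lemma rpart_point_act k z j : rpart (point_act k z) j = cx (plane_act th k (lpart z) (xpart z)) j.
Proof.
rewrite /rpart /point_act; case: (split_ordP (rshift 10 j)) => i.
  by move/eqP; rewrite eq_rlshift.
by move=> /rshift_inj ->.
Qed.

Lemma xpart_point_act k z : xpart (point_act k z) = plane_act th k (lpart z) (xpart z).
Proof. by rewrite /xpart !rpart_point_act; case: (plane_act _ _ _ _) => [[]]. Qed.

Lemma parts_inj (z w : 'I_(10 + 3) -> C) : lpart z = lpart w -> xpart z = xpart w -> z = w.
Proof.
move=> hl [h0 h1 h2]; apply: funext => i; case: (split_ordP i) => j ->.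
  by have := congr1 (fun f => f j) hl.
have [->|[->| ->]] : j = 0 \/ j = 1 \/ j = 2.
  by case: j => [[|[|[|m]]] hm] //; [left|right; left|right; right]; apply: val_inj.
- exact: h0.
- exact: h1.
- exact: h2.
Qed.

(* For [k != 0] the map [plane_act k] does not preserve the torus. *)
Definition point_act_dom (k : 'I_9) (z : 'I_(10 + 3) -> C) : Prop :=
  (nondeg th (lpart z) /\ nondeg th (sh k (lpart z))) /\ (k == 0 -> tor (xpart z)).

Lemma odense_lpart (P : ('I_10 -> C) -> Prop) :
  odense P -> odense (fun z : 'I_(10 + 3) -> C => P (lpart z)).
Proof.
move=> [o d]; split.
  move=> z /o [e [e0 he]]; exists e; split=> // w hw.
  by apply: he => i; apply: hw.
move=> z e e0; have [w [hw Uw]] := d (lpart z) e e0.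
pose v (i : 'I_(10 + 3)) := match split i with inl j => w j | inr j => z i end.
exists v; split.
  move=> i; rewrite /v; case: (split_ordP i) => j ij; last by rewrite subrr normr0.
  by rewrite ij; apply: hw.
rewrite (_ : lpart v = w) //; apply: funext => j; rewrite /lpart /v.
case: (split_ordP (lshift 3 j)) => k; first by move=> /lshift_inj ->.
by move/eqP; rewrite eq_lrshift.
Qed.

Lemma odense_point_act_dom k : odense (point_act_dom k).
Proof.
apply: odenseI.
  apply: odenseI; first exact: odense_lpart odense_nondeg.
  exact: (odense_lpart (odense_nondeg_sh k)).
case: (k == 0); last by apply: odense_iff (@odenseT _ _) => z.
have h : odense (fun z : 'I_(10 + 3) -> C =>
    z (rshift 10 0) != 0 /\ (z (rshift 10 1) != 0 /\ z (rshift 10 2) != 0)).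
  by apply: odenseI; [|apply: odenseI]; apply: odense_coord.
apply: odense_iff h => z; rewrite /tor /xpart /rpart /=; split.
  by case=> h0 [h1 h2] _; rewrite h0 h1 h2.
by move=> /(_ isT) /and3P [].
Qed.

Lemma point_act_dom_stable k z : point_act_dom k z -> point_act_dom k (point_act k z).
Proof.
case=> [[h1 h2] h3]; rewrite /point_act_dom lpart_point_act xpart_point_act shK; split=> // k0.
by move: (h3 k0); rewrite (eqP k0) /plane_act /tor /= !invr_eq0.
Qed.

Lemma point_actK k z : point_act_dom k z -> point_act k (point_act k z) = z.
Proof.
case=> [[h1 h2] h3]; apply: parts_inj; first by rewrite !lpart_point_act shK.
by rewrite !xpart_point_act lpart_point_act plane_actK.
Qed.

Lemma contat_lin3 i n (g : ('I_n -> C) -> hpt R) (y w : ('I_n -> C) -> C) z :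
  (0 < i < 3)%N -> nondeg th (g z) ->
  (forall l, contat (fun v => g v l) z) -> contat y z -> contat w z ->
  contat (fun v => lin3 th i (g v) (y v) (w v)) z.
Proof.
move=> hi hB cg cy cw.
have c4 l : contat (fun v => th (alpha0 (g v) + eps2 l 4 (g v))) z.
  by apply: contat_bracket => //; apply: contatD; [exact: contat_alpha0|exact: contat_eps2].
have ce l m : contat (fun v => th (eps2 l m (g v))) z.
  by apply: contat_bracket => //; apply: contat_eps2.
rewrite /lin3; apply: contatM; last apply: contatV.
- by apply: contatB; apply: contatM => //; apply: contatM.
- by rewrite mulf_neq0 ?(nondeg_alpha0 hB) //; apply: nondeg2 => //; lia.
by apply: contatM => //; apply: contat_bracket => //; apply: contat_alpha0.
Qed.

Lemma contat_point_act k z i : point_act_dom k z -> contat (fun w => point_act k w i) z.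
Proof.
case=> [[h1 h2] h3]; rewrite /point_act; case: (split i) => j.
  by apply: contat_sh => l; apply: contat_coord.
have cx j' : contat (fun w : 'I_(10 + 3) -> C => rpart w j') z by apply: contat_coord.
have cl l : contat (fun w : 'I_(10 + 3) -> C => lpart w l) z by apply: contat_coord.
move: h3; rewrite -val_eqE /plane_act /xpart.
case: k h1 h2 => [[|[|[|[|k]]]] hk] h1 h2 h3; case: j => [[|[|[|j]]] hj] //=.
all: try exact: cx.
- by case/and3P: (h3 isT) => h _ _; apply: contatV.
- by case/and3P: (h3 isT) => _ h _; apply: contatV.
- by case/and3P: (h3 isT) => _ _ h; apply: contatV.
- exact: contat_lin3.
- exact: contat_lin3.
Qed.

Lemma generic_tor_along w : generic (fun z : 'I_(10 + 3) -> C => tor_along th w (lpart z) (xpart z)).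
Proof.
elim: w => [|k w ih] /=; first exact: genericT.
have ht : odense (fun z : 'I_(10 + 3) -> C => z (rshift 10 0) != 0 /\
    (z (rshift 10 1) != 0 /\ z (rshift 10 2) != 0)).
  by apply: odenseI; [|apply: odenseI]; apply: odense_coord.
have := generic_pull (odense_point_act_dom k) (@point_act_dom_stable k) (@point_actK k) (fun z i => @contat_point_act k z i) ih.
move/(genericI (odense_generic ht)); apply: generic_sub => z [[h0 [h1' h2']] [_]].
by rewrite lpart_point_act xpart_point_act; split=> //; apply/and3P; split.
Qed.

End GenericWords.

(** * F and phi are proportional *)

Section Proportionality.
Variable R : realType.
Local Notation C := R[i].
Variable th : C -> C.
Hypothesis br : bracket_fn th.

(** For each fixed [h] all these conditions hold for generic t, as they only involve brackets of
    expressions moving at unit speed in t. *)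
Lemma exists_time_along (ws : seq (seq 'I_9)) (v : lat) (h : hpt R) : exists t,
  (forall w, w \in ws -> time_along th w h t) /\ th (ipC v h - t) != 0.
Proof.
have dir : exists u : 'I_1 -> C, forall (z : 'I_1 -> C) c,
    h = h /\ z ord0 + c * u ord0 = z ord0 - c.
  by exists (fun=> -1) => z c; rewrite mulrN1.
have gv : odense (fun z : 'I_1 -> C => th (ipC v h - z ord0) != 0).
  apply: odense_bracket => //.
    by move=> z; apply: contatB; [apply: contat_cst|apply: contat_coord].
  by case: dir => u hu; exists u => z c; have [_ ->] := hu z c; rewrite opprB; ring.
have gw : odense (fun z : 'I_1 -> C => forall w, w \in ws -> time_along th w h (z ord0)).
  elim: ws => [|w ws ih]; first by apply: odense_iff (@odenseT _ _).
  have o1 : odense (fun z : 'I_1 -> C => time_along th w h (z ord0)).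
    by apply: (@odense_time_along _ _ br 1 w (fun=> h) (fun z => z ord0)) => // z *; [apply: contat_cst|apply: contat_coord].
  apply: odense_iff (odenseI o1 ih) => z; split=> [[h1 h2] w'|hz].
    by rewrite inE => /orP [/eqP ->|/h2].
  by split=> [|w' hw]; apply: hz; rewrite inE ?eqxx ?hw ?orbT.
have [z [hz1 hz2]] := generic_exists (odense_generic (odenseI gw gv)).
by exists (z ord0).
Qed.

Lemma time_along_eps w h t (j : 'I_9) : time_along th w h t -> th (eps j.+1 h - t) != 0.
Proof. by case: w => [|k w] [[]]. Qed.

Lemma bprod_neq0 w L h t : time_along th w h t -> bprod th L h t != 0.
Proof.
move=> hT; rewrite /bprod; elim/big_ind: _ => [||j _]; first exact: oner_neq0.
  by move=> x y; apply: mulf_neq0.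
exact/expfz_neq0/(time_along_eps _ hT).
Qed.

Variables (w0 : seq 'I_9) (c0 : expo -> hpt R -> C).
Local Notation L := (actZ w0 (evec 9)).
Local Notation d := (degL L).
Hypothesis cV : forall h, nondeg_along th w0 h -> linsys th L h (c0^~ h).
Hypothesis cX : forall h t, nondeg_along th w0 h -> time_along th w0 h t ->
  hp d (c0^~ h) (xC th h t) = th (ipC L h - t) * bprod th L h t.

Lemma phi_neq0 h : nondeg_along th w0 h -> exists2 m, m \in mons d & c0 m h != 0.
Proof.
move=> hG; have [t [hT ht]] := exists_time_along [:: w0] L h.
have hT0 := hT w0 (mem_head _ _).
by apply: (@hp_neq0 _ d (c0^~ h) (xC th h t)); rewrite cX // mulf_neq0 // (bprod_neq0 _ hT0).
Qed.

Lemma Fcoef_phi h : nondeg_along th w0 h -> exists2 b, b != 0 &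
  forall m, m \in mons d -> Fcoef th L h m = b * c0 m h.
Proof.
move=> hG; have [m1 hm1 n1] := phi_neq0 hG.
have hL : Minv L by apply/Minv_actZ/(Minv_evec ord_max).
have F1 := Fcoef_neq0 br hG (cV hG) hm1 n1.
have [u [v [uv huv]]] := linsys_dim1 br hG (cV hG) (linsys_Fcoef hL).
have v0 : v != 0.
  apply/eqP => v0; move: uv; rewrite v0 eqxx orbF => u0.
  by have /eqP := huv _ hm1; rewrite v0 mul0r addr0 mulf_eq0 (negPf u0) (negPf n1).
have bE m : m \in mons d -> Fcoef th L h m = - u / v * c0 m h.
  move=> /huv /eqP; rewrite addrC addr_eq0 => /eqP e; apply: (mulfI v0); rewrite e.
  by field.
exists (- u / v) => //; apply/eqP => b0.
by move: F1; rewrite bE // b0 mul0r eqxx.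
Qed.

(** Two forms of the line with the same nonzero value at one point of x^C coincide. *)
Lemma phi_uniq w c h : actZ w (evec 9) = L -> nondeg_along th w0 h -> nondeg_along th w h ->
  linsys th L h (c^~ h) ->
  (forall t, time_along th w h t -> hp d (c^~ h) (xC th h t) = th (ipC L h - t) * bprod th L h t) ->
  forall m, m \in mons d -> c m h = c0 m h.
Proof.
move=> eL hG hG' hV hX.
have [t [hT ht]] := exists_time_along [:: w0; w] L h.
have hT0 : time_along th w0 h t by apply: hT; rewrite mem_head.
have hT1 : time_along th w h t by apply: hT; rewrite !inE eqxx orbT.
have [u [v [uv huv]]] := linsys_dim1 br hG (cV hG) hV.
have V0 : th (ipC L h - t) * bprod th L h t != 0 by rewrite mulf_neq0 // (bprod_neq0 _ hT0).
have : hp d (fun m => u * c0 m h + v * c m h) (xC th h t) = 0.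
  by rewrite /hp big_seq big1 // => m /huv ->; rewrite mul0r.
rewrite hp_lin cX // hX // -mulrDl => /eqP; rewrite mulf_eq0 (negPf V0) orbF addr_eq0 => /eqP uE.
have v0 : v != 0 by move: uv; rewrite uE oppr_eq0 orbb.
move=> m /huv; rewrite uE mulNr addrC => /eqP; rewrite subr_eq0 => /eqP; exact: mulfI.
Qed.

End Proportionality.

(** The coordinates (h, x) among (h, tau_0, x, tau). *)
Definition proj22 (i : 'I_(10 + 3)) : 'I_(10 + (1 + (3 + 9))) :=
  match split i with
  | inl j => lshift _ j
  | inr j => rshift 10 (rshift 1 (lshift 9 j))
  end.

Lemma proj22_inj : injective proj22.
Proof.
move=> i j; rewrite /proj22; case: (split_ordP i) => a ->; case: (split_ordP j) => b -> h.
- by rewrite (lshift_inj h).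
- by move/eqP: h; rewrite eq_lrshift.
- by move/eqP: h; rewrite eq_rlshift.
- by rewrite (lshift_inj (rshift_inj (rshift_inj h))).
Qed.

Lemma inM_word L : inM L -> exists w, actZ w (evec 9) = L.
Proof.
case=> w [j hw]; have [w' hw'] := actZ_evec j.
by exists (w ++ w'); rewrite /actZ foldr_cat -/(actZ w' _) hw'; apply: funext.
Qed.

Theorem theorem5 (R : realType) (th : R[i] -> R[i]) :
  bracket_fn th ->
  forall L : lat, inM L ->
  exists c : hpt R -> R[i],
    [/\ inK th c,
        ~ generic (fun h : hpt R => c h = 0),
        (* F(Lambda; x^C(t)) = C_Lambda [lambda - t] prod_j [eps_j - t]^{nu_j} *)
        generic (fun z : 'I_(10 + 1) -> R[i] =>
          let h := lpart z in let t := rpart z ord0 in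
          FL th L h (xC th h t)
          = c h * th (ipC L h - t)
                * \prod_(1 <= j < 10) th (eps j h - t) ^ nuL L j) &
        (* phi(Lambda; x) = C_Lambda^{-1} F(Lambda; x), where
           tau(Lambda) = w(tau_9) = tau_0^d tau_1^{-nu_1}..tau_9^{-nu_9} phi(Lambda;x)
           under f_i = tau_0 x_i / (tau_1 tau_2 tau_3) *)
        forall w : seq 'I_9, actZ w (evec 9) =1 L ->
        generic (fun z : 'I_(10 + (1 + (3 + 9))) -> R[i] =>
          let h := lpart z in
          let tau0 := lpart (rpart z) ord0 in
          let x := lpart (rpart (rpart z)) in
          let tau := rpart (rpart (rpart z)) in
          tauw th w h (fun i => tau0 * x i / (tau 0 * tau 1 * tau 2)) tau
          = tau0 ^ (L ord0)
            * (\prod_(j < 9) tau j ^ (L (lift ord0 j)))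
            * (c h)^-1 * FL th L h (x 0, x 1, x 2))].
Proof.
move=> br _ /inM_word [w0 <-]; set L := actZ w0 (evec 9).
have hL : Minv L by apply/Minv_actZ/(Minv_evec ord_max).
have [c0 [cK cV cX _]] := phi_exists br w0; rewrite -/L in cV cX.
pose c := kratio c0 (fun m h => Fcoef th L h m) (mons (degL L)).
have cP h : nondeg_along th w0 h -> c h != 0 /\ forall x, FL th L h x = c h * hp (degL L) (c0^~ h) x.
  move=> hG; have [b b0 hb] := Fcoef_phi br cV cX hG.
  have -> : c h = b by apply: kratioE => //; apply: (phi_neq0 br cX).
  split=> // x; rewrite FL_hp // /hp mulr_sumr big_seq [RHS]big_seq.
  by apply: eq_bigr => m /hb ->; rewrite mulrA.
have gG w : generic (fun z : 'I_10 -> R[i] => nondeg_along th w z) by apply/odense_generic/odense_nondeg_along.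
exists c; split.
- by apply: inK_kratio => // m; apply: inK_Fcoef.
(* Two generic conditions have a common point, and there [c] would be both zero and nonzero. *)
- by move=> /(genericI (gG w0)) /generic_exists [h [/cP [/eqP h1 _] h2]].
- have gh : generic (fun z : 'I_(10 + 1) -> R[i] => nondeg_along th w0 (lpart z)).
    exact: (generic_proj (@lshift_inj 10 1) (gG w0)).
  have gt : generic (fun z : 'I_(10 + 1) -> R[i] => time_along th w0 (lpart z) (rpart z ord0)).
    apply: odense_generic; apply: odense_time_along => //.
    + by move=> z i; apply: contat_coord.
    + by move=> z; apply: contat_coord.
    exists (fun i => - (i == rshift 10 (ord0 : 'I_1))%:R) => z s; split.
      by apply: funext => i; rewrite /lpart eq_lrshift oppr0 mulr0 addr0.
    by rewrite /rpart eqxx mulrN1.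
  apply: generic_sub (genericI gh gt) => z [hG hT] /=.
  have [_ ->] := cP _ hG; rewrite cX // mulrA; congr (_ * _).
  rewrite (@big_nat_1_10 _ _ *%R) /bprod; apply: eq_bigr => j _.
  by rewrite nuLS.
move=> w /funext hw; have [cw [_ cV' cX' cT]] := phi_exists br w.
rewrite hw -/L in cV' cX' cT.
have gh w' : generic (fun z : 'I_(10 + (1 + (3 + 9))) -> R[i] => nondeg_along th w' (lpart z)).
  exact: (generic_proj (@lshift_inj 10 _) (gG w')).
have gx : generic (fun z : 'I_(10 + (1 + (3 + 9))) -> R[i] =>
    tor_along th w (lpart (fun i => z (proj22 i))) (xpart (fun i => z (proj22 i)))).
  exact: (generic_proj proj22_inj (generic_tor_along br w)).
have gc : generic (fun z : 'I_(10 + (1 + (3 + 9))) -> R[i] => forall i, z i != 0).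
  by apply/odense_generic/odense_forall => i; apply: odense_coord.
apply: generic_sub (genericI (genericI (gh w0) (gh w)) (genericI gx gc)) => z [[hG hG'] [hX hz]] /=.
have pl : lpart (fun i => z (proj22 i)) = lpart z.
  apply: funext => i; rewrite /lpart /proj22; case: (split_ordP (lshift 3 i)) => j.
    by move=> /lshift_inj ->.
  by move/eqP; rewrite eq_lrshift.
have pr i : rpart (fun i => z (proj22 i)) i = lpart (rpart (rpart z)) i.
  rewrite /lpart /rpart /proj22; case: (split_ordP (rshift 10 i)) => j.
    by move/eqP; rewrite eq_rlshift.
  by move=> /rshift_inj ->.
move: hX; rewrite pl /xpart !pr => hX.
have [n0 ->] := cP _ hG.
set x := lpart (rpart (rpart z)) in hX *.
set tau := rpart (rpart (rpart z)); set t0 := lpart (rpart z) ord0.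
have -> : (fun i => t0 * x i / (tau 0 * tau 1 * tau 2)) = f_of_x t0 (x 0, x 1, x 2) tau.
  apply: funext => i; rewrite /f_of_x; congr (_ * _ / _).
  by case: i => [[|[|[|i]]] hi] //=; congr x; apply: val_inj.
rewrite cT //; [|exact: hz|by move=> j; apply: hz].
rewrite /Lmon -[RHS]mulrA mulKf //; congr (_ * _).
(* The form built from [w] is compared with the one from [w0], for which the constant [c] was
   defined. *)
apply: hp_ext => m hm; apply: (phi_uniq br cV cX hw hG hG') => //.
  exact: cV'.
by move=> t; apply: cX'.
Qed.
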